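(* Let $k \geq 0$ be an integer with $k \neq 1$. (1) If two twice-marked graphs $(\Gamma_1, v_1, w_1)$ and $(\Gamma_2, v_2, w_2)$ both have $k$-general transmission, then so does their vertex gluing $(\Gamma, v_1, w_2)$. (2) A twice-marked graph $(\Gamma, v, w)$ of genus $1$ with $v \not\sim w$ has $k$-general transmission if and only if it has torsion order $k$. (3) In particular, a chain of $k$-torsion loops has $k$-general transmission.
   Context: Graphs. The word ''graph'' means either a connected metric graph, or a finite connected graph (parallel edges allowed) with no loop edges; ''points'' are all points of a metric graph, respectively the vertices of a finite graph. A divisor is a $\mathbb{Z}$-linear combination of points; it is effective if all coefficients are nonnegative. Linear equivalence $\sim$ is the usual one (chip-firing for finite graphs; differing by the divisor of a continuous piecewise-linear function with integer slopes for metric graphs). $r(D)$ is the Baker--Norine rank: $r(D) = -1$ if $D$ is not equivalent to an effective divisor, and otherwise $r(D)$ is the largest $r \ge 0$ such that $D - E$ is equivalent to an effective divisor for every effective $E$ of degree $r$. The genus $g$ is the first Betti number, and $K_\Gamma=\sum_p (\mathrm{val}(p)-2)p$ is the canonical divisor. A twice-marked graph $(\Gamma, v, w)$ is a graph with two chosen points. Vertex gluing. The vertex gluing of $(\Gamma_1, v_1, w_1)$ and $(\Gamma_2, v_2, w_2)$ (both finite or both metric) is $(\Gamma, v_1, w_2)$, where $\Gamma$ is obtained from the disjoint union of $\Gamma_1$ and $\Gamma_2$ by identifying $w_1$ with $v_2$. Submodularity. For a divisor $D$ on $(\Gamma, v, w)$ put $\Delta(D) = r(D) - r(D-v) - r(D-w)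 + r(D-v-w)$. $D$ is submodular (with respect to $v,w$) if $\Delta(D + av - bw) \geq 0$ for all $a,b \in \mathbb{Z}$. Transmission permutation. The transmission permutation of $D$ on $(\Gamma, v, w)$, if it exists, is the unique permutation $\tau^{v,w}_D : \mathbb{Z} \to \mathbb{Z}$ such that the following two (equivalent) equations hold for all $a, b \in \mathbb{Z}$: $r(D + av - bw) + 1 = \#\{ n \geq b : \tau^{v,w}_D(n) \leq a\}$ and $r(K_\Gamma - D - av + bw) + 1 = \#\{ n < b : \tau^{v,w}_D(n) > a \}$. It exists exactly when $D$ is submodular. Groups and inversions. $\widetilde{\Sigma}_0$ is the group of permutations of $\mathbb{Z}$ with finitely many inversions; for $k \geq 2$, $\widetilde{\Sigma}_k$ is the group of permutations $\alpha$ of $\mathbb{Z}$ with $\alpha(n+k) = \alpha(n)+k$ for all $n$. An inversion of $\alpha$ is a pair $(x,y)\in\mathbb{Z}^2$ with $x<y$ and $\alpha(x) > \alpha(y)$. For $\alpha \in \widetilde{\Sigma}_k$, two inversions $(x,y), (x',y')$ are $k$-equivalent if $(x',y') = (x+nk, y+nk)$ for some $n \in \mathbb{Z}$; $\operatorname{inv}_k(\alpha)$ is the number of $k$-equivalence classes of inversions of $\alpha$ (so $\operatorname{inv}_0(\alpha)$ is the number of inversions). $k$-general transmission. For $k \geq 0$, $k\neq 1$, a genus-$g$ twice-marked graph $(\Gamma, v, w)$ has $k$-general transmission if every divisor $D$ on $\Gamma$ is submodular and satisfies $\tau^{v,w}_D \in \widetilde{\Sigma}_k$ and $\operatorname{inv}_k(\tau^{v,w}_D)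 \leq g$. Torsion order. For a twice-marked graph $(\Gamma, v, w)$ of genus $1$ with $v \not\sim w$, the torsion order is the nonnegative integer $k$ such that $nv \sim nw$ if and only if $n \in k\mathbb{Z}$. A chain of $k$-torsion loops is an iterated vertex gluing of one or more twice-marked cycles (each a genus-$1$ graph consisting of a single loop), each of torsion order $k$. *)

(* Defs.v *)
From HB Require Import structures.
From mathcomp Require Import all_boot all_order all_algebra.
From mathcomp Require Import boolp classical_sets cardinality reals.
From mathcomp.multinomials Require Import freeg.

Set Implicit Arguments.
Unset Strict Implicit.
Unset Printing Implicit Defensive.

Import Order.TTheory GRing.Theory Num.Theory.

Local Open Scope ring_scope.
Local Open Scope classical_set_scope.
Local Open Scope card_scope.

Section DivisorTheory.

(* What a twice-marked graph, finite or metric, provides in order to speak of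
   ranks and transmission permutations.  A divisor is an element of
   [{freeg point T}], the free abelian group on the points. *)
Record divisor_theory := DivisorTheory {
  point : choiceType;
  lin_equiv : {freeg point} -> {freeg point} -> Prop;
  canonical : {freeg point};
  genus : nat;
  vpt : point;
  wpt : point
}.

Variable T : divisor_theory.
Implicit Types (D E : {freeg (point T)}) (a b : int) (tau : int -> int).

Definition effective D : Prop := forall p, 0 <= coeff p D.

Definition equiv_effective D : Prop :=
  exists2 E, effective E & lin_equiv D E.

Definition rank_at_least D (r : nat) : Prop :=
  forall E, effective E -> deg E = r%:Z -> equiv_effective (D - E).

(* The default value 0 of [xget] is never used: [r <= deg D] for every such
   [r], so that a largest one exists. *)
Definition rank D : int :=
  if `[< equiv_effective D >] then
    (xget 0%N [set r | rank_at_least D r /\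
                       forall s, rank_at_least D s -> (s <= r)%N])%:Z
  else -1.

Definition twist D a b : {freeg (point T)} :=
  D + << vpt T >> *~ a - << wpt T >> *~ b.

Definition Delta D : int :=
  rank D - rank (D - << vpt T >>) - rank (D - << wpt T >>)
  + rank (D - << vpt T >> - << wpt T >>).

Definition submodular D : Prop := forall a b, 0 <= Delta (twist D a b).

Definition has_card (A : set int) (m : int) : Prop :=
  exists2 n : nat, m = n%:Z & A #= `I_n.

Definition transmission_permutation D tau : Prop :=
  [/\ bijective tau,
      forall a b, has_card [set n : int | b <= n /\ tau n <= a]
                           (rank (twist D a b) + 1)
    & forall a b, has_card [set n : int | n < b /\ a < tau n]
                           (rank (twist (canonical T - D) (- a) (- b)) + 1)].

End DivisorTheory.

Definition inversions (alpha : int -> int) : set (int * int) :=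
  [set p | p.1 < p.2 /\ alpha p.2 < alpha p.1].

(* Membership of a permutation in the group of index [k], for [k != 1]. *)
Definition in_Sigma (k : nat) (alpha : int -> int) : Prop :=
  if k is 0%N then finite_set (inversions alpha)
  else forall n, alpha (n + k%:Z) = alpha n + k%:Z.

Definition k_equivalent (k : nat) (p q : int * int) : Prop :=
  exists n : int, q = (p.1 + n * k%:Z, p.2 + n * k%:Z).

Definition inversion_classes (k : nat) (alpha : int -> int)
    : set (set (int * int)) :=
  [set C | exists2 p, inversions alpha p &
           C = [set q | inversions alpha q /\ k_equivalent k p q]].

Definition inv_at_most (k : nat) (alpha : int -> int) (g : nat) : Prop :=
  inversion_classes k alpha #<= `I_g.

Definition k_general_transmission (k : nat) (T : divisor_theory) : Prop :=
  forall D : {freeg (point T)},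
    submodular D /\
    exists tau, [/\ transmission_permutation D tau, in_Sigma k tau
                  & inv_at_most k tau (genus T)].

(* For [k != 1] this forces [v] and [w] to be inequivalent. *)
Definition torsion_order (T : divisor_theory) (k : nat) : Prop :=
  forall n : int,
    lin_equiv (<< vpt T >> *~ n) (<< wpt T >> *~ n) <->
    (exists m : int, n = m * k%:Z).

(* The half-edge [(e, b)] is the end of [e] that is attached at
   [endpoint e b]; the orientation of edges given by [b] plays no role. *)
Definition adjacent (V E : finType) (endpoint : E -> bool -> V) : rel V :=
  fun x y => [exists d : E * bool,
    (endpoint d.1 d.2 == x) && (endpoint d.1 (~~ d.2) == y)].

(* A connected multigraph, parallel edges and loops allowed, with two chosen
   vertices. *)
Record marked_multigraph := MarkedMultigraph {
  vertex : finType;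
  edge : finType;
  endpoint : edge -> bool -> vertex;
  vmark : vertex;
  wmark : vertex;
  multigraph_connected : forall x y, connect (adjacent endpoint) x y
}.

Section Multigraph.
Variable G : marked_multigraph.

Definition half_edges (x : vertex G) : seq (edge G * bool) :=
  [seq d <- enum {: edge G * bool} | endpoint d.1 d.2 == x].

Definition valence (x : vertex G) : nat := size (half_edges x).

Definition boundary : 'M[rat]_(#|edge G|, #|vertex G|) :=
  \matrix_(i, j) ((endpoint (enum_val i) true == enum_val j)%:R
                  - (endpoint (enum_val i) false == enum_val j)%:R).

(* The dimension of the first homology with rational coefficients. *)
Definition betti1 : nat := \rank (kermx boundary).

Definition is_loop : Prop := betti1 = 1%N /\ forall x, valence x = 2%N.

End Multigraph.

Section Glue.
Variables G1 G2 : marked_multigraph.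

Definition glue_vertex : finType :=
  (vertex G1 + {x : vertex G2 | x != vmark G2})%type.

Definition glue_inl (x : vertex G1) : glue_vertex := inl x.

Definition glue_inr (x : vertex G2) : glue_vertex :=
  if insub x is Some y then inr y else inl (wmark G1).

Definition glue_endpoint (e : edge G1 + edge G2) (b : bool) : glue_vertex :=
  match e with
  | inl e1 => glue_inl (endpoint e1 b)
  | inr e2 => glue_inr (endpoint e2 b)
  end.

Lemma glue_inr_mark : glue_inr (vmark G2) = glue_inl (wmark G1).
Proof. by rewrite /glue_inr insubF // eqxx. Qed.

Lemma glue_inr_val (y : {x : vertex G2 | x != vmark G2}) :
  glue_inr (val y) = inr y.
Proof. by rewrite /glue_inr valK. Qed.

Lemma glue_connected x y : connect (adjacent glue_endpoint) x y.
Proof.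
have homo (V W : finType) (e : rel V) (e' : rel W) (f : V -> W) :
    (forall a b, e a b -> e' (f a) (f b)) ->
    forall a b, connect e a b -> connect e' (f a) (f b).
  move=> ef a b /connectP[s + ->]; elim: s a => [|c s IHs] a //=.
  by case/andP=> /ef/connect1 ac /IHs; apply: connect_trans.
have cl a b : connect (adjacent glue_endpoint) (glue_inl a) (glue_inl b).
  apply: (homo _ _ (adjacent (@endpoint G1))); last exact: multigraph_connected.
  move=> {}a {}b /existsP[[e i] /= /andP[/eqP<- /eqP<-]].
  by apply/existsP; exists (inl e, i); rewrite /= !eqxx.
have cr a b : connect (adjacent glue_endpoint) (glue_inr a) (glue_inr b).
  apply: (homo _ _ (adjacent (@endpoint G2))); last exact: multigraph_connected.
  move=> {}a {}b /existsP[[e i] /= /andP[/eqP<- /eqP<-]].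
  by apply/existsP; exists (inr e, i); rewrite /= !eqxx.
case: x y => [x|x] [y|y].
- exact: cl.
- by rewrite -glue_inr_val; apply: connect_trans (cr (vmark G2) _);
    rewrite glue_inr_mark; apply: cl.
- by rewrite -glue_inr_val; apply: connect_trans (cr _ (vmark G2)) _;
    rewrite glue_inr_mark; apply: cl.
- by rewrite -!glue_inr_val; apply: cr.
Qed.

(* The disjoint union with [wmark G1] and [vmark G2] identified; the vertex
   [vmark G2] is removed and [wmark G1] stands for both. *)
Definition glue_multigraph : marked_multigraph :=
  {| multigraph_connected := glue_connected;
     vmark := glue_inl (vmark G1); wmark := glue_inr (wmark G2) |}.

End Glue.

Record finite_graph := FiniteGraph {
  fgraph :> marked_multigraph;
  loopless : forall e : edge fgraph, endpoint e false != endpoint e true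
}.

Section FiniteGraph.
Variable G : finite_graph.

Definition finite_divisor (f : vertex G -> int) (x : vertex G) : int :=
  \sum_(d <- half_edges x) (f (endpoint d.1 (~~ d.2)) - f x).

Definition finite_lin_equiv (D D' : {freeg (vertex G)}) : Prop :=
  exists f, forall x, coeff x (D - D') = finite_divisor f x.

Definition finite_canonical : {freeg (vertex G)} :=
  \sum_(x : vertex G) << ((valence x)%:Z - 2) *g x >>.

Definition finite_theory : divisor_theory :=
  {| lin_equiv := finite_lin_equiv; canonical := finite_canonical;
     genus := betti1 G; vpt := vmark G; wpt := wmark G |}.

End FiniteGraph.

Lemma glue_loopless (G1 G2 : finite_graph)
    (e : edge (glue_multigraph G1 G2)) :
  endpoint e false != endpoint e true.
Proof.
case: e => e /=.
  by apply: contra (loopless e) => /eqP[->].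
have := loopless e; rewrite /glue_inr; apply: contra => /eqP.
case: insubP => [x _ <-|/negPn/eqP->]; case: insubP => [y _ <-|/negPn/eqP->] //.
by case=> ->.
Qed.

Definition finite_glue (G1 G2 : finite_graph) : finite_graph :=
  FiniteGraph (@glue_loopless G1 G2).

(* A metric graph is given by a model: a connected multigraph with positive
   edge lengths, the edge [e] being a copy of the segment [0, len e].  Models
   are chosen so that the two marked points are vertices. *)
Record metric_graph (R : realType) := MetricGraph {
  mgraph :> marked_multigraph;
  len : edge mgraph -> R;
  len_gt0 : forall e, 0 < len e
}.

Section MetricGraph.
Variables (R : realType) (G : metric_graph R).

(* The points are the vertices and the interior points [(e, t)] of edges,
   [t] being the distance from [endpoint e false] along [e]. *)
Definition mpoint : choiceType :=
  (vertex G + {x : edge G * R | 0 < x.2 < len x.1})%type.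

(* For [t] in [0, len e]. *)
Definition edge_point (e : edge G) (t : R) : mpoint :=
  if insub (e, t) is Some x then inr x else inl (endpoint e (0 < t)).

(* The point of [e] at distance [s] from the end [(e, b)]. *)
Definition point_from (e : edge G) (b : bool) (s : R) : mpoint :=
  edge_point e (if b then len e - s else s).

(* The tangent directions at a point: [(e, b, s)] is the direction at
   [point_from e b s] along [e], away from the end [(e, b)]. *)
Definition directions (p : mpoint) : seq (edge G * bool * R) :=
  match p with
  | inl x => [seq (d, 0) | d <- half_edges x]
  | inr y => let: (e, t) := val y in
             [:: (e, false, t); (e, true, len e - t)]
  end.

(* [g] is continuous and piecewise linear with integer slopes on [a, b];
   continuity holds because the pieces are closed segments. *)
Inductive pl_on (g : R -> R) : R -> R -> Prop :=
| pl_linear a b (m : int) of a < b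
    & (forall t, a <= t <= b -> g t = g a + m%:~R * (t - a)) : pl_on g a b
| pl_concat a b c of pl_on g a b & pl_on g b c : pl_on g a c.

Definition rational (f : mpoint -> R) : Prop :=
  forall e, pl_on (fun t => f (edge_point e t)) 0 (len e).

(* The slope of [g] immediately to the right of [s], if it is an integer. *)
Definition right_slope (g : R -> R) (s : R) : int :=
  xget 0 [set m : int | exists2 h, 0 < h &
    forall t, 0 <= t <= h -> g (s + t) = g s + m%:~R * t].

Definition metric_divisor (f : mpoint -> R) (p : mpoint) : int :=
  \sum_(d <- directions p)
    right_slope (fun s => f (point_from d.1.1 d.1.2 s)) d.2.

Definition metric_lin_equiv (D D' : {freeg mpoint}) : Prop :=
  exists2 f, rational f & forall p, coeff p (D - D') = metric_divisor f p.

(* Interior points of edges have valence 2 and do not contribute. *)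
Definition metric_canonical : {freeg mpoint} :=
  \sum_(x : vertex G) << ((valence x)%:Z - 2) *g (inl x : mpoint) >>.

Definition metric_theory : divisor_theory :=
  {| lin_equiv := metric_lin_equiv; canonical := metric_canonical;
     genus := betti1 G; vpt := inl (vmark G) : mpoint; wpt := inl (wmark G) |}.

End MetricGraph.

Section MetricGlue.
Variables (R : realType) (G1 G2 : metric_graph R).

Definition glue_len (e : edge (glue_multigraph G1 G2)) : R :=
  match e with inl e1 => len e1 | inr e2 => len e2 end.

Lemma glue_len_gt0 e : 0 < glue_len e.
Proof. by case: e => e; apply: len_gt0. Qed.

Definition metric_glue : metric_graph R := MetricGraph glue_len_gt0.

End MetricGlue.

Variant graph_kind := Finite_kind | Metric_kind.

Definition marked_graph (R : realType) (c : graph_kind) : Type :=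
  match c with
  | Finite_kind => finite_graph
  | Metric_kind => metric_graph R
  end.

Definition multigraph_of (R : realType) (c : graph_kind)
    : marked_graph R c -> marked_multigraph :=
  match c with
  | Finite_kind => fun G => fgraph G
  | Metric_kind => fun G => mgraph G
  end.

Definition theory_of (R : realType) (c : graph_kind)
    : marked_graph R c -> divisor_theory :=
  match c with
  | Finite_kind => fun G => finite_theory G
  | Metric_kind => fun G => metric_theory G
  end.

Definition vertex_gluing (R : realType) (c : graph_kind)
    : marked_graph R c -> marked_graph R c -> marked_graph R c :=
  match c with
  | Finite_kind => fun G1 G2 => finite_glue G1 G2
  | Metric_kind => fun G1 G2 => metric_glue G1 G2
  end.

Inductive torsion_loop_chain (R : realType) (c : graph_kind) (k : nat)
    : marked_graph R c -> Prop :=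
| one_loop G of is_loop (multigraph_of G) & torsion_order (theory_of G) k :
    torsion_loop_chain k G
| glue_chains G1 G2 of torsion_loop_chain k G1 & torsion_loop_chain k G2 :
    torsion_loop_chain k (vertex_gluing G1 G2).

(* Main.v *)
(* Vertex gluing.  A divisor D1 + D2 on the wedge of two graphs at w1 = v2 is
   equivalent to an effective one if and only if D1 + m w1 and D2 - m v2 are for
   some m.  Hence r(D1 + D2) + 1 is the minimum over l of
   (r(D1 - (l + 1) w1) + 1) + (r(D2 + l v2) + 1).  In terms of transmission
   permutations this min-plus product is the Demazure product, which stays
   within the k-periodic permutations and is subadditive for the number of
   inversion classes.  The same formula applied to the residual divisors gives
   the second rank condition, so that Riemann-Roch is never needed.

   Genus one.  The position around the cycle, modulo its length L, is a complete
   invariant of degree 0 divisors for linear equivalence and is onto on points;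
   the canonical divisor has position 0.  So r(D) = deg D - 1 if deg D > 0, and
   the transmission permutation of D is a translation composed with the
   transpositions of b - 1 and b for those b with D + (b - deg D) v - b w ~ 0.
   These b form a coset of the torsion subgroup, or the empty set. *)
From HB Require Import structures.
From mathcomp Require Import all_boot all_order all_algebra.
From mathcomp Require Import boolp classical_sets functions cardinality reals.
From mathcomp.multinomials Require Import freeg.
From mathcomp Require Import zify ring lra.

Require Import Defs.

Set Implicit Arguments.
Unset Strict Implicit.
Unset Printing Implicit Defensive.

Import Order.TTheory GRing.Theory Num.Theory.

Local Open Scope ring_scope.

(** * Ranks *)

Section RankTheory.

(** The two counts in the definition of a transmission permutation are both carried through the
    induction behind the Demazure product. Multiplying by a reflection on the right replaces a
    count, at a cut that separates a swapped pair, by the minimum of the counts at the two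
    neighbouring cuts, one of them raised by 1; a minimum over l commutes with such a minimum. The
    residual formula fits because the canonical divisor of the wedge is K1 + K2 + 2q with q the
    glued point, and the 2q is absorbed by the substitution of -l for l. The condition k <> 1 says
    that n and n + 1 are never congruent modulo k, so that the transpositions of n and n + 1, for n
    in one residue class, are disjoint. Congruence modulo 0 is equality, and k = 0 needs no separate
    treatment. In genus one the graph may carry trees outside its cycle. Equivalences are produced
    by an explicit potential: a flow with the prescribed divergence is corrected by a multiple of
    the cycle until its integral round the cycle vanishes. Rational lengths 1 give finite graphs,
    real lengths metric ones. *)

Record good_theory (T : divisor_theory) : Prop := GoodTheory {
  lin_equivB : forall D D' : {freeg (point T)},
    lin_equiv D D' <-> lin_equiv (D - D') 0;
  lin_equiv00 : lin_equiv (0 : {freeg (point T)}) 0;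
  lin_equiv0B : forall D D' : {freeg (point T)},
    lin_equiv D 0 -> lin_equiv D' 0 -> lin_equiv (D - D') 0;
  lin_equiv0_deg : forall D : {freeg (point T)}, lin_equiv D 0 -> deg D = 0
}.

Variables (T : divisor_theory) (gT : good_theory T).
Implicit Types (D E F : {freeg (point T)}).

Lemma lin_equiv0N D : lin_equiv D 0 -> lin_equiv (- D) 0.
Proof.
by move=> D0; rewrite -sub0r; apply: lin_equiv0B => //; apply: lin_equiv00.
Qed.

Lemma lin_equiv0D D E : lin_equiv D 0 -> lin_equiv E 0 -> lin_equiv (D + E) 0.
Proof.
by move=> D0 E0; rewrite -[E]opprK; apply: lin_equiv0B => //; apply: lin_equiv0N.
Qed.

Lemma lin_equiv_trans D E F : lin_equiv D E -> lin_equiv E F -> lin_equiv D F.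
Proof.
move=> /(lin_equivB gT) DE /(lin_equivB gT) EF; apply/(lin_equivB gT).
by have := lin_equiv0D DE EF; rewrite addrA subrK.
Qed.

Lemma lin_equivDr D E F : lin_equiv D E -> lin_equiv (D + F) (E + F).
Proof.
move=> /(lin_equivB gT) DE; apply/(lin_equivB gT).
by rewrite opprD addrACA subrr addr0.
Qed.

Lemma lin_equiv_deg D E : lin_equiv D E -> deg D = deg E.
Proof.
move=> /(lin_equivB gT) /(lin_equiv0_deg gT).
by rewrite degB => /eqP; rewrite subr_eq0 => /eqP.
Qed.

Lemma effective0 : effective (0 : {freeg (point T)}).
Proof. by move=> p; rewrite coeff0. Qed.

Lemma effectiveD D E : effective D -> effective E -> effective (D + E).
Proof. by move=> hD hE p; rewrite coeffD addr_ge0. Qed.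

Lemma effective_point p (n : nat) : effective (<< n%:Z *g p >> : {freeg (point T)}).
Proof. by move=> q; rewrite coeffU mulr_ge0. Qed.

Lemma effective_deg_ge0 D : effective D -> 0 <= deg D.
Proof.
move=> hD; rewrite -[D]freeg_sumE raddf_sum /= sumr_ge0 // => p _.
by rewrite degU.
Qed.

Lemma effective_deg0 D : effective D -> deg D = 0 -> D = 0.
Proof. by move=> hD; apply: fgpos_eq0P; apply/fgposP. Qed.

Lemma equiv_effective_lin D E : lin_equiv D E -> equiv_effective E ->
  equiv_effective D.
Proof. by move=> DE [F eF EF]; exists F => //; apply: lin_equiv_trans EF. Qed.

Lemma equiv_effectiveD D E : equiv_effective D -> effective E ->
  equiv_effective (D + E).
Proof.
by case=> F eF DF eE; exists (F + E); [apply: effectiveD|apply: lin_equivDr].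
Qed.

Lemma equiv_effective_ge0 D : equiv_effective D -> 0 <= deg D.
Proof. by case=> F eF /lin_equiv_deg->; apply: effective_deg_ge0. Qed.

Lemma equiv_effective_deg0 D :
  deg D = 0 -> (equiv_effective D <-> lin_equiv D 0).
Proof.
move=> D0; split=> [[F eF DF]|]; last by exists 0 => //; apply: effective0.
by rewrite -(effective_deg0 eF) // -(lin_equiv_deg DF).
Qed.

(** A divisor of degree r is padded to degree s by multiples of v; adding them back preserves
    effectivity. *)
Lemma rank_at_least_le D r s : (r <= s)%N -> rank_at_least D s ->
  rank_at_least D r.
Proof.
move=> rs hs E eE dE.
have eP := effective_point (vpt T) (s - r).
suff: equiv_effective (D - (E + << (s - r)%N%:Z *g vpt T >>)).
  by move/equiv_effectiveD => /(_ _ eP); rewrite opprD addrA subrK.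
by apply: hs (effectiveD eE eP) _; rewrite degD degU dE -PoszD subnKC.
Qed.

Lemma rank_at_least0 D : rank_at_least D 0%N <-> equiv_effective D.
Proof.
split=> [/(_ 0 effective0)|hD E eE /(effective_deg0 eE)->]; last by rewrite subr0.
by rewrite deg0 subr0; apply.
Qed.

Lemma rank_at_least_deg D r : rank_at_least D r -> r%:Z <= deg D.
Proof.
move/(_ _ (effective_point (vpt T) r)); rewrite degU => /(_ erefl).
by move/equiv_effective_ge0; rewrite degB degU subr_ge0.
Qed.

(** The admissible r form an initial segment bounded by the degree, so the [xget] in [rank] does
    find a maximum. *)
Lemma rank_at_leastP D (r : nat) : r%:Z <= rank D <-> rank_at_least D r.
Proof.
rewrite /rank; case: asboolP => [eD|neD]; last first.
  split=> // /(rank_at_least_le (leq0n r)) /rank_at_least0.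
  by move=> /neD.
have bnd s : rank_at_least D s -> (s <= `|deg D|)%N.
  by move=> /rank_at_least_deg; lia.
have ex : exists s, `[< rank_at_least D s >].
  by exists 0%N; apply/asboolP/rank_at_least0.
case: (ex_maxnP (P := fun s => `[< rank_at_least D s >]) ex (m := `|deg D|%N)).
  by move=> s /asboolP; apply: bnd.
move=> m /asboolP hm max; case: xgetP => [s _ [hs maxs]|/(_ m)[]]; last first.
  by split=> // s /asboolP; apply: max.
split=> [rs|/maxs //]; first by apply: rank_at_least_le hs; lia.
Qed.

Lemma rankN1_le D : -1 <= rank D.
Proof. by rewrite /rank; case: asboolP => // _; apply: le_trans (_ : 0 <= _). Qed.

(** With the shift by one, r = 0 covers rank -1 (the witness is 0), and the degrees of witnesses on
    the two sides of a wedge simply add up. *)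
Lemma rank_ltP D (r : nat) :
  rank D + 1 <= r%:Z <->
  exists E, [/\ effective E, deg E = r%:Z & ~ equiv_effective (D - E)].
Proof.
rewrite -ltzD1 ltrD2r; split=> [rD|[E [eE dE nE]]]; last first.
  by rewrite ltNge; apply/negP => /rank_at_leastP /(_ E eE dE).
apply: contrapT => nE; suff /rank_at_leastP : rank_at_least D r.
  by rewrite leNgt rD.
move=> E eE dE; apply: contrapT => nDE; apply: nE.
by exists E.
Qed.

End RankTheory.

(** * Permutations of the integers *)

Section CountingFunctions.
Local Open Scope classical_set_scope.
Local Open Scope card_scope.

Lemma has_card_inj (A : set int) m n : has_card A m -> has_card A n -> m = n.
Proof.
move=> [i -> Ai] [j -> Aj]; congr Posz; apply/card_eq_II.
by apply: card_eq_trans Aj; rewrite card_eq_sym.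
Qed.

Lemma has_card0 : has_card (set0 : set int) 0.
Proof. by exists 0%N => //; rewrite II0; apply: card_eq00. Qed.

Lemma has_cardU1 (A : set int) x m :
  ~ A x -> has_card A m -> has_card (x |` A) (m + 1).
Proof.
move=> nAx [n -> An]; exists n.+1; first by rewrite -addn1.
apply/eq_cardSP; exists x; first by left.
suff -> : (x |` A) `\ x = A by [].
by apply/seteqP; split=> y /= => [[[->//|//]]|Ay]; split; [right|move=> yx; case: nAx; rewrite -yx].
Qed.

Lemma has_card_bounded (A : set int) m :
  has_card A m -> exists B, forall n, A n -> `|n| < B.
Proof.
case=> n _ An; have /finite_seqP[s ->] : finite_set A by exists n.
exists (\sum_(i <- s) `|i| + 1) => i /= si.
by rewrite ltzD1 (big_rem i) //= lerDl sumr_ge0.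
Qed.

Implicit Types (gamma : int -> int) (F : int -> int -> int) (a b : int).

(** The recursion in b and the vanishing for large b determine [F a b] as the number of n >= b with
    [gamma n <= a]. In this form identities between counts are local in b and fall to linear
    arithmetic. *)
Definition counts_below gamma F : Prop :=
  (forall a b, F a b = F a (b + 1) + (gamma b <= a)%R%:Z) /\
  (forall a, exists B, forall b, B <= b -> F a b = 0).

Definition counts_above gamma F : Prop :=
  (forall a b, F a (b + 1) = F a b + (a < gamma b)%R%:Z) /\
  (forall a, exists B, forall b, b <= B -> F a b = 0).

Lemma int_ind_down (P : int -> Prop) (B : int) :
  (forall b, B <= b -> P b) -> (forall b, P (b + 1) -> P b) -> forall b, P b.
Proof.
move=> hB hS b; have [/hB //|/ltW bB] := leP B b.
have -> : b = B - `|B - b|%N%:Z by lia.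
by elim: `|B - b|%N => [|n IH]; [apply: hB; lia|apply: hS; rewrite -addn1; congr P: IH; lia].
Qed.

Lemma int_ind_up (P : int -> Prop) (B : int) :
  (forall b, b <= B -> P b) -> (forall b, P b -> P (b + 1)) -> forall b, P b.
Proof.
move=> hB hS b; rewrite -[b]opprK; apply: (int_ind_down (P := P \o -%R) (B := - B)).
  by move=> c Bc; apply: hB; lia.
by move=> c /= /hS; rewrite opprD subrK.
Qed.

Lemma counts_below_card gamma F : counts_below gamma F ->
  forall a b, has_card [set n : int | b <= n /\ gamma n <= a] (F a b).
Proof.
move=> [FS F0] a; have [B FB] := F0 a; apply: (int_ind_down (B := B)) => b.
  move=> Bb; rewrite FB //; suff -> : [set n | b <= n /\ gamma n <= a] = set0.
    exact: has_card0.
  apply/seteqP; split=> // n [/= bn gn]; have := FS a n.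
  by rewrite !FB ?gn; lia.
move=> IH; rewrite FS; have [gb|gb] := boolP (gamma b <= a); last first.
  rewrite /= ?addr0; move: IH; congr (has_card _ _); apply/seteqP; split=> n /= [bn gn].
    by split=> //; lia.
  by split=> //; have [nb|] := eqVneq n b; [move: gb; rewrite -nb gn|lia].
suff -> : [set n | b <= n /\ gamma n <= a] =
          b |` [set n | b + 1 <= n /\ gamma n <= a].
  by apply: has_cardU1 => // -[/=]; lia.
apply/seteqP; split=> n /=.
  by move=> [bn gn]; have [->|nb] := eqVneq n b; [left|right; split=> //; lia].
by case=> [->|[? ?]]; split=> //; lia.
Qed.

Lemma counts_above_card gamma F : counts_above gamma F ->
  forall a b, has_card [set n : int | n < b /\ a < gamma n] (F a b).
Proof.
move=> [FS F0] a; have [B FB] := F0 a; apply: (int_ind_up (B := B)) => b.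
  move=> Bb; rewrite FB //; suff -> : [set n | n < b /\ a < gamma n] = set0.
    exact: has_card0.
  apply/seteqP; split=> // n [/= bn gn]; have := FS a n.
  by rewrite !FB ?gn; lia.
move=> IH; rewrite FS; have [gb|gb] := boolP (a < gamma b); last first.
  rewrite /= ?addr0; move: IH; congr (has_card _ _); apply/seteqP; split=> n /= [bn gn].
    by split=> //; lia.
  by split=> //; have [nb|] := eqVneq n b; [move: gb; rewrite -nb gn|lia].
suff -> : [set n | n < b + 1 /\ a < gamma n] =
          b |` [set n | n < b /\ a < gamma n].
  by apply: has_cardU1 => // -[/=]; lia.
apply/seteqP; split=> n /=.
  by move=> [bn gn]; have [->|nb] := eqVneq n b; [left|right; split=> //; lia].
by case=> [->|[? ?]]; split=> //; lia.
Qed.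

Lemma card_counts_below gamma F :
  (forall a b, has_card [set n : int | b <= n /\ gamma n <= a] (F a b)) ->
  counts_below gamma F.
Proof.
move=> hF; split=> [a b|a].
  apply: (has_card_inj (hF a b)); have [gb|gb] := boolP (gamma b <= a).
    suff -> : [set n | b <= n /\ gamma n <= a] =
              b |` [set n | b + 1 <= n /\ gamma n <= a].
      by apply: has_cardU1 => // -[/=]; lia.
    apply/seteqP; split=> n /=.
      by move=> [bn gn]; have [->|nb] := eqVneq n b; [left|right; split=> //; lia].
    by case=> [->|[? ?]]; split=> //; lia.
  rewrite /= ?addr0; move: (hF a (b + 1)); congr (has_card _ _).
  apply/seteqP; split=> n /= [bn gn]; first by split=> //; lia.
  by split=> //; have [nb|] := eqVneq n b; [move: gb; rewrite -nb gn|lia].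
(* For b >= 0 the set counted at b is contained in the one counted at 0, so one bound serves all
   large b. *)
have [B hB] := has_card_bounded (hF a 0); exists (`|B| + 1) => b Bb.
apply: (has_card_inj (hF a b)).
suff -> : [set n | b <= n /\ gamma n <= a] = set0 by apply: has_card0.
apply/seteqP; split=> // n [/= bn gn]; have : 0 <= n /\ gamma n <= a.
  by split=> //; lia.
by move/hB; lia.
Qed.

Lemma card_counts_above gamma F :
  (forall a b, has_card [set n : int | n < b /\ a < gamma n] (F a b)) ->
  counts_above gamma F.
Proof.
move=> hF; split=> [a b|a].
  apply: (has_card_inj (hF a (b + 1))); have [gb|gb] := boolP (a < gamma b).
    suff -> : [set n | n < b + 1 /\ a < gamma n] =
              b |` [set n | n < b /\ a < gamma n].
      by apply: has_cardU1 => // -[/=]; lia.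
    apply/seteqP; split=> n /=.
      by move=> [bn gn]; have [->|nb] := eqVneq n b; [left|right; split=> //; lia].
    by case=> [->|[? ?]]; split=> //; lia.
  rewrite /= ?addr0; move: (hF a b); congr (has_card _ _).
  apply/seteqP; split=> n /= [bn gn]; first by split=> //; lia.
  by split=> //; have [nb|] := eqVneq n b; [move: gb; rewrite -nb gn|lia].
have [B hB] := has_card_bounded (hF a 0); exists (- `|B| - 1) => b Bb.
apply: (has_card_inj (hF a b)).
suff -> : [set n | n < b /\ a < gamma n] = set0 by apply: has_card0.
apply/seteqP; split=> // n [/= bn gn]; have : n < 0 /\ a < gamma n.
  by split=> //; lia.
by move/hB; lia.
Qed.

Lemma counts_below_inj gamma F G a b :
  counts_below gamma F -> counts_below gamma G -> F a b = G a b.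
Proof.
by move=> hF hG; apply: has_card_inj (counts_below_card hF a b) (counts_below_card hG a b).
Qed.

Lemma counts_above_inj gamma F G a b :
  counts_above gamma F -> counts_above gamma G -> F a b = G a b.
Proof.
by move=> hF hG; apply: has_card_inj (counts_above_card hF a b) (counts_above_card hG a b).
Qed.

End CountingFunctions.

(** * Inversion classes and covering lists *)

Section Inversions.
Local Open Scope classical_set_scope.
Local Open Scope card_scope.
Implicit Types (alpha : int -> int) (s : seq (int * int)).

Definition k_periodic (k : nat) alpha : Prop :=
  forall n, alpha (n + k%:Z) = alpha n + k%:Z.

(** The members of [s] may be equivalent to each other and need not be inversions: only the length
    is bounded, and a reflection can be applied to the whole list without further checks. *)
Definition inversions_covered (k : nat) alpha s : Prop :=
  forall p, inversions alpha p -> exists2 q, q \in s & k_equivalent k q p.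

Lemma k_equivalent_refl k p : k_equivalent k p p.
Proof. by exists 0; rewrite !mul0r !addr0; case: p. Qed.

Lemma k_equivalent_sym k p q : k_equivalent k p q -> k_equivalent k q p.
Proof.
by case=> n ->; exists (- n); rewrite /= !mulNr !addrK; case: p.
Qed.

Lemma k_equivalent_trans k p q r :
  k_equivalent k p q -> k_equivalent k q r -> k_equivalent k p r.
Proof. by case=> m -> [n ->]; exists (m + n); rewrite /= !mulrDl !addrA. Qed.

Lemma k_periodicM k alpha : k_periodic k alpha ->
  forall j n, alpha (n + j * k%:Z) = alpha n + j * k%:Z.
Proof.
move=> ha j; have nat_case i n : alpha (n + i%:Z * k%:Z) = alpha n + i%:Z * k%:Z.
  elim: i => [|i IH]; first by rewrite !mul0r !addr0.
  by rewrite -addn1 PoszD mulrDl mul1r !addrA ha IH.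
case: j => i n //; rewrite NegzE; apply: (addIr (i.+1%:Z * k%:Z)).
by rewrite -nat_case !mulNr !subrK.
Qed.

(** An injection of the classes into [I_g] yields a list by choosing an inversion in the class
    numbered i, for each i < g; the default (0, 0) stands at indices that number no class.
    Conversely a class is numbered by the index of an entry of [s] equivalent to one of its
    members. *)
Lemma inv_at_mostP k alpha (g : nat) :
  inv_at_most k alpha g <->
  exists2 s, (size s <= g)%N & inversions_covered k alpha s.
Proof.
split=> [/pcard_leP[f]|[s sg hs]].
  pose cls p := [set q | inversions alpha q /\ k_equivalent k p q].
  pose F (i : nat) := xget (0, 0) [set p | inversions alpha p /\ f (cls p) = i].
  exists (mkseq F g); first by rewrite size_mkseq.
  move=> p ip; have cp : inversion_classes k alpha (cls p) by exists p.
  have fg : (f (cls p) < g)%N by have := @funS _ _ _ _ f _ cp.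
  exists (F (f (cls p))).
    by apply/mapP; exists (f (cls p)) => //; rewrite mem_iota add0n.
  rewrite /F; case: xgetP => [q _ [iq fq]|/(_ p)[]//].
  have cq : inversion_classes k alpha (cls q) by exists q.
  have /(_ _ _ _ _ fq) := @inj _ _ _ f.
  rewrite !inE => /(_ cq cp) E.
  have : cls q p by rewrite E; split=> //; apply: k_equivalent_refl.
  by case.
apply/pcard_leP.
pose f (C : set (int * int)) : nat := xget 0%N [set i | (i < size s)%N /\
  exists2 p, C p & k_equivalent k (nth (0, 0) s i) p].
have fP C : inversion_classes k alpha C -> (f C < size s)%N /\
    exists2 p, C p & k_equivalent k (nth (0, 0) s (f C)) p.
  case=> p ip ->; rewrite /f; case: xgetP => [i _ //|none].
  have [q qs qp] := hs p ip.
  case: (none (index q s)); split; first by rewrite index_mem.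
  by exists p; [split=> //; apply: k_equivalent_refl|rewrite nth_index].
have fin : set_fun (inversion_classes k alpha) `I_g f.
  by move=> C /fP[fC _] /=; apply: leq_trans sg.
have finj : {in inversion_classes k alpha &, injective f}.
  move=> C D; rewrite !inE => hC hD fCD.
  have [_ [p Cp ep]] := fP _ hC; have [_ [q Dq eq]] := fP _ hD.
  have pq : k_equivalent k p q.
    apply: k_equivalent_trans (k_equivalent_sym ep) _.
    by rewrite fCD.
  case: hC Cp => p0 _ -> [_ ep0]; case: hD Dq => q0 _ -> [_ eq0].
  have pq0 : k_equivalent k p0 q0.
    apply: k_equivalent_trans ep0 _; apply: k_equivalent_trans pq _.
    exact: k_equivalent_sym.
  apply/seteqP; split=> r [ir er]; split=> //.
    exact: k_equivalent_trans (k_equivalent_sym pq0) er.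
  exact: k_equivalent_trans pq0 er.
by apply/injfunPex; exists f.
Qed.

(** For k = 0 equivalence is equality, so a finite covering list contains every inversion. *)
Lemma in_SigmaP k alpha s : k_periodic k alpha -> inversions_covered k alpha s ->
  in_Sigma k alpha.
Proof.
case: k => [|k] // _ hs; apply: (sub_finite_set (B := [set` s])); last first.
  exact: finite_seq.
by move=> p /hs[q qs [n ->]] /=; rewrite !mulr0 !addr0; case: (q) qs.
Qed.

Lemma in_Sigma_periodic k alpha : in_Sigma k alpha -> k_periodic k alpha.
Proof. by case: k => // _ n; rewrite !addr0. Qed.

End Inversions.

(** * Products of disjoint adjacent transpositions and their effect on counts *)

Section SimpleReflections.
Local Open Scope classical_set_scope.
Variables (P : int -> bool) (nP : forall n, P n -> ~~ P (n + 1)).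
Implicit Types (gamma tau : int -> int) (F : int -> int -> int) (a b n : int).

Definition reflect_at n : int :=
  if P n then n + 1 else if P (n - 1) then n - 1 else n.

(** Sorting the values on each pair n, n + 1 with [P n] into decreasing order affects the count only
    if b separates a pair, that is if [P (b - 1)]. The smaller value then lies at b, and it adds 1
    to [F a (b + 1)] exactly when at least one of the two values is at most a. *)
Definition reflection_max F a b : int :=
  if P (b - 1) then Num.min (F a (b - 1)) (F a (b + 1) + 1) else F a b.

Definition reflection_max_above F a b : int :=
  if P (b - 1) then Num.min (F a (b - 1) + 1) (F a (b + 1)) else F a b.

(** One formula serves both kinds of count: at a cut that separates a pair, the contributions of b -
    1 and b are exchanged. *)
Definition reflection_swap F a b : int :=
  if P (b - 1) then F a (b - 1) + F a (b + 1) - F a b else F a b.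

Lemma reflected_pred n : P n -> P (n - 1) = false.
Proof. by move=> Pn; apply/negbTE/negP => /nP; rewrite subrK Pn. Qed.

Lemma reflect_atK : involutive reflect_at.
Proof.
move=> n; rewrite /reflect_at; have [Pn|nPn] := boolP (P n).
  by rewrite (negbTE (nP Pn)) addrK Pn.
have [Pn|nPn'] := boolP (P (n - 1)); first by rewrite Pn subrK.
by rewrite (negbTE nPn) (negbTE nPn').
Qed.

(** The transposed pairs are disjoint blocks of neighbours, so that only the two members of one
    block change their order. *)
Lemma reflect_at_lt x y : x < y -> ~~ (P x && (y == x + 1)) ->
  reflect_at x < reflect_at y.
Proof.
move=> xy; rewrite /reflect_at.
have [Px|nPx] /= := boolP (P x).
  move=> /eqP yx; case: ifP => Py; first lia.
  case: ifP => Py1; last lia.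
  have : y - 1 <> x + 1 by move=> E; move: (nP Px); rewrite -E Py1.
  lia.
move=> _; have : (if P (x - 1) then x - 1 else x) <= x by case: ifP; lia.
set u := if _ then _ else _; move=> ux; case: ifP => Py; first lia.
case: ifP => Py1; last lia.
have : y - 1 <> x by move=> E; rewrite -E Py1 in nPx.
lia.
Qed.

(* With [F] the counting function of [gamma], the minimum over [l] of
   [F a (l + 1) + #{n >= b | reflect_at n <= l}] is [reflection_max F a b]. *)
Lemma counts_below_max gamma tau F :
  (forall n, P n -> tau n = Num.max (gamma n) (gamma (n + 1))) ->
  (forall n, P n -> tau (n + 1) = Num.min (gamma n) (gamma (n + 1))) ->
  (forall n, ~~ P n -> ~~ P (n - 1) -> tau n = gamma n) ->
  counts_below gamma F -> counts_below tau (reflection_max F).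
Proof.
move=> tP tP1 tN [FS F0]; split=> [a b|a]; last first.
  have [B FB] := F0 a; exists (B + 1) => b Bb.
  by rewrite /reflection_max; case: ifP => _; rewrite !FB //; lia.
rewrite /reflection_max addrK; have [Pb|nPb] := boolP (P b).
  rewrite reflected_pred // (FS a b) (FS a (b + 1)) tP //; lia.
have [Pb1|nPb1] := boolP (P (b - 1)); last by rewrite tN // FS.
have := tP1 _ Pb1; rewrite subrK => ->.
have := FS a (b - 1); rewrite subrK => ->; rewrite (FS a b); lia.
Qed.

Lemma counts_above_max gamma tau F :
  (forall n, P n -> tau n = Num.max (gamma n) (gamma (n + 1))) ->
  (forall n, P n -> tau (n + 1) = Num.min (gamma n) (gamma (n + 1))) ->
  (forall n, ~~ P n -> ~~ P (n - 1) -> tau n = gamma n) ->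
  counts_above gamma F -> counts_above tau (reflection_max_above F).
Proof.
move=> tP tP1 tN [FS F0]; split=> [a b|a]; last first.
  have [B FB] := F0 a; exists (B - 1) => b Bb.
  by rewrite /reflection_max_above; case: ifP => _; rewrite !FB //; lia.
rewrite /reflection_max_above addrK; have [Pb|nPb] := boolP (P b).
  rewrite reflected_pred // (FS a (b + 1)) (FS a b) tP //; lia.
have [Pb1|nPb1] := boolP (P (b - 1)); last by rewrite tN // FS.
have := tP1 _ Pb1; rewrite subrK => ->.
by have := FS a (b - 1); rewrite subrK FS => ->; lia.
Qed.

Lemma counts_below_swap gamma F : counts_below gamma F ->
  counts_below (gamma \o reflect_at) (reflection_swap F).
Proof.
move=> [FS F0]; split=> [a b|a]; last first.
  have [B FB] := F0 a; exists (B + 1) => b Bb.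
  by rewrite /reflection_swap; case: ifP => _; rewrite !FB //; lia.
rewrite /reflection_swap /reflect_at /= addrK; have [Pb|nPb] := boolP (P b).
  rewrite reflected_pred // (FS a b) (FS a (b + 1)); lia.
have [Pb1|nPb1] := boolP (P (b - 1)); last by rewrite FS.
by have := FS a (b - 1); rewrite subrK => ->; rewrite (FS a b); lia.
Qed.

Lemma counts_above_swap gamma F : counts_above gamma F ->
  counts_above (gamma \o reflect_at) (reflection_swap F).
Proof.
move=> [FS F0]; split=> [a b|a]; last first.
  have [B FB] := F0 a; exists (B - 1) => b Bb.
  by rewrite /reflection_swap; case: ifP => _; rewrite !FB //; lia.
rewrite /reflection_swap /reflect_at /= addrK; have [Pb|nPb] := boolP (P b).
  rewrite reflected_pred // (FS a (b + 1)) (FS a b); lia.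
have [Pb1|nPb1] := boolP (P (b - 1)); last by rewrite FS.
by have := FS a (b - 1); rewrite subrK FS => ->; lia.
Qed.

End SimpleReflections.

(** * The Demazure product as a min-plus product of counting functions *)

Section DemazureProduct.
Local Open Scope classical_set_scope.
Implicit Types (f : int -> int) (s : seq (int * int)) (F : int -> int -> int).

Definition is_min f (m : int) : Prop := (exists l, f l = m) /\ forall l, m <= f l.

Lemma is_min_min f g h (m n : int) : is_min f m -> is_min g n ->
  (forall l, h l = Num.min (f l) (g l)) -> is_min h (Num.min m n).
Proof.
move=> [[l fl] mf] [[l' gl'] ng] hfg; split; last first.
  by move=> i; rewrite hfg; have := mf i; have := ng i; lia.
have [mn|/ltW nm] := leP m n.
  by exists l; rewrite hfg fl min_l //; apply: le_trans mn (ng l).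
by exists l'; rewrite hfg gl' min_r //; apply: le_trans nm (mf l').
Qed.

Lemma is_minDr f (m c : int) : is_min f m -> is_min (fun l => f l + c) (m + c).
Proof.
move=> [[l fl] mf]; split; first by exists l; rewrite fl.
by move=> i; rewrite lerD2r.
Qed.

Lemma eq_is_min f g (m n : int) : f =1 g -> m = n -> is_min f m -> is_min g n.
Proof. by move=> /funext-> ->. Qed.

Record counted_perm (k : nat) (alpha : int -> int) (F F' : int -> int -> int) s
    : Prop := CountedPerm {
  cp_bij : bijective alpha;
  cp_periodic : k_periodic k alpha;
  cp_covered : inversions_covered k alpha s;
  cp_below : counts_below alpha F;
  cp_above : counts_above alpha F'
}.

Variables (k : nat) (k_neq1 : k <> 1%N).

(** For k = 0 this is the single integer i, and [refl i] below is one transposition; otherwise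
    [refl i] is a simple reflection of the affine symmetric group. *)
Definition residue_class (i n : int) : bool := (k%:Z %| n - i)%Z.

Lemma residue_classN i n : residue_class i n -> ~~ residue_class i (n + 1).
Proof.
rewrite /residue_class => kn; apply/negP => kn1.
have : (k%:Z %| n + 1 - i - (n - i))%Z by apply: rpredB.
have -> : n + 1 - i - (n - i) = 1 by lia.
by rewrite dvdz1 absz_nat => /eqP.
Qed.

Lemma residue_classP i n : residue_class i n -> exists j, n = i + j * k%:Z.
Proof. by case/dvdzP=> j nij; exists j; rewrite -nij; lia. Qed.

Lemma residue_classD i j n :
  residue_class i (n + j * k%:Z) = residue_class i n.
Proof.
by rewrite /residue_class addrAC rpredDr // dvdz_mull.
Qed.

Let refl i := reflect_at (residue_class i).

Lemma reflect_at_shift i j n : refl i (n + j * k%:Z) = refl i n + j * k%:Z.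
Proof.
rewrite /refl /reflect_at residue_classD.
have -> : n + j * k%:Z - 1 = n - 1 + j * k%:Z by lia.
by rewrite residue_classD; case: (residue_class i n); case: (residue_class i (n - 1)); lia.
Qed.

Lemma reflect_periodic i (alpha : int -> int) :
  k_periodic k alpha -> k_periodic k (alpha \o refl i).
Proof.
move=> ha n; rewrite /= -ha; congr alpha.
by have := reflect_at_shift i 1 n; rewrite !mul1r.
Qed.

Lemma reflect_bij i (alpha : int -> int) : bijective alpha -> bijective (alpha \o refl i).
Proof.
move=> ha; apply: bij_comp => //.
by exists (refl i); apply: reflect_atK; apply: residue_classN.
Qed.

Lemma k_equivalent_reflect i p q : k_equivalent k p q ->
  k_equivalent k (refl i p.1, refl i p.2) (refl i q.1, refl i q.2).
Proof. by case=> n ->; exists n; rewrite /= !reflect_at_shift. Qed.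

Lemma inversion_reflect i (gamma : int -> int) x y : k_periodic k gamma ->
  inversions (gamma \o refl i) (x, y) ->
  k_equivalent k (i, i + 1) (x, y) \/ inversions gamma (refl i x, refl i y).
Proof.
move=> hg [/= xy gyx].
have [/andP[/residue_classP[j ->] /eqP->]|nxy] :=
    boolP (residue_class i x && (y == x + 1)).
  by left; exists j; congr pair => /=; lia.
by right; split=> //=; apply: reflect_at_lt => //; apply: residue_classN.
Qed.

Lemma covered_reflect i (gamma : int -> int) s : k_periodic k gamma ->
  inversions_covered k gamma s ->
  inversions_covered k (gamma \o refl i)
    ((i, i + 1) :: [seq (refl i p.1, refl i p.2) | p <- s]).
Proof.
move=> hg hs [x y] /(inversion_reflect hg)[e|/hs[q qs e]].
  by exists (i, i + 1); rewrite ?mem_head.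
exists (refl i q.1, refl i q.2).
  by rewrite inE map_f ?orbT.
by have := k_equivalent_reflect i e; rewrite /= /refl !reflect_atK //; apply: residue_classN.
Qed.

(** At a descent (i, i + 1) is itself an inversion, so [s] has an entry equivalent to it, which is
    dropped. After the reflection this class is ascending, and all other inversions correspond to
    inversions of [gamma]. *)
Lemma covered_descent i (gamma : int -> int) s : k_periodic k gamma ->
  gamma (i + 1) < gamma i -> inversions_covered k gamma s ->
  exists2 s', (size s' < size s)%N & inversions_covered k (gamma \o refl i) s'.
Proof.
move=> hg gi hs; pose ok q := ~~ `[< k_equivalent k q (i, i + 1) >].
exists [seq (refl i q.1, refl i q.2) | q <- s & ok q].
  rewrite size_map size_filter.
  have [|q qs /asboolP qi] := hs (i, i + 1); first by split=> //=; lia.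
  rewrite -(count_predC ok s) -{1}[count ok s]addn0 ltn_add2l -has_count.
  by apply/hasP; exists q; rewrite //= /ok qi.
move=> [x y] ixy; have [] := inversion_reflect hg ixy.
  case=> j /= [xE yE]; case: ixy => /= _.
  rewrite xE yE !reflect_at_shift !(k_periodicM hg) ltrD2r.
  rewrite /refl /reflect_at /residue_class subrr dvdz0 addrK subrr dvdz0.
  case: ifP => [ki|_]; last by move=> gi'; move: (lt_trans gi gi'); rewrite ltxx.
  have := @residue_classN i i; rewrite /residue_class subrr dvdz0 ki.
  by move=> /(_ isT).
move=> iv; have [q qs e] := hs _ iv; exists (refl i q.1, refl i q.2).
  apply/mapP; exists q; rewrite // mem_filter qs andbT.
  apply/asboolP => qi; case: ixy => /= xy _.
  (* If q were one of the dropped entries, reflecting back would make (x, y) equivalent to (i + 1,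
     i), against x < y. *)
  have := k_equivalent_reflect i (k_equivalent_trans (k_equivalent_sym qi) e).
  rewrite /= /refl !reflect_atK; try exact: residue_classN.
  rewrite {1 2}/reflect_at /residue_class subrr dvdz0 addrK subrr dvdz0.
  rewrite -[_ \in _]/(residue_class i (i + 1)).
  rewrite (negbTE (residue_classN _)) /residue_class ?subrr ?dvdz0 //.
  by case=> j [xE yE]; lia.
by have := k_equivalent_reflect i e; rewrite /= /refl !reflect_atK //; apply: residue_classN.
Qed.

(** A strictly increasing map with a gap between [beta i] and [beta (i + 1)] would miss the value
    [beta i + 1]. *)
Lemma increasing_bij_shift (beta : int -> int) : bijective beta ->
  (forall i, beta i <= beta (i + 1)) -> exists c, forall n, beta n = n + c.
Proof.
move=> bb hb; have binj := bij_inj bb.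
have hlt (i : int) : beta i < beta (i + 1).
  by rewrite lt_neqAle hb andbT; apply/eqP => /binj; lia.
have mono (i : int) (j : nat) : beta i + j%:Z <= beta (i + j%:Z).
  elim: j => [|j IH]; first by rewrite !addr0.
  by have := hlt (i + j%:Z); (have -> : i + j.+1%:Z = i + j%:Z + 1 by lia); lia.
have hS (i : int) : beta (i + 1) = beta i + 1.
  have [n bn] : exists n, beta n = beta i + 1.
    by have [b' _ bK] := bb; exists (b' (beta i + 1)).
  have [ni|ni] := leP n i.
    by have := mono n `|i - n|%N; (have -> : n + `|i - n|%N%:Z = i by lia); lia.
  have [|ni'] := leP n (i + 1); first by move=> ?; rewrite -bn; congr beta; lia.
  have := mono (i + 1) `|(n - (i + 1))%R|%N.
  (have -> : i + 1 + `|(n - (i + 1))%R|%N%:Z = n by lia); have := hlt i.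
  by rewrite bn; lia.
exists (beta 0) => n.
have up (j : nat) : beta j%:Z = j%:Z + beta 0.
  by elim: j => [|j IH]; rewrite ?add0r // -addn1 PoszD hS IH; lia.
have dn (j : nat) : beta (- j%:Z) = - j%:Z + beta 0.
  elim: j => [|j IH]; first by rewrite oppr0 add0r.
  have := hS (- j.+1%:Z); have -> : - j.+1%:Z + 1 = - j%:Z by lia.
  by rewrite IH; lia.
by case: n => n; [apply: up|rewrite NegzE; apply: dn].
Qed.

Lemma counts_below_mono alpha F : counts_below alpha F ->
  forall a b (j : nat), F a (b + j%:Z) <= F a b <= F a (b + j%:Z) + j%:Z.
Proof.
move=> [FS _] a b; elim=> [|j IH]; first by rewrite !addr0 lexx.
by have := FS a (b + j%:Z); (have -> : b + j.+1%:Z = b + j%:Z + 1 by lia); lia.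
Qed.

Lemma counts_above_mono alpha F : counts_above alpha F ->
  forall a b (j : nat), F a b <= F a (b + j%:Z) <= F a b + j%:Z.
Proof.
move=> [FS _] a b; elim=> [|j IH]; first by rewrite !addr0 lexx.
by have := FS a (b + j%:Z); (have -> : b + j.+1%:Z = b + j%:Z + 1 by lia); lia.
Qed.

(** Base case of the induction. The counts of a translation are ramps of slope 1 or -1 in l with
    their corner at l = b + c - 1, where they reach 0. The counts of [alpha] are monotone and change
    by at most 1 at each step, so the sum is minimal at the corner. *)
Lemma demazure_shift alpha Fa Fa' sa beta Fb Fb' (c : int) :
  counted_perm k alpha Fa Fa' sa -> (forall n, beta n = n + c) ->
  counts_below beta Fb -> counts_above beta Fb' ->
  exists tau F F' s, [/\ counted_perm k tau F F' s, size s = size sa,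
    forall a b, is_min (fun l => Fa a (l + 1) + Fb l b) (F a b) &
    forall a b, is_min (fun l => Fa' a (l + 1) + Fb' l b) (F' a b)].
Proof.
move=> [ba pa ca cFa cFa'] hb cFb cFb'.
have FbE l b : Fb l b = Num.max 0 (l - c - b + 1).
  apply: (counts_below_inj (G := fun l b => Num.max 0 (l - c - b + 1)) _ _ cFb).
  split=> [{}l {}b|{}l]; first by rewrite hb; lia.
  by exists (l - c + 1) => {}b; lia.
have Fb'E l b : Fb' l b = Num.max 0 (b - 1 + c - l).
  apply: (counts_above_inj (G := fun l b => Num.max 0 (b - 1 + c - l)) _ _ cFb').
  split=> [{}l {}b|{}l]; first by rewrite hb; lia.
  by exists (l - c + 1) => {}b; lia.
exists (fun n => alpha (n + c)), (fun a b => Fa a (b + c)),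
  (fun a b => Fa' a (b + c)), [seq (p.1 - c, p.2 - c) | p <- sa].
split; last 2 first.
- move=> a b; split; first by exists (b + c - 1); rewrite FbE; (have -> : b + c - 1 + 1 = b + c by lia); lia.
  move=> l; rewrite FbE; have [lb|lb] := leP (l + 1) (b + c).
    have := counts_below_mono cFa a (l + 1) `|(b + c - (l + 1))%R|%N.
    by (have -> : l + 1 + `|(b + c - (l + 1))%R|%N%:Z = b + c by lia); lia.
  have := counts_below_mono cFa a (b + c) `|(l + 1 - (b + c))%R|%N.
  by (have -> : b + c + `|(l + 1 - (b + c))%R|%N%:Z = l + 1 by lia); lia.
- move=> a b; split; first by exists (b + c - 1); rewrite Fb'E; (have -> : b + c - 1 + 1 = b + c by lia); lia.
  move=> l; rewrite Fb'E; have [lb|lb] := leP (l + 1) (b + c).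
    have := counts_above_mono cFa' a (l + 1) `|(b + c - (l + 1))%R|%N.
    by (have -> : l + 1 + `|(b + c - (l + 1))%R|%N%:Z = b + c by lia); lia.
  have := counts_above_mono cFa' a (b + c) `|(l + 1 - (b + c))%R|%N.
  by (have -> : b + c + `|(l + 1 - (b + c))%R|%N%:Z = l + 1 by lia); lia.
- split.
  + by apply: (bij_comp ba); exists (fun n => n - c) => n /=; rewrite ?addrK ?subrK.
  + by move=> n; rewrite addrAC pa.
  + move=> [x y] [/= xy axy].
    have [|q qs [j [xE yE]]] := ca (x + c, y + c).
      by split=> //=; rewrite ltrD2r.
    exists (q.1 - c, q.2 - c).
      by apply/mapP; exists q.
    by exists j; congr pair => /=; lia.
  + case: cFa => FS F0; split=> [a b|a]; first by rewrite addrAC FS.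
    by have [B FB] := F0 a; exists (B - c) => b Bb; apply: FB; lia.
  + case: cFa' => FS F0; split=> [a b|a]; first by rewrite addrAC FS.
    by have [B FB] := F0 a; exists (B - c) => b Bb; apply: FB; lia.
- by rewrite size_map.
Qed.

(* Induction on the number of inversion classes of [beta].  At a descent
   [beta (i + 1) < beta i] one has [beta = (beta \o refl i) * refl i] for the
   Demazure product [*], the first factor has fewer inversion classes, and
   [t * refl i] is [t] or [t \o refl i], which has at most one class more. *)
Lemma demazure_product alpha Fa Fa' sa : counted_perm k alpha Fa Fa' sa ->
  forall beta Fb Fb' sb, counted_perm k beta Fb Fb' sb ->
  exists tau F F' s, [/\ counted_perm k tau F F' s,
    (size s <= size sa + size sb)%N,
    forall a b, is_min (fun l => Fa a (l + 1) + Fb l b) (F a b) &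
    forall a b, is_min (fun l => Fa' a (l + 1) + Fb' l b) (F' a b)].
Proof.
move=> ha beta Fb Fb' sb; have [N] := ubnP (size sb).
elim: N beta Fb Fb' sb => // N IH beta Fb Fb' sb sbN hbeta.
have [bb pb cb cFb cFb'] := hbeta.
have [[i di]|nd] := pselect (exists i, beta (i + 1) < beta i); last first.
  have [|c hc] := increasing_bij_shift bb.
    by move=> i; rewrite leNgt; apply/negP => di; apply: nd; exists i.
  have [tau [F [F' [s [cp ss hF hF']]]]] := demazure_shift ha hc cFb cFb'.
  by exists tau, F, F', s; split=> //; rewrite ss leq_addr.
have [s1 s1s cs1] := covered_descent pb di cb.
have nP := @residue_classN i; set P := residue_class i in nP.
have dP n : P n -> beta (n + 1) < beta n.
  by case/residue_classP=> j ->; rewrite addrAC !(k_periodicM pb) ltrD2r.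
pose beta1 := beta \o refl i.
pose Fb1 := reflection_swap P Fb; pose Fb1' := reflection_swap P Fb'.
have h1 : counted_perm k beta1 Fb1 Fb1' s1.
  split=> //; first exact: reflect_bij.
  - exact: reflect_periodic.
  - exact: counts_below_swap.
  - exact: counts_above_swap.
have b1P n : P n -> beta1 n = beta (n + 1) /\ beta1 (n + 1) = beta n.
  move=> Pn; rewrite /beta1 /refl /reflect_at /= -/P Pn.
  by rewrite (negbTE (nP _ Pn)) addrK Pn.
have b1N n : ~~ P n -> ~~ P (n - 1) -> beta1 n = beta n.
  by move=> nPn nPn1; rewrite /beta1 /refl /reflect_at /= -/P (negbTE nPn) (negbTE nPn1).
(* The pairs of the class are descents of [beta], so [beta] is [beta1] sorted decreasingly on each
   of them, and its counts arise from those of [beta1] by [reflection_max] and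
   [reflection_max_above]. *)
have bE1 n : P n -> beta n = Num.max (beta1 n) (beta1 (n + 1)).
  by move=> Pn; have [-> ->] := b1P n Pn; rewrite max_r // ltW // dP.
have bE2 n : P n -> beta (n + 1) = Num.min (beta1 n) (beta1 (n + 1)).
  by move=> Pn; have [-> ->] := b1P n Pn; rewrite min_l // ltW // dP.
have FbE l b : Fb l b = reflection_max P Fb1 l b.
  apply: (counts_below_inj _ _ cFb).
  apply: (counts_below_max nP bE1 bE2 _ (cp_below h1)).
  by move=> n nPn nPn1; rewrite b1N.
have Fb'E l b : Fb' l b = reflection_max_above P Fb1' l b.
  apply: (counts_above_inj _ _ cFb').
  apply: (counts_above_max nP bE1 bE2 _ (cp_above h1)).
  by move=> n nPn nPn1; rewrite b1N.
have [|tau0 [F0 [F0' [s0 [cp0 ss0 hF0 hF0']]]]] := IH _ _ _ _ _ h1.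
  exact: leq_trans s1s _.
have [bt pt ct cFt cFt'] := cp0.
(* [tau] is [tau0] sorted decreasingly on each pair. By periodicity the pairs are all ascents of
   [tau0] or all descents, so [tau] is [tau0 \o refl i] or [tau0] itself. *)
have [tau [s [cpt st tE1 tE2 tN]]] : exists tau s, [/\
    [/\ bijective tau, k_periodic k tau & inversions_covered k tau s],
    (size s <= (size s0).+1)%N,
    forall n, P n -> tau n = Num.max (tau0 n) (tau0 (n + 1)),
    forall n, P n -> tau (n + 1) = Num.min (tau0 n) (tau0 (n + 1)) &
    forall n, ~~ P n -> ~~ P (n - 1) -> tau n = tau0 n].
  have [asc|desc] := ltP (tau0 i) (tau0 (i + 1)).
    have aP n : P n -> tau0 n < tau0 (n + 1).
      by case/residue_classP=> j ->; rewrite addrAC !(k_periodicM pt) ltrD2r.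
    exists (tau0 \o refl i), ((i, i + 1) :: [seq (refl i p.1, refl i p.2) | p <- s0]).
    split.
    - split; [exact: reflect_bij|exact: reflect_periodic|exact: covered_reflect].
    - by rewrite /= size_map.
    - move=> n Pn; rewrite /refl /reflect_at /= -/P Pn max_r // ltW //; exact: aP.
    - move=> n Pn; rewrite /refl /reflect_at /= -/P (negbTE (nP _ Pn)) addrK Pn.
      by rewrite min_l // ltW //; apply: aP.
    - by move=> n nPn nPn1; rewrite /refl /reflect_at /= -/P (negbTE nPn) (negbTE nPn1).
  have dP0 n : P n -> tau0 (n + 1) <= tau0 n.
    by case/residue_classP=> j ->; rewrite addrAC !(k_periodicM pt) lerD2r.
  exists tau0, s0; split=> // n Pn; first by rewrite max_l // dP0.
  by rewrite min_r // dP0.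
exists tau, (reflection_max P F0), (reflection_max_above P F0'), s.
have [btau ptau ctau] := cpt.
split.
- split=> //; first exact: (counts_below_max nP tE1 tE2 tN cFt).
  exact: (counts_above_max nP tE1 tE2 tN cFt').
- apply: leq_trans st _; apply: leq_ltn_trans ss0 _.
  by rewrite ltn_add2l.
(* [reflection_max] is the identity or a minimum of two counts at shifted b, so the minimum over l
   passes through it. *)
- move=> a b; rewrite /reflection_max; case: ifP => Pb; last first.
    by apply: eq_is_min (hF0 a b) => // l; rewrite FbE /reflection_max Pb.
  apply: is_min_min (hF0 a (b - 1)) (is_minDr 1 (hF0 a (b + 1))) _ => l.
  by rewrite FbE /reflection_max Pb; lia.
- move=> a b; rewrite /reflection_max_above; case: ifP => Pb; last first.
    by apply: eq_is_min (hF0' a b) => // l; rewrite Fb'E /reflection_max_above Pb.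
  apply: is_min_min (is_minDr 1 (hF0' a (b - 1))) (hF0' a (b + 1)) _ => l.
  by rewrite Fb'E /reflection_max_above Pb; lia.
Qed.

End DemazureProduct.

Ltac freeg_ring :=
  apply/eqP/freeg_eqP => ?;
  rewrite ?(coeff0, coeffD, coeffN, raddfMz, raddfMn) /=; ring.

(** * Transmission permutations in terms of counting functions *)

Section Transmission.
Variables (T : divisor_theory) (gT : good_theory T).
Implicit Types (D : {freeg (point T)}) (tau : int -> int).

Lemma transmissionP D tau :
  transmission_permutation D tau <->
  [/\ bijective tau, counts_below tau (fun a b => rank (twist D a b) + 1)
    & counts_above tau (fun a b => rank (twist (canonical T - D) (- a) (- b)) + 1)].
Proof.
split=> -[bt hF hF']; split=> //.
- exact: card_counts_below.
- exact: card_counts_above.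
- exact: counts_below_card.
- exact: counts_above_card.
Qed.

(** [Delta (twist D a b)] is a mixed second difference of the counts, equal to 1 if [tau b = a] and
    to 0 otherwise. *)
Lemma transmission_submodular D tau :
  transmission_permutation D tau -> submodular D.
Proof.
move=> /transmissionP[_ [FS _] _] a b; rewrite /Delta.
have -> : twist D a b - << vpt T >> = twist D (a - 1) b.
  by rewrite /twist; freeg_ring.
have -> : twist D a b - << wpt T >> = twist D a (b + 1).
  by rewrite /twist; freeg_ring.
have -> : twist D (a - 1) b - << wpt T >> = twist D (a - 1) (b + 1).
  by rewrite /twist; freeg_ring.
have := FS a b; have := FS (a - 1) b; lia.
Qed.

(** The b with [tau b = 0] is counted at a = 0, so the rank there is nonnegative. This stands in for
    Riemann's inequality and supplies the hypothesis of [glue_rank]. *)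
Lemma transmission_eventually_effective D tau :
  transmission_permutation D tau ->
  exists b, equiv_effective (D - << wpt T >> *~ b).
Proof.
move=> /transmissionP[[tau' _ tauK] [FS _] _]; exists (tau' 0).
have := FS 0 (tau' 0); rewrite tauK lexx => rD.
have /(rank_at_leastP gT _ 0)/rank_at_least0 : 0%:Z <= rank (twist D 0 (tau' 0)).
  by have := rankN1_le (twist D 0 (tau' 0 + 1)); move: rD; lia.
by rewrite /twist mulr0z addr0.
Qed.

End Transmission.

(** * Vertex gluing *)

Section Gluing.

(** [i1] and [i2] stand for the pushforwards of divisors. A divisor on the wedge splits only up to a
    multiple of the glued point, which is what [m] accounts for in [glue_lin]. *)
Record gluing (T1 T2 T : divisor_theory)
    (i1 : {additive {freeg (point T1)} -> {freeg (point T)}})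
    (i2 : {additive {freeg (point T2)} -> {freeg (point T)}}) : Prop := Gluing {
  glue_deg1 : forall D, deg (i1 D) = deg D;
  glue_deg2 : forall D, deg (i2 D) = deg D;
  glue_eff1 : forall D, effective D -> effective (i1 D);
  glue_eff2 : forall D, effective D -> effective (i2 D);
  glue_onto : forall D, exists D1 D2, D = i1 D1 + i2 D2;
  glue_eff_onto : forall E, effective E ->
    exists E1 E2, [/\ effective E1, effective E2 & E = i1 E1 + i2 E2];
  glue_v : i1 << vpt T1 >> = << vpt T >>;
  glue_w : i2 << wpt T2 >> = << wpt T >>;
  glue_q : i1 << wpt T1 >> = i2 << vpt T2 >>;
  glue_lin : forall D1 D2, lin_equiv (i1 D1 + i2 D2) 0 <-> exists m : int,
    lin_equiv (D1 + << wpt T1 >> *~ m) 0 /\ lin_equiv (D2 - << vpt T2 >> *~ m) 0;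
  glue_canonical :
    canonical T = i1 (canonical T1) + i2 (canonical T2) + i1 << wpt T1 >> *+ 2;
  glue_genus : genus T = (genus T1 + genus T2)%N
}.

Variables (T1 T2 T : divisor_theory).
Variables (i1 : {additive {freeg (point T1)} -> {freeg (point T)}})
          (i2 : {additive {freeg (point T2)} -> {freeg (point T)}}).
Hypotheses (g1 : good_theory T1) (g2 : good_theory T2) (g : good_theory T).
Hypothesis gl : gluing i1 i2.

Let v1 : {freeg (point T1)} := << vpt T1 >>.
Let w1 : {freeg (point T1)} := << wpt T1 >>.
Let v2 : {freeg (point T2)} := << vpt T2 >>.
Let w2 : {freeg (point T2)} := << wpt T2 >>.

Lemma glue_moveE D1 D2 (m : int) :
  i1 (D1 + w1 *~ m) + i2 (D2 - v2 *~ m) = i1 D1 + i2 D2.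
Proof.
by rewrite raddfD raddfB /= !raddfMz /= /w1 (glue_q gl); freeg_ring.
Qed.

Lemma glue_equiv_effective D1 D2 : equiv_effective (i1 D1 + i2 D2) <->
  exists m : int, equiv_effective (D1 + w1 *~ m) /\ equiv_effective (D2 - v2 *~ m).
Proof.
split=> [[E eE /(lin_equivB g)]|[m [[E1 eE1 D1E1] [E2 eE2 D2E2]]]].
  have [E1 [E2 [eE1 eE2 ->]]] := glue_eff_onto gl eE.
  have -> : i1 D1 + i2 D2 - (i1 E1 + i2 E2) = i1 (D1 - E1) + i2 (D2 - E2).
    by rewrite !raddfB /= opprD addrACA.
  move=> /(glue_lin gl)[m [h1 h2]]; exists m; split.
    by exists E1 => //; apply/(lin_equivB g1); move: h1; rewrite addrAC.
  by exists E2 => //; apply/(lin_equivB g2); move: h2; rewrite addrAC.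
exists (i1 E1 + i2 E2).
  by apply: effectiveD; [apply: (glue_eff1 gl)|apply: (glue_eff2 gl)].
apply/(lin_equivB g); rewrite -(glue_moveE _ _ m).
have -> : i1 (D1 + w1 *~ m) + i2 (D2 - v2 *~ m) - (i1 E1 + i2 E2) =
    i1 (D1 + w1 *~ m - E1) + i2 (D2 - v2 *~ m - E2).
  by rewrite opprD addrACA -!raddfB.
apply/(glue_lin gl); exists 0; rewrite !mulr0z addr0 subr0.
by split; [apply: (lin_equivB g1 _ _).1|apply: (lin_equivB g2 _ _).1].
Qed.

(* If [D - E1 - E2] is not equivalent to an effective divisor, then neither are
   [D1 - E1 - (l + 1) w1] and [D2 - E2 + l v2], with [l] maximal such that
   [D1 - E1 - l w1] is. *)
Lemma glue_rank (D1 : {freeg (point T1)}) (D2 : {freeg (point T2)}) :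
  (forall E1, exists l, equiv_effective (E1 - w1 *~ l)) ->
  is_min (fun l => (rank (D1 - w1 *~ (l + 1)) + 1) + (rank (D2 + v2 *~ l) + 1))
         (rank (i1 D1 + i2 D2) + 1).
Proof.
move=> ev1.
have upper (l : int) : rank (i1 D1 + i2 D2) + 1 <=
    (rank (D1 - w1 *~ (l + 1)) + 1) + (rank (D2 + v2 *~ l) + 1).
  have rE1 := rankN1_le (D1 - w1 *~ (l + 1)).
  have rE2 := rankN1_le (D2 + v2 *~ l).
  pose r1 := `|(rank (D1 - w1 *~ (l + 1)) + 1)%R|%N.
  pose r2 := `|(rank (D2 + v2 *~ l) + 1)%R|%N.
  have /(rank_ltP g1)[E1 [eE1 dE1 nE1]] : rank (D1 - w1 *~ (l + 1)) + 1 <= r1%:Z.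
    by rewrite /r1; lia.
  have /(rank_ltP g2)[E2 [eE2 dE2 nE2]] : rank (D2 + v2 *~ l) + 1 <= r2%:Z.
    by rewrite /r2; lia.
  have -> : (rank (D1 - w1 *~ (l + 1)) + 1) + (rank (D2 + v2 *~ l) + 1) =
    (r1 + r2)%N%:Z by rewrite /r1 /r2; lia.
  apply/(rank_ltP g); exists (i1 E1 + i2 E2); split.
  - by apply: effectiveD; [apply: (glue_eff1 gl)|apply: (glue_eff2 gl)].
  - by rewrite degD (glue_deg1 gl) (glue_deg2 gl) dE1 dE2.
  have -> : i1 D1 + i2 D2 - (i1 E1 + i2 E2) = i1 (D1 - E1) + i2 (D2 - E2).
    by rewrite !raddfB /= opprD addrACA.
  move=> /glue_equiv_effective[m [f1 f2]].
  (* Either m <= -(l + 1), and adding points at w1 makes [D1 - E1 - (l + 1) w1] effective up to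
     equivalence, or l + m >= 0, and adding points at v2 does so for [D2 - E2 + l v2]. *)
  have [ml|lm] := leP m (- (l + 1)).
    apply: nE1; have eX := effective_point (wpt T1) `|(- (l + 1) - m)%R|%N.
    have := equiv_effectiveD g1 f1 eX; congr equiv_effective.
    have -> : `|(- (l + 1) - m)%R|%N%:Z = - (l + 1) - m by lia.
    by rewrite -[_ - _ as X in << X *g _ >>]intz -freegU_mulz -/w1; freeg_ring.
  apply: nE2; have eX := effective_point (vpt T2) `|(l + m)%R|%N.
  have := equiv_effectiveD g2 f2 eX; congr equiv_effective.
  have -> : `|(l + m)%R|%N%:Z = l + m by lia.
  by rewrite -[l + m as X in << X *g _ >>]intz -freegU_mulz -/v2; freeg_ring.
split=> //.
have rD := rankN1_le (i1 D1 + i2 D2).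
pose r := `|(rank (i1 D1 + i2 D2) + 1)%R|%N.
have /(rank_ltP g)[E [eE dE nE]] : rank (i1 D1 + i2 D2) + 1 <= r%:Z.
  by rewrite /r; lia.
have [E1 [E2 [eE1 eE2 EE]]] := glue_eff_onto gl eE.
have [l0 hl0] := ev1 (D1 - E1).
(* The maximal l is sought at or above [l0], where the set is nonempty; the degree of [D1 - E1]
   bounds it. *)
pose ok n := `[< equiv_effective (D1 - E1 - w1 *~ (l0 + n%:Z)) >].
have ex : exists n, ok n by exists 0%N; apply/asboolP; rewrite addr0.
have bnd n : ok n -> (n <= `|(deg (D1 - E1) - l0)%R|%N)%N.
  move=> /asboolP/(equiv_effective_ge0 g1).
  have -> : deg (D1 - E1 - w1 *~ (l0 + n%:Z)) = deg (D1 - E1) - (l0 + n%:Z).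
    by rewrite [LHS]degB raddfMz /= /w1 degU intz.
  lia.
have [n /asboolP okn maxn] := ex_maxnP ex bnd; pose l := l0 + n%:Z.
have n1 : ~ equiv_effective (D1 - w1 *~ (l + 1) - E1).
  move=> h; have : ok n.+1.
    apply/asboolP; rewrite addrAC; have -> : l0 + n.+1%:Z = l + 1 by rewrite /l; lia.
    exact: h.
  by move=> /maxn; rewrite ltnn.
have n2 : ~ equiv_effective (D2 + v2 *~ l - E2).
  move=> h; apply: nE; rewrite EE.
  have -> : i1 D1 + i2 D2 - (i1 E1 + i2 E2) = i1 (D1 - E1) + i2 (D2 - E2).
    by rewrite !raddfB /= opprD addrACA.
  apply/glue_equiv_effective; exists (- l); rewrite !mulrNz opprK.
  by split; [exact: okn|move: h; rewrite addrAC].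
exists l; apply/eqP; rewrite eq_le upper andbT.
have -> : rank (i1 D1 + i2 D2) + 1 = deg E1 + deg E2.
  by rewrite -(glue_deg1 gl) -(glue_deg2 gl) -degD -EE dE /r; lia.
apply: lerD; [have dE1 := effective_deg_ge0 eE1|have dE2 := effective_deg_ge0 eE2].
  have -> : deg E1 = `|deg E1|%N%:Z by lia.
  by apply/(rank_ltP g1); exists E1; split=> //; lia.
have -> : deg E2 = `|deg E2|%N%:Z by lia.
by apply/(rank_ltP g2); exists E2; split=> //; lia.
Qed.

Lemma glue_k_general_transmission (k : nat) : k <> 1%N ->
  k_general_transmission k T1 -> k_general_transmission k T2 ->
  k_general_transmission k T.
Proof.
move=> k1 kgt1 kgt2 D; have [D1 [D2 DE]] := glue_onto gl D.
have ev1 E1 : exists l, equiv_effective (E1 - w1 *~ l).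
  have [_ [tau [htau _ _]]] := kgt1 E1.
  exact: transmission_eventually_effective htau.
have [_ [al [/transmissionP[bal cal cal'] sal ial]]] := kgt1 D1.
have [_ [be [/transmissionP[bbe cbe cbe'] sbe ibe]]] := kgt2 D2.
move: ial ibe => /inv_at_mostP[sa sag ca] /inv_at_mostP[sb sbg cb].
have cpa := CountedPerm bal (in_Sigma_periodic sal) ca cal cal'.
have cpb := CountedPerm bbe (in_Sigma_periodic sbe) cb cbe cbe'.
have [tau [F [F' [s [cpt ss hF hF']]]]] := demazure_product k1 cpa cpb.
have is_min_inj f m n : is_min f m -> is_min f n -> m = n.
  case=> [[i fi] hm] [[j fj] hn]; apply/eqP.
  by rewrite eq_le -{1}fj -{2}fi hm hn.
have FE a b : F a b = rank (twist D a b) + 1.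
  apply: is_min_inj (hF a b) _.
  have -> : twist D a b = i1 (D1 + v1 *~ a) + i2 (D2 - w2 *~ b).
    rewrite raddfD raddfB /= !raddfMz /= (glue_v gl) (glue_w gl) /twist DE.
    by freeg_ring.
  apply: (eq_is_min _ (erefl _) (glue_rank (D1 + v1 *~ a) (D2 - w2 *~ b) ev1)) => l.
  congr (_ + _ + (_ + _)); congr rank; rewrite /twist /v1 /w1 /v2 /w2.
  by freeg_ring.
have F'E a b : F' a b = rank (twist (canonical T - D) (- a) (- b)) + 1.
  apply: is_min_inj (hF' a b) _.
  have -> : twist (canonical T - D) (- a) (- b) =
      i1 (canonical T1 - D1 - v1 *~ a + w1 *+ 2) +
      i2 (canonical T2 - D2 + w2 *~ b).
    rewrite !(raddfD, raddfN) /= ?raddfMn ?raddfMz /= (glue_v gl) (glue_w gl).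
    by rewrite /twist DE (glue_canonical gl); freeg_ring.
  have [[l hl] hmin] := glue_rank (canonical T1 - D1 - v1 *~ a + w1 *+ 2)
    (canonical T2 - D2 + w2 *~ b) ev1.
  (* The minimum is reindexed by l = -l'. On the first side w1 then has coefficient 2 - (-l' + 1) =
     l' + 1, the 2 coming from the canonical divisor of the wedge. *)
  have E l' : rank (twist (canonical T1 - D1) (- a) (- (l' + 1))) + 1 +
      (rank (twist (canonical T2 - D2) (- l') (- b)) + 1) =
    rank (canonical T1 - D1 - v1 *~ a + w1 *+ 2 - w1 *~ (- l' + 1)) + 1 +
      (rank (canonical T2 - D2 + w2 *~ b + v2 *~ (- l')) + 1).
    congr (_ + _ + (_ + _)); congr rank; rewrite /twist /v1 /w1 /v2 /w2.
      by freeg_ring.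
    by freeg_ring.
  split; first by exists (- l); rewrite E opprK.
  by move=> l'; rewrite E.
have tr : transmission_permutation D tau.
  apply/transmissionP; case: cpt => bt _ _ cF cF'; split=> //.
    by have -> : (fun a b => rank (twist D a b) + 1) = F by do 2 apply/funext => ?.
  have -> // : (fun a b => rank (twist (canonical T - D) (- a) (- b)) + 1) = F'.
  by do 2 apply/funext => ?.
split; first exact: transmission_submodular tr.
exists tau; split=> //.
  exact: in_SigmaP (cp_periodic cpt) (cp_covered cpt).
apply/inv_at_mostP; exists s; last exact: cp_covered cpt.
by rewrite (glue_genus gl); apply: leq_trans ss _; apply: leq_add.
Qed.

End Gluing.

(** * Genus one *)

Section GenusOne.
Variables (T : divisor_theory) (gT : good_theory T).
Hypothesis v_not_w : ~ lin_equiv << vpt T >> << wpt T >>.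
Hypothesis effective_deg1 : forall D : {freeg (point T)},
  deg D = 1 -> equiv_effective D.
Hypothesis canonical_trivial : lin_equiv (canonical T) 0.
Implicit Types (D : {freeg (point T)}) (a b n : int).

Let v : {freeg (point T)} := << vpt T >>.
Let w : {freeg (point T)} := << wpt T >>.

(** In degree d + 1 > 0, removing d points leaves degree 1, which is effective up to equivalence.
    The rank is no larger because D cannot be equivalent to both (d + 1) v and d v + w. *)
Lemma rank_genus1 D : rank D + 1 =
  if deg D == 0 then `[< lin_equiv D 0 >]%:Z else Num.max 0 (deg D).
Proof.
have rD := rankN1_le D.
have lt0 : deg D < 0 -> rank D + 1 = 0.
  move=> d0; apply/eqP; rewrite eq_le; apply/andP; split; last lia.
  apply/(rank_ltP gT _ 0); exists 0; split; [exact: effective0|exact: deg0|].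
  by rewrite subr0 => /(equiv_effective_ge0 gT); lia.
case: eqP => [d0|dn0]; last have [d0|d0] := ltP (deg D) 0.
- case: asboolP => hD /=; apply/eqP; rewrite eq_le; apply/andP; split; try lia.
  + apply/(rank_ltP gT _ 1); exists << vpt T >>; split; last first.
    * by move=> /(equiv_effective_ge0 gT); rewrite degB degU d0.
    * by rewrite degU.
    exact: (effective_point (vpt T) 1).
  + suff /(rank_at_leastP gT) : rank_at_least D 0 by lia.
    exact/rank_at_least0/(equiv_effective_deg0 gT d0).
  + apply/(rank_ltP gT _ 0); exists 0; split; [exact: effective0|exact: deg0|].
    by rewrite subr0 => /(equiv_effective_deg0 gT d0).
- by rewrite lt0 //; lia.
have dD : deg D = `|deg D|.-1.+1%:Z by lia.
apply/eqP.
rewrite eq_le; apply/andP; split; last first.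
  suff /(rank_at_leastP gT) : rank_at_least D `|deg D|.-1 by lia.
  by move=> E eE dE; apply: effective_deg1; rewrite degB dE; lia.
set d := `|deg D|.-1 in dD *; rewrite dD.
have eff_dw (p : point T) : effective (<< d%:Z *g vpt T >> + << 1%N%:Z *g p >>).
  by apply: effectiveD; apply: effective_point.
have deg_dw (p : point T) : deg (<< d%:Z *g vpt T >> + << 1%N%:Z *g p >>) = d.+1%:Z.
  by rewrite degD !degU; lia.
have [h|h] := pselect (lin_equiv (D - (<< d%:Z *g vpt T >> + << 1%N%:Z *g vpt T >>)) 0).
  apply/(rank_ltP gT); exists (<< d%:Z *g vpt T >> + << 1%N%:Z *g wpt T >>).
  split=> // hE; apply: v_not_w; apply/(lin_equivB gT).
  have e0 : deg (D - (<< d%:Z *g vpt T >> + << 1%N%:Z *g wpt T >>)) = 0.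
    by rewrite degB deg_dw dD subrr.
  have := lin_equiv0B gT ((equiv_effective_deg0 gT e0).1 hE) h.
  by congr lin_equiv; freeg_ring.
apply/(rank_ltP gT); exists (<< d%:Z *g vpt T >> + << 1%N%:Z *g vpt T >>).
split=> // hE; apply: h; apply: (equiv_effective_deg0 gT _).1 hE.
by rewrite degB deg_dw dD subrr.
Qed.

(** The choice a = b - deg D makes the twist of degree 0, the only degree in which the rank is not
    determined by the degree. *)
Definition meets D b : bool := `[< lin_equiv (twist D (b - deg D) b) 0 >].

Lemma meetsB D b c : meets D b -> meets D c -> lin_equiv ((v - w) *~ (b - c)) 0.
Proof.
move=> /asboolP hb /asboolP hc; have := lin_equiv0B gT hb hc.
by congr lin_equiv; rewrite /twist /v /w; freeg_ring.
Qed.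

(** Two consecutive members would give v ~ w. The shift by one matches the predicate
    [meets D (n + 1)] that selects the transpositions of n and n + 1. *)
Lemma meetsN D b : meets D (b + 1) -> ~~ meets D (b + 1 + 1).
Proof.
move=> hb; apply/negP => /meetsB /(_ hb); rewrite addrAC subrr add0r mulr1z.
by move=> h; apply: v_not_w; apply/(lin_equivB gT).
Qed.

Definition genus1_transmission D n : int :=
  reflect_at (fun n => meets D (n + 1)) n + 1 - deg D.

Lemma genus1_transmissionE D n : genus1_transmission D n =
  if meets D (n + 1) then n + 2 - deg D
  else if meets D n then n - deg D else n + 1 - deg D.
Proof.
rewrite /genus1_transmission /reflect_at subrK.
by case: ifP => _; [|case: ifP => _]; lia.
Qed.

Lemma deg_twist D a b : deg (twist D a b) = deg D + a - b.
Proof. by rewrite /twist degB degD !raddfMz /= !degU mulNrz !intz. Qed.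

Lemma rank_twist D a b : rank (twist D a b) + 1 =
  if deg D + a - b == 0 then (meets D b)%:Z else Num.max 0 (deg D + a - b).
Proof.
rewrite rank_genus1 deg_twist; case: eqP => // dab.
by rewrite /meets; have -> : b - deg D = a by lia.
Qed.

Lemma rank_twist_canonical D a b :
  rank (twist (canonical T - D) (- a) (- b)) + 1 =
  if deg D + a - b == 0 then (meets D b)%:Z else Num.max 0 (b - a - deg D).
Proof.
have dK := lin_equiv0_deg gT canonical_trivial.
rewrite rank_genus1 deg_twist degB dK.
have -> : 0 - deg D - a - - b = - (deg D + a - b) by lia.
rewrite oppr_eq0; case: eqP => [dab|_]; last by congr Num.max; lia.
congr (nat_of_bool _)%:Z; apply: asbool_equiv_eq.
have -> : b - deg D = a by lia.
have E : twist (canonical T - D) (- a) (- b) = canonical T - twist D a b.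
  by rewrite /twist; freeg_ring.
rewrite E; split=> h; last exact: lin_equiv0B.
by have := lin_equiv0B gT canonical_trivial h; rewrite opprB addrC subrK.
Qed.

Lemma genus1_transmissionP D :
  transmission_permutation D (genus1_transmission D).
Proof.
apply/transmissionP; split.
- apply: (@bij_comp _ _ _ (fun n => n + 1 - deg D) (reflect_at _)).
    exists (fun n => n - 1 + deg D) => n; lia.
  by exists (reflect_at (fun n => meets D (n + 1))); apply: reflect_atK; apply: meetsN.
- split=> [a b|a]; last first.
    by exists (deg D + a + 1) => b hb; rewrite rank_twist; case: eqP; lia.
  rewrite !rank_twist genus1_transmissionE.
  have := @meetsN D (b - 1); rewrite subrK.
  case: (meets D b) => [/(_ isT)/negbTE->|_] /=; do 2 case: eqP => //=; try lia.
  - by case: (meets D (b + 1)) => /=; lia.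
  - by case: (meets D (b + 1)) => /=; lia.
  - by case: (meets D (b + 1)) => /=; lia.
- split=> [a b|a]; last first.
    by exists (deg D + a - 1) => b hb; rewrite rank_twist_canonical; case: eqP; lia.
  rewrite !rank_twist_canonical genus1_transmissionE.
  have := @meetsN D (b - 1); rewrite subrK.
  case: (meets D b) => [/(_ isT)/negbTE->|_] /=; do 2 case: eqP => //=; try lia.
  - by case: (meets D (b + 1)) => /=; lia.
  - by case: (meets D (b + 1)) => /=; lia.
  - by case: (meets D (b + 1)) => /=; lia.
Qed.

(** The first differences in b of the counts recover every comparison [tau b <= a]. *)
Lemma transmission_uniq D tau : transmission_permutation D tau ->
  tau =1 genus1_transmission D.
Proof.
move=> /transmissionP[_ [FS _] _] b.
have /transmissionP[_ [GS _] _] := genus1_transmissionP D.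
have E a : (tau b <= a) = (genus1_transmission D b <= a).
  by have := FS a b; rewrite GS; case: (tau b <= a); case: (genus1_transmission D b <= a); lia.
by apply/eqP; rewrite eq_le E lexx -E lexx.
Qed.

Lemma genus1_inversion D x y : inversions (genus1_transmission D) (x, y) ->
  meets D (x + 1) /\ y = x + 1.
Proof.
move=> [/= xy]; rewrite /genus1_transmission ltrD2r ltrD2r => r.
have [/andP[? /eqP->]//|n] := boolP (meets D (x + 1) && (y == x + 1)).
have := reflect_at_lt (P := fun n => meets D (n + 1)) (@meetsN D) xy n.
by rewrite ltNge (ltW r).
Qed.

(** If the torsion order is k, the b that meet D are all congruent modulo k, which gives at most one
    class of inversions. For the converse the divisor 0 suffices: n meets it if and only if n v ~ n
    w, and n = 0 always does. *)
Lemma genus1_k_general_transmission (k : nat) : k <> 1%N -> genus T = 1%N ->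
  k_general_transmission k T <-> torsion_order T k.
Proof.
move=> k1 g1; split=> [kgt|tors D]; last first.
  have vw (n : int) : lin_equiv ((v - w) *~ n) 0 <-> exists m, n = m * k%:Z.
    rewrite -tors; apply: iff_trans (iff_sym (lin_equivB gT _ _)).
    by rewrite -mulrzBl.
  have meetsD n j : meets D (n + j * k%:Z) = meets D n.
    apply: asbool_equiv_eq.
    have E : twist D (n + j * k%:Z - deg D) (n + j * k%:Z) =
        twist D (n - deg D) n + (v - w) *~ (j * k%:Z).
      by rewrite /twist /v /w; freeg_ring.
    have hj : lin_equiv ((v - w) *~ (j * k%:Z)) 0 by apply/vw; exists j.
    rewrite E; split=> h; last exact: lin_equiv0D.
    by have := lin_equiv0B gT h hj; rewrite addrK.
  have per : k_periodic k (genus1_transmission D).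
    move=> n; rewrite !genus1_transmissionE addrAC.
    have := meetsD n 1; have := meetsD (n + 1) 1; rewrite !mul1r => -> ->.
    by case: ifP => _; [|case: ifP => _]; lia.
  have [s s1 cs] : exists2 s, (size s <= 1)%N &
      inversions_covered k (genus1_transmission D) s.
    have [[b0 hb0]|none] := pselect (exists b, meets D b); last first.
      exists [::] => // -[x y] /genus1_inversion[mx _]; case: none.
      by exists (x + 1).
    exists [:: (b0 - 1, b0)] => // -[x y] /genus1_inversion[mx ->].
    exists (b0 - 1, b0); first by rewrite mem_head.
    have /vw[j hj] := meetsB mx hb0; exists j; congr pair => /=; lia.
  split; first exact: transmission_submodular (genus1_transmissionP D).
  exists (genus1_transmission D); split; first exact: genus1_transmissionP.
    exact: in_SigmaP per cs.
  by apply/inv_at_mostP; exists s; rewrite ?g1.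
have [_ [tau [htau stau itau]]] := kgt 0.
have tauE : tau = genus1_transmission 0.
  by apply/funext; apply: transmission_uniq htau.
have m0 n : lin_equiv (v *~ n) (w *~ n) <-> meets 0 n.
  rewrite (lin_equivB gT); split=> [h|/asboolP]; [apply/asboolP; move: h|];
  by rewrite /twist deg0 subr0 add0r.
have per := in_Sigma_periodic stau; rewrite tauE in per.
move: itau; rewrite g1 tauE => /inv_at_mostP[s s1 cs].
have meets0 : meets 0 0.
  by apply/m0; rewrite !mulr0z; apply: (lin_equiv00 gT).
have inv n : meets 0 n -> inversions (genus1_transmission 0) (n - 1, n).
  move=> hn; split=> /=; first lia.
  rewrite !genus1_transmissionE subrK hn.
  have := @meetsN 0 (n - 1); rewrite subrK => /(_ hn)/negbTE->.
  lia.
move=> n; rewrite -/v -/w m0; split=> [hn|[m ->]].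
  (* The inversions (n - 1, n) and (-1, 0) are covered by a list of at most one entry, so n is a
     multiple of k. *)
  have [q qs [i [q1 q2]]] := cs _ (inv _ hn).
  have [q' qs' [j [q1' q2']]] := cs _ (inv _ meets0).
  case: s s1 qs qs' {cs} => [|q0 [|]] //= _; rewrite !inE => /eqP Eq /eqP Eq'.
  by exists (i - j); move: q2 q2'; rewrite Eq Eq'; lia.
(* Since 0 meets the divisor 0, the permutation fixes 0 and hence m k; if m k did not meet it, the
   value would be m k + 1 or m k + 2. *)
have := k_periodicM per m 0; rewrite add0r !genus1_transmissionE.
rewrite meets0; have := @meetsN 0 (0 - 1); rewrite subrK => /(_ meets0)/negbTE->.
by case: (meets 0 (m * k%:Z)) => //; case: ifP; lia.
Qed.

End GenusOne.

(** * Cycles in multigraphs *)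

Section Multigraphs.
Implicit Types (G : marked_multigraph).

Lemma connected_constant G (A : Type) (f : vertex G -> A) :
  (forall e : edge G, f (endpoint e false) = f (endpoint e true)) ->
  forall x y, f x = f y.
Proof.
move=> fe x y; have /connectP[s + ->] := multigraph_connected x y.
elim: s x => [|z s IH] x //= /andP[/existsP[[e b] /= /andP[/eqP<- /eqP<-]] /IH <-].
by case: b => /=; rewrite fe.
Qed.

Lemma half_edges_sum G (A : nmodType) (x : vertex G) (phi : edge G * bool -> A) :
  \sum_(d <- half_edges x) phi d =
  \sum_(e : edge G) ((if endpoint e false == x then phi (e, false) else 0) +
                     (if endpoint e true == x then phi (e, true) else 0)).
Proof.
rewrite /half_edges big_filter big_enum_cond /= big_mkcond /=.
transitivity (\sum_(e : edge G) \sum_(b : bool)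
    (if endpoint e b == x then phi (e, b) else 0)).
  by rewrite pair_bigA; apply: eq_bigr => -[e b].
by apply: eq_bigr => e _; rewrite big_bool addrC.
Qed.

Lemma valenceE G (x : vertex G) : (valence x)%:Z = \sum_(d <- half_edges x) 1.
Proof. by rewrite /valence big_const_seq count_predT iter_addr_0 natz. Qed.

Lemma sum_half_edges G (A : nmodType) (phi : edge G * bool -> A) :
  \sum_(x : vertex G) \sum_(d <- half_edges x) phi d =
  \sum_(e : edge G) (phi (e, false) + phi (e, true)).
Proof.
under eq_bigr do rewrite half_edges_sum.
rewrite exchange_big; apply: eq_bigr => e _ /=.
by rewrite big_split /= -!big_mkcond /=; congr (_ + _); apply: big_pred1 => x; rewrite eq_sym.
Qed.

Lemma boundaryE G (u : 'rV[rat]_#|vertex G|) (e : edge G) :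
  (u *m (boundary G)^T) 0 (enum_rank e) =
  u 0 (enum_rank (endpoint e true)) - u 0 (enum_rank (endpoint e false)).
Proof.
rewrite mxE; under eq_bigr do rewrite !mxE enum_rankK mulrBr.
have delta x : \sum_(i < #|vertex G|) u 0 i * (x == enum_val i)%:R = u 0 (enum_rank x).
  rewrite (bigD1 (enum_rank x)) //= enum_rankK eqxx mulr1 big1 ?addr0 // => i ix.
  case: eqP => [xi|]; last by rewrite mulr0.
  by rewrite xi enum_valK eqxx in ix.
by rewrite sumrB !delta.
Qed.

(** Euler characteristic: by connectedness the kernel of the coboundary consists of the constants,
    so the boundary has rank one less than the number of vertices. *)
Lemma betti1E G : (betti1 G + #|vertex G| = #|edge G|.+1)%N.
Proof.
pose one : 'rV[rat]_#|vertex G| := const_mx 1.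
have ker : (kermx (boundary G)^T :=: one)%MS.
  apply/eqmxP/andP; split; last first.
    by apply/sub_kermxP/rowP => j; rewrite -[j]enum_valK boundaryE !mxE subrr.
  apply/row_subP => i; set u := row i _.
  have /rowP u0 : u *m (boundary G)^T = 0.
    by apply/sub_kermxP; apply: row_sub.
  have uconst : forall x y, u 0 (enum_rank x) = u 0 (enum_rank y).
    apply: connected_constant => e.
    by have := u0 (enum_rank e); rewrite boundaryE [RHS]mxE => /subr0_eq.
  suff -> : u = u 0 (enum_rank (vmark G)) *: one by apply: scalemx_sub.
  apply/rowP => j; rewrite -[j]enum_valK (uconst _ (vmark G)).
  by rewrite [RHS]mxE [X in _ * X]mxE mulr1.
have r1 : \rank one = 1%N.
  rewrite rank_rV; case: eqP => // /rowP /(_ (enum_rank (vmark G))).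
  by rewrite !mxE => /eqP; rewrite oner_eq0.
have := mxrank_ker (boundary G)^T; rewrite ker r1 mxrank_tr.
rewrite /betti1 mxrank_ker.
have := rank_leq_row (boundary G); have := rank_leq_col (boundary G); lia.
Qed.

End Multigraphs.

(** * Half-edges, valences and Betti number of a wedge *)

Section GlueMultigraphs.
Variables G1 G2 : marked_multigraph.
Local Notation G := (glue_multigraph G1 G2).
Local Notation inl1 := (@glue_inl G1 G2).
Local Notation inr2 := (@glue_inr G1 G2).

Lemma glue_inl_eq (x y : vertex G1) : (inl1 x == inl1 y) = (x == y).
Proof. by []. Qed.

Lemma glue_inr_eq (x y : vertex G2) : (inr2 x == inr2 y) = (x == y).
Proof.
apply/eqP/eqP => [|->//]; rewrite /glue_inr.
case: insubP => [u _ <-|/negPn/eqP->]; case: insubP => [t _ <-|/negPn/eqP->] //.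
by case=> ->.
Qed.

Lemma glue_inrl_eq (y : vertex G2) (x : vertex G1) :
  (inr2 y == inl1 x) = (y == vmark G2) && (x == wmark G1).
Proof.
rewrite /glue_inr; case: insubP => [u yu _|/negPn/eqP->].
  by rewrite (negbTE yu).
by rewrite eqxx /= eq_sym glue_inl_eq.
Qed.

Lemma glue_inl_inj : injective inl1.
Proof. by move=> x y []. Qed.

Lemma glue_inr_inj : injective inr2.
Proof. by move=> x y /eqP; rewrite glue_inr_eq => /eqP. Qed.

Lemma glue_inlr x y : inl1 x = inr2 y <-> x = wmark G1 /\ y = vmark G2.
Proof.
split=> [/esym/eqP|[-> ->]]; last by rewrite glue_inr_mark.
by rewrite glue_inrl_eq => /andP[/eqP-> /eqP->].
Qed.

Lemma glue_vertexP (P : vertex G -> Prop) :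
  (forall x, P (inl1 x)) -> (forall y, y != vmark G2 -> P (inr2 y)) -> forall z, P z.
Proof. by move=> h1 h2 [x|y]; [exact: h1|have <- := glue_inr_val G1 y; apply/h2/(valP y)]. Qed.

Lemma glue_half_edges_inl (A : nmodType) (phi : edge G * bool -> A) x :
  \sum_(d <- half_edges (inl1 x : vertex G)) phi d =
  \sum_(d <- half_edges x) phi (inl d.1, d.2) +
  (if x == wmark G1 then \sum_(d <- half_edges (vmark G2)) phi (inr d.1, d.2) else 0).
Proof.
rewrite !half_edges_sum big_sumType /=; congr (_ + _).
have [->|xw] := eqVneq x (wmark G1).
  by apply: eq_bigr => e _; rewrite !glue_inrl_eq eqxx !andbT.
by apply: big1 => e _; rewrite !glue_inrl_eq (negbTE xw) !andbF addr0.
Qed.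

Lemma glue_half_edges_inr (A : nmodType) (phi : edge G * bool -> A) y :
  y != vmark G2 ->
  \sum_(d <- half_edges (inr2 y : vertex G)) phi d =
  \sum_(d <- half_edges y) phi (inr d.1, d.2).
Proof.
move=> yv; rewrite !half_edges_sum big_sumType /= big1 ?add0r.
  by apply: eq_bigr => e _; rewrite !glue_inr_eq.
by move=> e _; rewrite ![inl1 _ == _]eq_sym !glue_inrl_eq (negbTE yv) addr0.
Qed.

Lemma glue_valence_inl x : (valence (inl1 x : vertex G))%:Z =
  (valence x)%:Z + (if x == wmark G1 then (valence (vmark G2))%:Z else 0).
Proof. by rewrite !valenceE glue_half_edges_inl. Qed.

Lemma glue_valence_inr y : y != vmark G2 ->
  valence (inr2 y : vertex G) = valence y.
Proof.
move=> yv; apply/eqP; rewrite -eqz_nat !valenceE.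
by rewrite (glue_half_edges_inr (fun=> 1)).
Qed.

Lemma glue_betti1 : betti1 G = (betti1 G1 + betti1 G2)%N.
Proof.
have := betti1E G; have := betti1E G1; have := betti1E G2.
have -> : #|edge G| = (#|edge G1| + #|edge G2|)%N by rewrite card_sum.
have : #|vertex G2| = #|{: {x : vertex G2 | x != vmark G2}}|.+1.
  have V0 : (0 < #|vertex G2|)%N by apply/card_gt0P; exists (vmark G2).
  by rewrite card_sig -(prednK V0) -(cardC1 (vmark G2)).
have -> : #|vertex G| = (#|vertex G1| + #|{: {x : vertex G2 | x != vmark G2}}|)%N.
  by rewrite card_sum.
lia.
Qed.

End GlueMultigraphs.

(** * Rooted spanning trees *)

Section SpanningTree.
Variables (G : marked_multigraph) (r : vertex G).
Local Notation V := (vertex G).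
Local Notation half := (edge G * bool)%type.

Definition hend (d : half) : V := endpoint d.1 d.2.
Definition hrev (d : half) : half := (d.1, ~~ d.2).
Definition hsign (d : half) : int := if d.2 then -1 else 1.

(* [up x] is the half-edge at [x] that leads towards the root [r]. *)
Definition is_tree (depth : V -> nat) (up : V -> half) : Prop :=
  forall x, x != r -> hend (up x) = x /\ (depth (hend (hrev (up x))) < depth x)%N.

(** The depth is the length of a shortest path to the root, and [up x] is the first half-edge of
    such a path; [e] provides a value for [up] at the root. *)
Lemma spanning_tree (e : edge G) : exists depth up, is_tree depth up.
Proof.
have ex x : exists n, `[< exists s, [/\ path (adjacent (@endpoint G)) x s,
    last x s = r & size s = n] >].
  have /connectP[s ps ls] := multigraph_connected x r.
  by exists (size s); apply/asboolP; exists s.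
pose depth x := ex_minn (ex x).
have step x : exists d : half,
    x != r -> hend d = x /\ (depth (hend (hrev d)) < depth x)%N.
  have [->|xr] := eqVneq x r; first by exists (e, true).
  rewrite {2}/depth; case: ex_minnP => n /asboolP[s [ps ls <-]] _.
  case: s ps ls => [|y s] /=; first by move=> _ xE; rewrite xE eqxx in xr.
  move=> /andP[/existsP[d /andP[/eqP dx /eqP dy]] ps] ls.
  exists d => _; split; first exact: dx.
  rewrite /hend /= dy /depth ltnS; case: ex_minnP => m _; apply.
  by apply/asboolP; exists s.
have [up hup] := choice step.
by exists depth, up.
Qed.

Variables (depth : V -> nat) (up : V -> half).
Hypothesis tree : is_tree depth up.

Definition parent x := hend (hrev (up x)).

Lemma hend_up x : x != r -> hend (up x) = x.
Proof. by case/tree. Qed.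

Lemma depth_parent x : x != r -> (depth (parent x) < depth x)%N.
Proof. by case/tree. Qed.

Lemma tree_ind (P : V -> Prop) : P r ->
  (forall x, x != r -> P (parent x) -> P x) -> forall x, P x.
Proof.
move=> Pr Pp x; have [n] := ubnP (depth x); elim: n x => // n IH x xn.
have [->//|xr] := eqVneq x r; apply: Pp => //; apply: IH.
exact: leq_trans (depth_parent xr) _.
Qed.

(** Recursion with fuel: n rounds settle the value at every vertex of depth less than n. *)
Lemma tree_rec (T : Type) (a : T) (step : V -> T -> T) :
  exists f, f r = a /\ forall x, x != r -> f x = step x (f (parent x)).
Proof.
pose g n := iter n (fun h x => if x == r then a else step x (h (parent x))) (fun=> a).
have gE n x : (depth x < n)%N -> g n x = g (depth x).+1 x.
  have [k] := ubnP n; elim: k n x => // k IH [//|n] x nk xn /=.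
  case: eqVneq => // xr; have dx := depth_parent xr; congr step.
  by rewrite IH ?[in RHS]IH //; lia.
exists (fun x => g (depth x).+1 x); split; first by rewrite /= eqxx.
move=> x xr; rewrite [LHS]/= (negbTE xr); congr step; apply: gE.
exact: depth_parent.
Qed.

(** Two distinct vertices with the same upward edge would be parents of each other, and the depth
    would decrease both ways. *)
Lemma up_edge_inj x y : x != r -> y != r -> (up x).1 = (up y).1 -> x = y.
Proof.
move=> xr yr; have := hend_up xr; have := hend_up yr.
have := depth_parent xr; have := depth_parent yr; rewrite /parent /hend /=.
case: (up x) (up y) => [e b] [e' b'] /= dy dx ey ex E; rewrite -{}E in dy ey.
have [bb|bb] := eqVneq b b'; first by rewrite -ex -ey bb.
have bE : b' = ~~ b by case: (b) (b') bb => [] [].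
by move: dx dy; rewrite bE negbK -bE ex ey; lia.
Qed.

(** There are as many edges as vertices, and the tree uses one edge for each vertex other than the
    root. *)
Lemma extra_edge : betti1 G = 1%N -> exists e0,
  (forall x, x != r -> (up x).1 != e0) /\
  (forall e, e != e0 -> exists2 x, x != r & (up x).1 = e).
Proof.
move=> b1; pose S := [set (up x).1 | x in [set~ r]]%SET.
have cS : #|S| = #|V|.-1.
  rewrite card_in_imset ?cardsC1 // => x y; rewrite !inE => xr yr.
  exact: up_edge_inj.
have V0 : (0 < #|V|)%N by apply/card_gt0P; exists r.
have /cards1P[e0 SE] : #|~: S|%SET == 1%N.
  have := betti1E G; have := cardsC S; rewrite b1 cS; lia.
exists e0; split=> [x xr|e].
  apply/negP => /eqP E; have : e0 \in (~: S)%SET by rewrite SE set11.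
  by rewrite inE => /negP; apply; apply/imsetP; exists x; rewrite ?inE.
move=> ee0; have : e \notin (~: S)%SET by rewrite SE inE.
by rewrite inE negbK => /imsetP[x]; rewrite !inE => xr ->; exists x.
Qed.

End SpanningTree.

(** * Abel-Jacobi coordinates for Betti number one *)

Section CycleCoordinates.
Variables (G : marked_multigraph) (R : archiRealFieldType) (len : edge G -> R).
Hypothesis len_gt0 : forall e, 0 < len e.
Local Notation V := (vertex G).
Local Notation E := (edge G).

(* [theta] is the position along the cycle, of length [L], of the retraction of
   a vertex to the cycle, and [c] is the cycle as an integral flow.  An edge
   contributes to a divisor its total interior degree [delta e] and its moment
   [M e] with respect to [endpoint e true]. *)
Record cycle_coordinates (theta : V -> R) (c : E -> int) (L : R) : Prop :=
    CycleCoordinates {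
  cycle_length_gt0 : 0 < L;
  cycle_unit : forall e, [\/ c e = 0, c e = 1 | c e = -1];
  cycle_edge : forall e, exists j : int,
    theta (endpoint e false) = theta (endpoint e true) + (c e)%:~R * len e + j%:~R * L;
  cycle_integral : (forall e, len e = 1) ->
    L \is a Num.int /\ forall x, theta x \is a Num.int;
  cycle_principal : forall (D0 : V -> int) (delta : E -> int) (M : E -> R) (j : int),
    \sum_x D0 x + \sum_e delta e = 0 ->
    \sum_x (D0 x)%:~R * theta x +
      \sum_e ((delta e)%:~R * theta (endpoint e true) + (c e)%:~R * M e) = j%:~R * L ->
    exists (h : V -> R) (m : E -> int),
      (forall e, h (endpoint e true) - h (endpoint e false) = (m e)%:~R * len e + M e) /\
      (forall x, D0 x = \sum_(d <- half_edges x) (if d.2 then - m d.1 - delta d.1 else m d.1));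
  cycle_canonical : \sum_x ((valence x)%:Z - 2)%:~R * theta x = 0;
  cycle_onto : forall s : R, exists j : int,
    (exists x, s = j%:~R * L + theta x) \/
    (exists e u, 0 <= u <= len e /\
       s = j%:~R * L + theta (endpoint e true) + (c e)%:~R * u)
}.

Section Construction.
Variables (r : V) (depth : V -> nat) (up : V -> E * bool) (e0 : E).
Hypothesis tree : is_tree r depth up.
Hypothesis up_e0 : forall x, x != r -> (up x).1 != e0.
Hypothesis up_onto : forall e, e != e0 -> exists2 x, x != r & (up x).1 = e.
Local Notation parent := (parent up).

(* The flow of the path of the tree from [x] to [r]. *)
Variable A : V -> E -> int.
Hypothesis A_root : forall e, A r e = 0.
Hypothesis A_up : forall x e, x != r ->
  A x e = (if e == (up x).1 then hsign (up x) else 0) + A (parent x) e.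

Definition divergence (m : E -> int) (x : V) : int :=
  \sum_(d <- half_edges x) hsign d * m d.1.

Lemma divergenceE m x : divergence m x =
  \sum_e ((if endpoint e false == x then m e else 0) -
          (if endpoint e true == x then m e else 0)).
Proof.
rewrite /divergence half_edges_sum; apply: eq_bigr => e _.
by rewrite /hsign /= mul1r mulN1r; congr (_ + _); case: ifP => // _; rewrite oppr0.
Qed.

Lemma divergence_edge (d : E * bool) x :
  divergence (fun e => if e == d.1 then hsign d else 0) x =
  (hend d == x)%:Z - (hend (hrev d) == x)%:Z.
Proof.
rewrite divergenceE (bigD1 d.1) //= eqxx big1 ?addr0; last first.
  by move=> e /negbTE->; rewrite !if_same subrr.
by case: d => e [] /=; rewrite /hsign /hend /=; do 2 case: eqP => _.
Qed.

Lemma divergenceD m m' x :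
  divergence (fun e => m e + m' e) x = divergence m x + divergence m' x.
Proof. by rewrite -big_split; apply: eq_bigr => d _; rewrite mulrDr. Qed.

Lemma divergenceZ k m x : divergence (fun e => k * m e) x = k * divergence m x.
Proof. by rewrite mulr_sumr; apply: eq_bigr => d _; rewrite mulrCA. Qed.

Lemma divergence_sum (I : finType) (m : I -> E -> int) x :
  divergence (fun e => \sum_i m i e) x = \sum_i divergence (m i) x.
Proof.
by rewrite exchange_big; apply: eq_bigr => d _; rewrite mulr_sumr.
Qed.

Lemma divergence_path x y : divergence (A x) y = (x == y)%:Z - (r == y)%:Z.
Proof.
elim/(tree_ind tree): x => [|x xr IH].
  by rewrite subrr /divergence big1 // => d _; rewrite A_root mulr0.
transitivity (divergence (fun e => (if e == (up x).1 then hsign (up x) else 0) +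
    A (parent x) e) y).
  by congr (divergence _ y); apply/funext => e; rewrite A_up.
by rewrite divergenceD divergence_edge IH (hend_up tree xr) /parent; lia.
Qed.

Lemma path_e0 x : A x e0 = 0.
Proof.
elim/(tree_ind tree): x => // x xr IH.
by rewrite A_up // eq_sym (negbTE (up_e0 xr)) add0r.
Qed.

Let B x z : int := A x (up z).1 * hsign (up z).

Lemma hsignK (d : E * bool) : hsign d * hsign d = 1.
Proof. by case: d => e []. Qed.

(** [B x z] indicates whether z lies on the tree path from x to the root. The depth bound shows in
    the induction that z is not met a second time above itself. *)
Lemma path01 x z : z != r -> B x z = 0 \/ B x z = 1 /\ (depth z <= depth x)%N.
Proof.
move=> zr; elim/(tree_ind tree): x => [|x xr IH].
  by left; rewrite /B A_root mul0r.
have dx := depth_parent tree xr.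
have -> : B x z = (x == z)%:Z + B (parent x) z.
  rewrite /B A_up // mulrDl; congr (_ + _).
  have [->|xz] := eqVneq x z; first by rewrite eqxx hsignK.
  case: eqP => [E|]; last by rewrite mul0r.
  by rewrite (up_edge_inj tree xr zr (esym E)) eqxx in xz.
case: IH => [->|[-> dz]]; rewrite ?addr0.
  by have [<-|_] := eqVneq x z; [right|left].
have [xz|_] := eqVneq x z; first by move: dx dz; rewrite xz; lia.
by right; split=> //; lia.
Qed.

Let x1 := endpoint e0 false.
Let y1 := endpoint e0 true.

(** The fundamental cycle of [e0]: along [e0] from [x1] to [y1], up the tree to the root, and back
    down to [x1]. The common part of the two tree paths cancels. *)
Definition cycle_flow e : int := (e == e0)%:Z + A y1 e - A x1 e.
Local Notation c := cycle_flow.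

(** The pairing, weighted by edge lengths, of the cycle with the tree path from x: the Abel-Jacobi
    map based at the root, before reduction modulo the length. *)
Definition cycle_position x : R := \sum_e (c e * A x e)%:~R * len e.
Local Notation theta := cycle_position.

Definition cycle_length : R := \sum_e (c e * c e)%:~R * len e.
Local Notation L := cycle_length.

Lemma cycle_e0 : c e0 = 1.
Proof. by rewrite /c eqxx !path_e0. Qed.

Lemma cycle_up z : z != r -> c (up z).1 * hsign (up z) = B y1 z - B x1 z.
Proof. by move=> zr; rewrite /c (negbTE (up_e0 zr)) add0r mulrBl. Qed.

Lemma cycle_flow_unit e : [\/ c e = 0, c e = 1 | c e = -1].
Proof.
have [->|/up_onto[z zr <-]] := eqVneq e e0; first by apply: Or32; apply: cycle_e0.
have := cycle_up zr; have := path01 y1 zr; have := path01 x1 zr.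
rewrite /hsign; case: (up z).2; move=> [->|[-> _]] [->|[-> _]] => E;
  by (apply: Or31; lia) || (apply: Or32; lia) || (apply: Or33; lia).
Qed.

Lemma divergence_cycle x : divergence c x = 0.
Proof.
transitivity (divergence (fun e => (if e == (e0, false).1 then hsign (e0, false) else 0) +
    (A y1 e + -1 * A x1 e)) x).
  by congr (divergence _ x); apply/funext => e; rewrite /c /hsign /=; case: (e == e0) => /=; lia.
rewrite !divergenceD divergenceZ !divergence_path divergence_edge /hend /=.
by rewrite -/x1 -/y1; lia.
Qed.

Lemma cycle_length_pos : 0 < L.
Proof.
rewrite /L (bigD1 e0) //= cycle_e0 mulr1 mul1r ltr_wpDr // sumr_ge0 // => e _.
by rewrite mulr_ge0 ?(ltW (len_gt0 e)) // ler0z -expr2 sqr_ge0.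
Qed.

(** The tree paths from the two ends of a tree edge differ by that edge; for [e0] they differ by
    [e0] minus the whole cycle. *)
Lemma path_edge e e' :
  A (endpoint e false) e' - A (endpoint e true) e' =
  (e' == e)%:Z - (if e == e0 then c e' else 0).
Proof.
case: (eqVneq e e0) => [->|ee0].
  by rewrite -/x1 -/y1 /c; lia.
have [z zr ze] := up_onto ee0; have := A_up e' zr; have := hend_up tree zr.
rewrite subr0 -ze /parent /hend /hrev /=; case: (up z) => e1 [] /= -> ->;
by rewrite /hsign /=; case: eqP => _ /=; lia.
Qed.

Lemma cycle_positionB e : theta (endpoint e false) - theta (endpoint e true) =
  (c e)%:~R * len e - (if e == e0 then L else 0).
Proof.
rewrite /theta -sumrB.
transitivity (\sum_e' ((c e' * (e' == e)%:Z)%:~R * len e' -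
    (if e == e0 then (c e' * c e')%:~R * len e' else 0))).
  apply: eq_bigr => e' _; rewrite -mulrBl -rmorphB /= -mulrBr path_edge.
  by case: ifP => _; rewrite ?subr0 // mulrBr rmorphB /= mulrBl.
rewrite sumrB; congr (_ - _).
  rewrite (bigD1 e) //= eqxx mulr1 big1 ?addr0 // => e' /negbTE->.
  by rewrite mulr0 mul0r.
by case: ifP => // _; apply: big1_eq.
Qed.

Lemma cycle_position_root : theta r = 0.
Proof. by apply: big1 => e _; rewrite A_root mulr0 mul0r. Qed.

(* [m] is the flow with divergence [D0] corrected by a multiple of the cycle, so
   that the cochain [w] vanishes on the cycle and is the coboundary of [h]. *)
Lemma cycle_flow_principal (D0 : V -> int) (delta : E -> int) (M : E -> R) (j : int) :
  \sum_x D0 x + \sum_e delta e = 0 ->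
  \sum_x (D0 x)%:~R * theta x +
    \sum_e ((delta e)%:~R * theta (endpoint e true) + (c e)%:~R * M e) = j%:~R * L ->
  exists (h : V -> R) (m : E -> int),
    (forall e, h (endpoint e true) - h (endpoint e false) = (m e)%:~R * len e + M e) /\
    (forall x, D0 x = \sum_(d <- half_edges x) (if d.2 then - m d.1 - delta d.1 else m d.1)).
Proof.
move=> deg0 AJ.
(* The interior degree of each edge is moved to its end [true], the end with respect to which the
   moments [M] are taken. *)
pose D1 x := D0 x + \sum_(e | endpoint e true == x) delta e.
have sumD1 (W : zmodType) (f : int -> V -> W) :
    (forall k k' x, f (k + k') x = f k x + f k' x) ->
    \sum_x f (D1 x) x = \sum_x f (D0 x) x + \sum_e f (delta e) (endpoint e true).
  move=> fD; have f0 x : f 0 x = 0 by apply: (addrI (f 0 x)); rewrite -fD !addr0.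
  rewrite (partition_big (fun e => endpoint e true) xpredT) //= -big_split.
  apply: eq_bigr => x _ /=; rewrite fD; congr (_ + _).
  rewrite (big_morph (fun k => f k x) (id1 := 0) (op1 := +%R)) //.
  by apply: eq_bigr => e /eqP->.
pose m e := \sum_x D1 x * A x e - j * c e.
pose w e := (m e)%:~R * len e + M e.
(* The potential is minus the integral of [w] along the tree path to the root. Its coboundary is [w]
   on tree edges, and also on [e0] once [w] integrates to 0 over the cycle. The latter is the
   hypothesis on positions, and is why j times the cycle is subtracted in [m]. *)
exists (fun x => - \sum_e (A x e)%:~R * w e), m.
have divm x : divergence m x = D1 x.
  transitivity (divergence (fun e => \sum_y D1 y * A y e + (- j) * c e) x).
    by congr (divergence _ x); apply/funext => e; rewrite /m mulNr.
  rewrite divergenceD divergenceZ divergence_cycle mulr0 addr0 divergence_sum.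
  under eq_bigr do rewrite divergenceZ divergence_path mulrBr.
  rewrite sumrB -mulr_suml (sumD1 int (fun k _ => k)) // deg0 mul0r subr0.
  rewrite (bigD1 x) //= eqxx mulr1 big1 ?addr0 // => y /negbTE->.
  by rewrite mulr0.
have cw : \sum_e (c e)%:~R * w e = 0.
  transitivity (\sum_x (D1 x)%:~R * theta x - j%:~R * L + \sum_e (c e)%:~R * M e).
    under eq_bigr do rewrite /w mulrDr.
    rewrite big_split /=; congr (_ + _).
    rewrite /L mulr_sumr; under [in RHS]eq_bigr do rewrite /theta mulr_sumr.
    rewrite exchange_big -sumrB /=; apply: eq_bigr => e _.
    rewrite /m; move: (c e) => k.
    rewrite rmorphB /= raddf_sum /= mulrA mulrBr mulrBl; congr (_ - _).
      rewrite mulr_sumr mulr_suml; apply: eq_bigr => x _.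
      by rewrite !rmorphM /=; ring.
    by rewrite !rmorphM /=; ring.
  rewrite (sumD1 R (fun k x => k%:~R * theta x)); last first.
    by move=> k k' x; rewrite rmorphD mulrDl.
  by move: AJ; rewrite big_split /= => AJ; lra.
split=> [e|x].
  rewrite opprK addrC -sumrB.
  transitivity (\sum_e' ((e' == e)%:Z%:~R * w e' - (if e == e0 then (c e')%:~R * w e' else 0))).
    apply: eq_bigr => e' _; rewrite -mulrBl -rmorphB /= path_edge.
    by case: (e == e0); rewrite ?subr0 // rmorphB /= mulrBl.
  rewrite sumrB; have -> : \sum_e' (if e == e0 then (c e')%:~R * w e' else 0) = 0.
    by case: (e == e0); rewrite ?cw ?big1_eq.
  rewrite subr0 (bigD1 e) //= eqxx mul1r big1 ?addr0 // => e' /negbTE->.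
  by rewrite mul0r.
apply: (addIr (\sum_(e | endpoint e true == x) delta e)).
rewrite -/(D1 x) -divm divergenceE half_edges_sum /=.
rewrite (big_mkcond (fun e => endpoint e true == x)) -big_split /=.
by apply: eq_bigr => e _; case: (_ == x); case: (_ == x); lia.
Qed.

(* Orienting the tree towards the root makes every vertex but [r] the tail of
   one edge, so that the canonical divisor is the sum of [parent z - z] over
   [z != r], plus the ends of [e0], minus [2 r]. *)
Lemma cycle_canonical0 : \sum_x ((valence x)%:Z - 2)%:~R * theta x = 0.
Proof.
have sum_edges (F : E -> R) : \sum_e F e = F e0 + \sum_(z | z != r) F (up z).1.
  rewrite (bigD1 e0) //=; congr (_ + _).
  rewrite (reindex_onto (fun z => (up z).1)
    (fun e => odflt r [pick z | (z != r) && ((up z).1 == e)])) /=; last first.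
    move=> e /up_onto[z zr ze]; case: pickP => [z' /andP[_ /eqP] //|/(_ z)].
    by rewrite zr ze eqxx.
  apply: eq_bigl => z; case: pickP => [z' /andP[zr' /eqP E]|none] /=.
    have [->|zr] := eqVneq z r; first by rewrite (negbTE zr') andbF.
    by rewrite (up_edge_inj tree zr' zr E) up_e0 ?eqxx.
  move: none; have [->|zr] := eqVneq z r; last by move=> /(_ z); rewrite zr eqxx.
  case: (eqVneq (up r).1 e0) => //= /up_onto[z' zr' E] /(_ z').
  by rewrite zr' E eqxx.
have val_sum : \sum_x (valence x)%:Z%:~R * theta x =
    \sum_e (theta (endpoint e false) + theta (endpoint e true)).
  rewrite -(sum_half_edges (fun d => theta (hend d))); apply: eq_bigr => x _.
  rewrite valenceE rmorph_sum /= mulr_suml /half_edges !big_filter.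
  by apply: eq_bigr => d /eqP dx; rewrite mul1r /hend dx.
have -> : \sum_x ((valence x)%:Z - 2)%:~R * theta x =
    \sum_e (theta (endpoint e false) + theta (endpoint e true)) - 2 * \sum_x theta x.
  rewrite -val_sum mulr_sumr -sumrB; apply: eq_bigr => x _.
  by rewrite rmorphB /= mulrBl.
rewrite sum_edges [\sum_x theta x](bigD1 r) //= cycle_position_root add0r.
have ends z : theta (endpoint (up z).1 false) + theta (endpoint (up z).1 true) =
    theta (hend (up z)) + theta (parent z).
  by rewrite /parent /hend /hrev /=; case: (up z) => e [] //=; rewrite addrC.
rewrite -addrA mulr_sumr -sumrB -/x1 -/y1.
have -> : theta x1 + theta y1 =
    \sum_(z | z != r) (B y1 z - B x1 z)%:~R * (B y1 z + B x1 z)%:~R * len (up z).1.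
  rewrite -big_split /= sum_edges !path_e0 !mulr0 mul0r addr0 add0r.
  apply: eq_bigr => z zr; rewrite -mulrDl -rmorphD /= -mulrDr -rmorphM /=.
  congr (_%:~R * _); rewrite -cycle_up // /B -mulrDl mulrACA hsignK mulr1.
  by rewrite addrC.
rewrite -big_split big1 // => z zr /=; rewrite ends (hend_up tree zr).
have : theta z - theta (parent z) = (B y1 z - B x1 z)%:~R * len (up z).1.
  rewrite -cycle_up //; have := cycle_positionB (up z).1.
  rewrite (negbTE (up_e0 zr)) subr0; have := hend_up tree zr.
  rewrite /parent /hend /hrev /hsign; case: (up z) => e [] /= -> E; last by rewrite E mulr1.
  by rewrite mulrN1 rmorphN mulNr -E opprB.
(* Writing p and q for [B y1 z] and [B x1 z], the term is (p^2 - q^2) - (p - q) times the length,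
   which vanishes for p and q in {0, 1}. *)
case: (path01 y1 zr) => [->|[-> _]]; case: (path01 x1 zr) => [->|[-> _]];
  rewrite ?subr0 ?subrr ?sub0r ?rmorphN /=; lra.
Qed.

(** Modulo L the position may be taken in the period starting at [theta x1]. The edge [e0] covers
    the part from [theta y1] to [theta x1 + L]; the tree paths from [x1] and [y1] to the root, whose
    position is 0, cover the rest. *)
Lemma cycle_flow_onto (s : R) : exists j : int,
  (exists x, s = j%:~R * L + theta x) \/
  (exists e u, 0 <= u <= len e /\
     s = j%:~R * L + theta (endpoint e true) + (c e)%:~R * u).
Proof.
pose between (a b t : R) := (a <= t <= b) \/ (b <= t <= a).
pose hit (t : R) := (exists x, t = theta x) \/
  (exists e u, 0 <= u <= len e /\ t = theta (endpoint e true) + (c e)%:~R * u).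
have edge_hit e t : e != e0 ->
    between (theta (endpoint e false)) (theta (endpoint e true)) t -> hit t.
  move=> ee0; have := cycle_positionB e; rewrite (negbTE ee0) subr0 => dE bt.
  right; case: (cycle_flow_unit e) dE => ce; rewrite ce => dE.
  - exists e, 0; rewrite lexx ltW // ce; split=> //.
    by case: bt => /andP[]; lra.
  - exists e, (t - theta (endpoint e true)); rewrite ce; split; last lra.
    by have := len_gt0 e; case: bt => /andP[]; lra.
  - exists e, (theta (endpoint e true) - t); rewrite ce; split; last lra.
    by have := len_gt0 e; case: bt => /andP[]; lra.
(* An intermediate value argument along the tree: a value between 0 and [theta x] that is not
   between 0 and [theta (parent x)] is attained on the edge joining the two. *)
have path_hit x t : between 0 (theta x) t -> hit t.
  elim/(tree_ind tree): x t => [t|x xr IH t bt].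
    rewrite cycle_position_root => bt; left; exists r.
    by rewrite cycle_position_root; case: bt => /andP[]; lra.
  have [/IH//|nbt] := pselect (between 0 (theta (parent x)) t).
  apply: (edge_hit (up x).1); first exact: up_e0.
  have : between (theta (hend (up x))) (theta (parent x)) t.
    rewrite (hend_up tree xr); case: bt => /andP[t1 t2].
      have [tp|tp] := leP t (theta (parent x)).
        by case: nbt; left; rewrite t1.
      by right; rewrite t2 ltW.
    have [tp|tp] := leP (theta (parent x)) t.
      by case: nbt; right; rewrite tp.
    by left; rewrite t1 ltW.
  rewrite /parent /hend /hrev /=; case: (up x) => e [] //=.
  by rewrite /between; tauto.
have L0 := cycle_length_pos.
pose j := Num.floor ((s - theta x1) / L); exists j; pose t := s - j%:~R * L.
have tb : theta x1 <= t < theta x1 + L.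
  have /andP[] := real_floor_itv (num_real ((s - theta x1) / L)).
  rewrite -/j ler_pdivlMr // ltr_pdivrMr // rmorphD /= mulrDl mul1r /t.
  lra.
have dE := cycle_positionB e0; rewrite eqxx -/x1 -/y1 cycle_e0 mul1r in dE.
have : hit t.
  have [ty|ty] := leP (theta y1) t.
    right; exists e0, (t - theta y1); rewrite cycle_e0 -/y1; split; last lra.
    by have := len_gt0 e0; lra.
  have [t0|t0] := leP t 0.
    by apply: (path_hit x1); right; lra.
  by apply: (path_hit y1); left; lra.
case=> [[x tx]|[e [u [hu tx]]]]; [left; exists x|right; exists e, u; split=> //].
  by rewrite -tx /t; lra.
by rewrite -addrA -tx /t; lra.
Qed.

End Construction.

Lemma cycle_coordinates_exist : betti1 G = 1%N ->
  exists theta c L, cycle_coordinates theta c L.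
Proof.
move=> b1; have /card_gt0P[e _] : (0 < #|E|)%N.
  have := betti1E G; have : (0 < #|V|)%N by apply/card_gt0P; exists (vmark G).
  by rewrite b1; lia.
pose r := vmark G; have [depth [up tree]] := spanning_tree r e.
have [e0 [up_e0 up_onto]] := extra_edge tree b1.
have [A [A_root A_up]] := tree_rec tree (fun=> 0)
  (fun x (f : E -> int) e => (if e == (up x).1 then hsign (up x) else 0) + f e).
have Ar e' : A r e' = 0 by rewrite A_root.
have Au x e' : x != r -> A x e' = (if e' == (up x).1 then hsign (up x) else 0) + A (parent up x) e'.
  by move=> /A_up->.
exists (cycle_position e0 A), (cycle_flow e0 A), (cycle_length e0 A); split.
- exact: (cycle_length_pos tree up_e0 Ar Au).
- exact: (cycle_flow_unit tree up_e0 up_onto Ar Au).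
- move=> e'; have := cycle_positionB tree up_onto Au e' => dE.
  by exists (if e' == e0 then -1 else 0); move: dE; case: ifP => _; lra.
- move=> len1; split=> [|x]; apply: rpred_sum => e' _;
  by rewrite len1 mulr1 intr_int.
- move=> D0; exact: (cycle_flow_principal tree up_onto Ar Au).
- exact: (cycle_canonical0 tree up_e0 up_onto Ar Au).
- exact: (cycle_flow_onto tree up_e0 up_onto Ar Au).
Qed.

End CycleCoordinates.

(** * Pushforward of divisors *)

Section FreeAbelianGroups.
Implicit Types (K : choiceType).

Lemma freeg_additive_eq K (A : zmodType) (f g : {additive {freeg K} -> A}) :
  (forall x, f << x >> = g << x >>) -> f =1 g.
Proof.
move=> fg D; rewrite -[D]freeg_sumE !raddf_sum /=; apply: eq_bigr => x _.
by rewrite -[coeff x D]intz -freegU_mulz !raddfMz /= fg.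
Qed.

HB.instance Definition _ K K' (f : K -> {freeg K'}) :=
  GRing.isZmodMorphism.Build {freeg K} {freeg K'} (fglift f) (lift_is_additive f).

Lemma lift_effective K K' (f : K -> {freeg K'}) (D : {freeg K}) :
  (forall x p, 0 <= coeff p (f x)) -> (forall x, 0 <= coeff x D) ->
  forall p, 0 <= coeff p (fglift f D).
Proof.
move=> f0 D0 p; rewrite -[D]freeg_sumE !raddf_sum /=; apply: sumr_ge0 => x _.
by rewrite liftU coeffZ mulr_ge0.
Qed.

Definition push K K' (j : K -> K') (D : {freeg K}) : {freeg K'} :=
  fglift (fun x => << j x >>) D.

HB.instance Definition _ K K' (j : K -> K') :=
  GRing.isZmodMorphism.Build {freeg K} {freeg K'} (push j) (lift_is_additive _).

Lemma pushU K K' (j : K -> K') k x : push j << k *g x >> = << k *g j x >>.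
Proof.
rewrite /push liftU; apply/eqP/freeg_eqP => p.
by rewrite coeffZ !coeffU mul1r.
Qed.

Lemma deg_push K K' (j : K -> K') D : deg (push j D) = deg D.
Proof.
pose f : {additive {freeg K} -> int} := @deg K' \o push j.
apply: (freeg_additive_eq (f := f) (g := @deg K)) => x; rewrite /f /=.
by rewrite pushU !degU.
Qed.

Lemma deg_finType (K : finType) (D : {freeg K}) : deg D = \sum_x coeff x D.
Proof.
rewrite -{1}[D]freeg_sumE raddf_sum /=; under eq_bigr do rewrite degU.
rewrite big_uniq ?uniq_dom //= big_mkcond; apply: eq_bigr => x _.
by rewrite mem_dom; case: eqP.
Qed.

Lemma push_comp K K' K'' (i : K' -> K'') (j : K -> K') D :
  push i (push j D) = push (i \o j) D.
Proof.
pose f : {additive {freeg K} -> {freeg K''}} := push i \o push j.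
apply: (freeg_additive_eq (f := f) (g := push (i \o j))) => x.
by rewrite /f /= !pushU.
Qed.

Lemma coeff_push K K' (j : K -> K') x D : injective j ->
  coeff (j x) (push j D) = coeff x D.
Proof.
move=> ij; pose f : {additive {freeg K} -> int} := coeff (j x) \o push j.
apply: (freeg_additive_eq (f := f) (g := coeff x)) => y; rewrite /f /=.
by rewrite pushU !coeffU (inj_eq ij).
Qed.

Lemma coeff_push_out K K' (j : K -> K') z D : (forall x, j x != z) ->
  coeff z (push j D) = 0.
Proof.
move=> jz; pose f : {additive {freeg K} -> int} := coeff z \o push j.
apply: (freeg_additive_eq (f := f) (g := \0)) => y; rewrite /f /=.
by rewrite pushU !coeffU (negbTE (jz y)) mulr0.
Qed.

End FreeAbelianGroups.

Section MultigraphCanonical.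

Definition vertex_canonical (G : marked_multigraph) : {freeg (vertex G)} :=
  \sum_(x : vertex G) << ((valence x)%:Z - 2) *g x >>.

Lemma coeff_vertex_canonical (G : marked_multigraph) (x : vertex G) :
  coeff x (vertex_canonical G) = (valence x)%:Z - 2.
Proof.
rewrite raddf_sum (bigD1 x) //= coeffU eqxx mulr1 big1 ?addr0 // => y /negbTE yx.
by rewrite coeffU yx mulr0.
Qed.

Lemma deg_vertex_canonical (G : marked_multigraph) :
  deg (vertex_canonical G) = (betti1 G)%:Z * 2 - 2.
Proof.
rewrite deg_finType; under eq_bigr do rewrite coeff_vertex_canonical valenceE.
rewrite sumrB (sum_half_edges (fun=> 1 : int)) !sumr_const.
have := betti1E G; rewrite -[_ *+ #|edge G|]mulr_natr -[_ *+ #|vertex G|]mulr_natr !natz; lia.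
Qed.

Lemma glue_vertex_canonical (G1 G2 : marked_multigraph) :
  vertex_canonical (glue_multigraph G1 G2) =
  push (@glue_inl G1 G2) (vertex_canonical G1) +
  push (@glue_inr G1 G2) (vertex_canonical G2) +
  << glue_inl G2 (wmark G1) : vertex (glue_multigraph G1 G2) >> *+ 2.
Proof.
have inl_inj := @glue_inl_inj G1 G2; have inr_inj := @glue_inr_inj G1 G2.
apply/eqP/freeg_eqP; apply: glue_vertexP => [x|y yv];
  rewrite coeff_vertex_canonical !coeffD raddfMn /= coeffU mul1r coeff_push //.
  rewrite coeff_vertex_canonical glue_valence_inl glue_inl_eq.
  have [->|xw] := eqVneq x (wmark G1).
    by rewrite -glue_inr_mark coeff_push // coeff_vertex_canonical; lia.
  rewrite coeff_push_out; first by lia.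
  by move=> y; apply/eqP => /esym/glue_inlr[xE]; rewrite xE eqxx in xw.
rewrite coeff_vertex_canonical glue_valence_inr // coeff_push_out; last first.
  by move=> x; apply/eqP => /glue_inlr[_ /eqP]; rewrite (negbTE yv).
rewrite [_ == _]eq_sym glue_inrl_eq (negbTE yv) /=; lia.
Qed.

End MultigraphCanonical.

(** * Finite and metric graphs *)

Section FunctionTheories.

(** [rat] and [dv] stand for the admissible functions and their divisors: all integer functions and
    the Laplacian on a finite graph, rational functions and their slopes on a metric graph. *)
Record function_theory (T : divisor_theory) (W : zmodType)
    (rat : (point T -> W) -> Prop) (dv : (point T -> W) -> point T -> int) : Prop :=
    FunctionTheory {
  ft_lin : forall D D' : {freeg (point T)}, lin_equiv D D' <->
    exists2 f, rat f & forall p, coeff p (D - D') = dv f p;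
  ft_cst : forall a, rat (fun=> a) /\ forall p, dv (fun=> a) p = 0;
  ft_sub : forall f g, rat f -> rat g ->
    rat (fun p => f p - g p) /\ forall p, dv (fun p => f p - g p) p = dv f p - dv g p;
  ft_deg : forall (D : {freeg (point T)}) f, rat f ->
    (forall p, coeff p D = dv f p) -> deg D = 0
}.

Lemma function_theory_good (T : divisor_theory) (W : zmodType) rat dv :
  @function_theory T W rat dv -> good_theory T.
Proof.
move=> ft; have lin := ft_lin ft; split=> [D D'||D D'|D].
- rewrite !lin; split=> -[f rf fD]; exists f => // p; rewrite -fD ?subr0 //.
- apply/lin; have [r0 d0] := ft_cst ft 0; exists (fun=> 0) => // p.
  by rewrite subrr coeff0 d0.
- move=> /lin[f rf fD] /lin[g rg gD]; have [rs ds] := ft_sub ft rf rg.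
  apply/lin; exists (fun p => f p - g p) => // p.
  by rewrite ds -fD -gD !subr0 coeffB.
- by move=> /lin[f rf fD]; apply: (ft_deg ft rf) => p; rewrite -fD subr0.
Qed.

Variables (W : zmodType) (T1 T2 T : divisor_theory).
Variables (rat1 : (point T1 -> W) -> Prop) (dv1 : (point T1 -> W) -> point T1 -> int).
Variables (rat2 : (point T2 -> W) -> Prop) (dv2 : (point T2 -> W) -> point T2 -> int).
Variables (rat : (point T -> W) -> Prop) (dv : (point T -> W) -> point T -> int).
Hypotheses (ft1 : function_theory rat1 dv1) (ft2 : function_theory rat2 dv2)
           (ft : function_theory rat dv).
Variables (j1 : point T1 -> point T) (j2 : point T2 -> point T).
Hypotheses (j1_inj : injective j1) (j2_inj : injective j2).
Hypothesis j12 : forall x y, j1 x = j2 y <-> x = wpt T1 /\ y = vpt T2.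
Hypothesis j_onto : forall z, (exists x, z = j1 x) \/ (exists y, z = j2 y).
Hypotheses (j1v : j1 (vpt T1) = vpt T) (j2w : j2 (wpt T2) = wpt T).
Hypothesis rat_restrict : forall f, rat f -> rat1 (f \o j1) /\ rat2 (f \o j2).
Hypothesis rat_glue : forall f, rat1 (f \o j1) -> rat2 (f \o j2) -> rat f.
Hypothesis dv_j1 : forall f x, x <> wpt T1 -> dv f (j1 x) = dv1 (f \o j1) x.
Hypothesis dv_j2 : forall f y, y <> vpt T2 -> dv f (j2 y) = dv2 (f \o j2) y.
Hypothesis dv_j12 : forall f,
  dv f (j1 (wpt T1)) = dv1 (f \o j1) (wpt T1) + dv2 (f \o j2) (vpt T2).
Hypothesis canonicalE : canonical T =
  push j1 (canonical T1) + push j2 (canonical T2) + << j1 (wpt T1) >> *+ 2.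
Hypothesis genusE : genus T = (genus T1 + genus T2)%N.

Let j12q : j1 (wpt T1) = j2 (vpt T2).
Proof. exact/j12. Qed.

Lemma coeff_glue1 D1 D2 x : x <> wpt T1 ->
  coeff (j1 x) (push j1 D1 + push j2 D2) = coeff x D1.
Proof.
move=> xw; rewrite coeffD coeff_push // coeff_push_out ?addr0 // => y.
by apply/eqP => /esym/j12[].
Qed.

Lemma coeff_glue2 D1 D2 y : y <> vpt T2 ->
  coeff (j2 y) (push j1 D1 + push j2 D2) = coeff y D2.
Proof.
move=> yv; rewrite coeffD coeff_push // coeff_push_out ?add0r // => x.
by apply/eqP => /j12[].
Qed.

Lemma coeff_glue12 D1 D2 : coeff (j1 (wpt T1)) (push j1 D1 + push j2 D2) =
  coeff (wpt T1) D1 + coeff (vpt T2) D2.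
Proof. by rewrite coeffD coeff_push // j12q coeff_push. Qed.

Lemma coeff_mulz (K : choiceType) (D : {freeg K}) p m :
  coeff p (D *~ m) = coeff p D * m.
Proof. by rewrite raddfMz /= -mulrzr intz. Qed.

(** A function on the wedge restricts to both parts, and its divisor at the glued point is the sum
    of the two local ones; [m] is the discrepancy there on the first part. Conversely, a constant
    subtracted from the second function makes the two agree at the glued point without changing
    divisors. *)
Lemma glued_lin_equiv D1 D2 : lin_equiv (push j1 D1 + push j2 D2) 0 <->
  exists m : int, lin_equiv (D1 + << wpt T1 >> *~ m) 0 /\
                  lin_equiv (D2 - << vpt T2 >> *~ m) 0.
Proof.
split=> [/(ft_lin ft)[f rf fD]|[m []]].
  have [r1 r2] := rat_restrict rf.
  have {}fD p : coeff p (push j1 D1 + push j2 D2) = dv f p by rewrite -fD subr0.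
  exists (dv1 (f \o j1) (wpt T1) - coeff (wpt T1) D1); split.
    apply/(ft_lin ft1); exists (f \o j1) => // x.
    rewrite subr0 coeffD coeff_mulz coeffU mul1r.
    case: eqP => [<-|wx]; first by rewrite mul1r addrC subrK.
    by rewrite mul0r addr0 -dv_j1 -?fD ?coeff_glue1 // => xw; apply: wx.
  apply/(ft_lin ft2); exists (f \o j2) => // y.
  rewrite subr0 coeffB coeff_mulz coeffU mul1r.
  case: eqP => [<-|vy].
    have := fD (j1 (wpt T1)); rewrite dv_j12 coeff_glue12; lia.
  by rewrite mul0r subr0 -dv_j2 -?fD ?coeff_glue2 // => yv; apply: vy.
move=> /(ft_lin ft1)[f1 r1 f1D] /(ft_lin ft2)[f2 r2 f2D].
pose a := f2 (vpt T2) - f1 (wpt T1).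
have [ra da] := ft_cst ft2 a; have [r2' d2'] := ft_sub ft2 r2 ra.
pose f2' y := f2 y - a.
have ex z : exists u, (forall x, z = j1 x -> u = f1 x) /\ (forall y, z = j2 y -> u = f2' y).
  have f12 : f1 (wpt T1) = f2' (vpt T2) by rewrite /f2' /a opprB addrC subrK.
  have [[x ->]|[y ->]] := j_onto z.
    exists (f1 x); split=> [x' /j1_inj->//|y /j12[-> ->]]; exact: f12.
  by exists (f2' y); split=> [x /esym/j12[-> ->]|y' /j2_inj->] //; rewrite f12.
have [f hf] := choice ex.
have fj1 : f \o j1 = f1 by apply/funext => x; apply: (hf (j1 x)).1.
have fj2 : f \o j2 = f2' by apply/funext => y; apply: (hf (j2 y)).2.
apply/(ft_lin ft); exists f; first by apply: rat_glue; rewrite ?fj1 ?fj2.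
have e1 x : coeff x D1 + (wpt T1 == x)%:Z * m = dv1 f1 x.
  by rewrite -f1D subr0 coeffD coeff_mulz coeffU mul1r natz.
have e2 y : coeff y D2 - (vpt T2 == y)%:Z * m = dv2 f2' y.
  by rewrite d2' da -f2D !subr0 coeffB coeff_mulz coeffU mul1r natz.
have at1 x : coeff (j1 x) (push j1 D1 + push j2 D2) = dv f (j1 x).
  have [->|xw] := pselect (x = wpt T1).
    rewrite coeff_glue12 dv_j12 fj1 fj2 -e1 -e2 !eqxx; lia.
  rewrite coeff_glue1 // dv_j1 // fj1 -e1; case: eqP => [wx|]; last by lia.
  by case: xw.
move=> z; rewrite subr0; have [[x ->//]|[y ->]] := j_onto z.
have [->|yv] := pselect (y = vpt T2); first by rewrite -j12q.
rewrite coeff_glue2 // dv_j2 // fj2 -e2; case: eqP => [vy|]; last by lia.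
by case: yv.
Qed.

Lemma function_gluing : gluing (push j1) (push j2).
Proof.
have ex z : exists s : point T1 + point T2,
    match s with inl x => z = j1 x | inr y => z = j2 y end.
  by have [[x ->]|[y ->]] := j_onto z; [exists (inl x)|exists (inr y)].
have [s hs] := choice ex.
(* Each point, the glued one included, is assigned to one side; extended linearly, this splits
   divisors and keeps effective ones effective. *)
pose rho1 z : {freeg (point T1)} := if s z is inl x then << x >> else 0.
pose rho2 z : {freeg (point T2)} := if s z is inr y then << y >> else 0.
have dec D : D = push j1 (fglift rho1 D) + push j2 (fglift rho2 D).
  pose f : {additive {freeg (point T)} -> {freeg (point T)}} := idfun.
  pose g : {additive {freeg (point T)} -> {freeg (point T)}} :=
    (push j1 \o fglift rho1) \+ (push j2 \o fglift rho2).
  apply: (freeg_additive_eq (f := f) (g := g)) => z; rewrite /f /g /= !liftU !scale1r.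
  rewrite /rho1 /rho2; have := hs z; case: (s z) => [x|y] ->.
    by rewrite pushU raddf0 addr0.
  by rewrite pushU raddf0 add0r.
have rho1_ge0 z p : 0 <= coeff p (rho1 z).
  by rewrite /rho1; case: (s z) => [x|y]; rewrite ?coeff0 // coeffU mul1r.
have rho2_ge0 z p : 0 <= coeff p (rho2 z).
  by rewrite /rho2; case: (s z) => [x|y]; rewrite ?coeff0 // coeffU mul1r.
split.
- by move=> D; rewrite deg_push.
- by move=> D; rewrite deg_push.
- by move=> D eD; apply: lift_effective => // x p; rewrite coeffU mul1r.
- by move=> D eD; apply: lift_effective => // x p; rewrite coeffU mul1r.
- by move=> D; exists (fglift rho1 D), (fglift rho2 D).
- move=> E eE; exists (fglift rho1 E), (fglift rho2 E); split=> //.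
    exact: lift_effective.
  exact: lift_effective.
- by rewrite /= pushU j1v.
- by rewrite /= pushU j2w.
- by rewrite /= !pushU j12q.
- exact: glued_lin_equiv.
- by rewrite canonicalE /= pushU.
- exact: genusE.
Qed.

End FunctionTheories.

(** * Finite graphs *)

Section FiniteGraphs.
Implicit Types (G : finite_graph).

Lemma half_edges_hend (G : marked_multigraph) (A : nmodType) x
    (phi : vertex G -> edge G * bool -> A) :
  \sum_(d <- half_edges x) phi x d = \sum_(d <- half_edges x) phi (hend d) d.
Proof. by rewrite !big_filter; apply: eq_bigr => d /eqP <-. Qed.

Lemma finite_function_theory G : @function_theory (finite_theory G) int
  (fun=> True) (@finite_divisor G).
Proof.
split.
- by move=> D D'; split=> [[f fD]|[f _ fD]]; exists f.
- by move=> a; split=> // x; rewrite /finite_divisor; under eq_bigr do rewrite subrr; rewrite big1_eq.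
- move=> f g _ _; split=> // x; rewrite /finite_divisor -sumrB.
  by apply: eq_bigr => d _; lia.
- move=> D f _ fD; rewrite deg_finType; under eq_bigr do rewrite fD.
  under eq_bigr do rewrite /finite_divisor (half_edges_hend _ (fun x d => f (endpoint d.1 (~~ d.2)) - f x)).
  rewrite sum_half_edges big1 // => e _ /=.
  by rewrite /hend /=; lia.
Qed.


Section FiniteGlue.
Variables G1 G2 : finite_graph.
Local Notation inl1 := (@glue_inl G1 G2).
Local Notation inr2 := (@glue_inr G1 G2).

Lemma finite_divisor_inl (f : vertex (finite_glue G1 G2) -> int) x :
  finite_divisor f (inl1 x) = finite_divisor (f \o inl1) x +
    (if x == wmark G1 then finite_divisor (f \o inr2) (vmark G2) else 0).
Proof.
rewrite /finite_divisor glue_half_edges_inl /=; congr (_ + _).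
by case: eqP => // ->; rewrite glue_inr_mark.
Qed.

Lemma finite_divisor_inr (f : vertex (finite_glue G1 G2) -> int) y :
  y != vmark G2 -> finite_divisor f (inr2 y) = finite_divisor (f \o inr2) y.
Proof. by move=> yv; rewrite /finite_divisor glue_half_edges_inr. Qed.

Lemma finite_glue_general (k : nat) : k <> 1%N ->
  k_general_transmission k (finite_theory G1) ->
  k_general_transmission k (finite_theory G2) ->
  k_general_transmission k (finite_theory (finite_glue G1 G2)).
Proof.
move=> k1; have ft1 := finite_function_theory G1.
have ft2 := finite_function_theory G2.
have ft := finite_function_theory (finite_glue G1 G2).
apply: (glue_k_general_transmission (function_theory_good ft1)
  (function_theory_good ft2) (function_theory_good ft) _ k1).
apply: (function_gluing ft1 ft2 ft).
- exact: glue_inl_inj.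
- exact: glue_inr_inj.
- exact: glue_inlr.
- by apply: glue_vertexP => [x|y _]; [left; exists x|right; exists y].
- by [].
- by [].
- by [].
- by [].
- by move=> f x xw; rewrite finite_divisor_inl; case: eqP => // _; rewrite addr0.
- by move=> f y yv; rewrite finite_divisor_inr //; apply/eqP.
- by move=> f; rewrite finite_divisor_inl eqxx.
- exact: glue_vertex_canonical.
- exact: glue_betti1.
Qed.

End FiniteGlue.

End FiniteGraphs.

Section FiniteGenusOne.
Variable G : finite_graph.
Hypothesis b1 : betti1 G = 1%N.
Variables (theta : vertex G -> rat) (c : edge G -> int) (L : rat).
Hypothesis cc : cycle_coordinates (fun=> 1) theta c L.

(** With unit lengths and no interior degree the potential has integer differences along edges.
    Normalised to vanish at one vertex, it is integral everywhere by connectedness. *)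
Lemma finite_principal (D : {freeg (vertex G)}) (j : int) :
  deg D = 0 -> \sum_x (coeff x D)%:~R * theta x = j%:~R * L ->
  finite_lin_equiv D 0.
Proof.
rewrite deg_finType => dD AJ.
have [||h [m [hm Dm]]] := cycle_principal cc (D0 := fun x => coeff x D) (delta := fun=> 0)
    (M := fun=> 0) (j := j).
- by rewrite (big1 _ _ (fun=> 0)) ?addr0.
- by rewrite [X in _ + X]big1 ?addr0 // => e _; rewrite mul0r mulr0 addr0.
pose g x := h x - h (vmark G).
have gB e : g (endpoint e true) - g (endpoint e false) = (m e)%:~R.
  by rewrite /g; have := hm e; rewrite mulr1 addr0; lra.
have g_int x : g x \is a Num.int.
  rewrite (connected_constant (f := fun x => g x \is a Num.int) _ x (vmark G)).
    by rewrite /g subrr.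
  move=> e; have := gB e => /eqP; rewrite subr_eq => /eqP->.
  by rewrite [RHS]rpredDl ?intr_int.
pose f x := Num.floor (g x).
have fg x : (f x)%:~R = g x by rewrite /f floorK.
have fB e : f (endpoint e true) - f (endpoint e false) = m e.
  by apply: (@intr_inj rat); rewrite rmorphB /= !fg gB.
exists f => x; rewrite subr0 Dm /finite_divisor !big_filter.
apply: eq_bigr => -[e b] /eqP <- /=; have := fB e; case: b => /=; lia.
Qed.

(** All positions are integers here, so a point found by [cycle_onto] on an edge of nonzero flow is
    at distance 0 or 1 from an end, hence at a vertex. *)
Lemma finite_effective_deg1 (D : {freeg (point (finite_theory G))}) :
  deg D = 1 -> equiv_effective D.
Proof.
move=> dD; have [Lint thint] := cycle_integral cc (fun=> erefl).
pose s := \sum_x (coeff x D)%:~R * theta x.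
have s_int : s \is a Num.int by apply: rpred_sum => x _; rewrite rpredM ?intr_int.
suff [x [j sx]] : exists x, exists j : int, s = j%:~R * L + theta x.
  exists << x >>; first by move=> y; rewrite coeffU mul1r.
  apply: ((lin_equivB (function_theory_good (finite_function_theory G)) _ _).2).
  apply: (finite_principal (j := j)); first by rewrite degB dD degU subrr.
  under eq_bigr do rewrite coeffB coeffU mul1r rmorphB /= mulrBl.
  rewrite sumrB -/s [X in _ - X](bigD1 x) //= eqxx mul1r big1 => [|y /negbTE yx].
    by rewrite addr0 sx addrK.
  by rewrite eq_sym yx mul0r.
have [j [[x ->]|[e [u [hu sE]]]]] := cycle_onto cc s; first by exists x, j.
have [i dE] := cycle_edge cc e.
case: (cycle_unit cc e) => ce; rewrite ce ?mul0r ?mul1r ?mulN1r in sE dE.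
- by exists (endpoint e true), j; rewrite sE addr0.
- have /intrP[n un] : u \is a Num.int.
    have -> : u = s - (j%:~R * L + theta (endpoint e true)) by rewrite sE; lra.
    by rewrite rpredB // rpredD // rpredM // intr_int.
  have : 0 <= n <= 1 by rewrite -(ler0z rat) -(ler_int rat n 1) -un.
  have [n0 _|n0 n1] := eqVneq n 0; first by exists (endpoint e true), j; rewrite sE un n0 addr0.
  exists (endpoint e false), (j - i); rewrite sE un dE rmorphB /=.
  have -> : n = 1 by lia.
  by rewrite mulr1z; lra.
- have /intrP[n un] : u \is a Num.int.
    have -> : u = - (s - (j%:~R * L + theta (endpoint e true))) by rewrite sE; lra.
    by rewrite rpredN rpredB // rpredD // rpredM // intr_int.
  have : 0 <= n <= 1 by rewrite -(ler0z rat) -(ler_int rat n 1) -un.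
  have [n0 _|n0 n1] := eqVneq n 0; first by exists (endpoint e true), j; rewrite sE un n0 oppr0 addr0.
  exists (endpoint e false), (j - i); rewrite sE un dE rmorphB /=.
  have -> : n = 1 by lia.
  by rewrite mulr1z; lra.
Qed.

Lemma finite_canonical_trivial : lin_equiv (canonical (finite_theory G)) 0.
Proof.
apply: (finite_principal (j := 0)).
  by rewrite [LHS]deg_vertex_canonical b1.
under eq_bigr do rewrite coeff_vertex_canonical.
by rewrite (cycle_canonical cc) mul0r.
Qed.

End FiniteGenusOne.

Lemma finite_genus1 (G : finite_graph) (k : nat) : k <> 1%N ->
  betti1 G = 1%N ->
  ~ lin_equiv << vpt (finite_theory G) >> << wpt (finite_theory G) >> ->
  k_general_transmission k (finite_theory G) <-> torsion_order (finite_theory G) k.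
Proof.
move=> k1 b1 vw.
have [theta [c [L cc]]] := @cycle_coordinates_exist G rat (fun=> 1) (fun=> ltr01) b1.
apply: genus1_k_general_transmission => //.
- exact: function_theory_good (finite_function_theory G).
- exact: finite_effective_deg1 cc.
- exact: finite_canonical_trivial b1 _ _ _ cc.
Qed.

(** * Piecewise linear functions with integer slopes on a segment *)

Section PiecewiseLinear.
Variable R : realType.
Implicit Types (f g : R -> R) (a b c t : R) (m n : int).

Definition slope_at g t m : Prop :=
  exists2 h, 0 < h & forall u, 0 <= u <= h -> g (t + u) = g t + m%:~R * u.

Lemma slope_at_inj g t m n : slope_at g t m -> slope_at g t n -> m = n.
Proof.
case=> h h0 gm [k k0 gn]; pose u := Num.min h k.
have u0 : 0 < u by rewrite lt_min h0.
have uhk : (u <= h) && (u <= k) by rewrite !ge_min !lexx orbT.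
have := gm u; have := gn u; case/andP: uhk => -> ->; rewrite ltW // => -> // /(_ isT).
by move=> /addrI/(mulIf (lt0r_neq0 u0))/intr_inj.
Qed.

Lemma right_slopeE g t m : slope_at g t m -> right_slope g t = m.
Proof.
move=> gm; rewrite /right_slope; case: xgetP => [n _ gn|/(_ m)[]//].
exact: slope_at_inj gn gm.
Qed.

Lemma slope_atD f g t m n : slope_at f t m -> slope_at g t n ->
  slope_at (fun s => f s + g s) t (m + n).
Proof.
case=> h h0 fm [k k0 gn]; exists (Num.min h k); first by rewrite lt_min h0.
move=> u; rewrite le_min => /and3P[u0 uh uk].
by rewrite fm ?u0 // gn ?u0 // rmorphD /=; ring.
Qed.

Lemma slope_atN g t m : slope_at g t m -> slope_at (fun s => - g s) t (- m).
Proof.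
by case=> h h0 gm; exists h => // u /gm ->; rewrite rmorphN /=; ring.
Qed.

Lemma slope_at_cst a t : slope_at (fun=> a) t 0.
Proof. by exists 1 => // u _; rewrite mul0r addr0. Qed.

Lemma slope_at_sum (I : Type) (r : seq I) (f : I -> R -> R) (m : I -> int) t :
  (forall i, slope_at (f i) t (m i)) ->
  slope_at (fun s => \sum_(i <- r) f i s) t (\sum_(i <- r) m i).
Proof.
move=> fm; elim: r => [|i r IH].
  rewrite big_nil; have -> : (fun s => \sum_(i <- [::]) f i s) = (fun=> 0).
    by apply/funext => s; rewrite big_nil.
  exact: slope_at_cst.
rewrite big_cons; have -> : (fun s => \sum_(j <- i :: r) f j s) =
    (fun s => f i s + \sum_(j <- r) f j s).
  by apply/funext => s; rewrite big_cons.
exact: slope_atD.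
Qed.

Lemma eq_slope_at f g t m h : 0 < h ->
  (forall u, 0 <= u <= h -> f (t + u) = g (t + u)) ->
  slope_at f t m -> slope_at g t m.
Proof.
move=> h0 fg [k k0 fm]; exists (Num.min h k); first by rewrite lt_min h0.
move=> u; rewrite le_min => /and3P[u0 uh uk].
have := fg 0; rewrite addr0 => <-; last by rewrite lexx ltW.
by rewrite -fg ?u0 // fm // u0.
Qed.

(* The slope away from [t] to the left, which is minus the left derivative. *)
Definition left_slope_at g t m := slope_at (fun u => g (- u)) (- t) m.

Lemma left_slope_atE g t m c :
  left_slope_at g t m <-> slope_at (fun u => g (c - u)) (c - t) m.
Proof.
split=> -[h h0 gm]; exists h => // u /gm.
  by rewrite opprK opprD !opprK subKr opprD opprB addrA subrKC.
by rewrite subKr opprD opprB addrA subrKC opprK opprD !opprK.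
Qed.

Lemma pl_on_lt g a b : pl_on g a b -> a < b.
Proof. by elim=> // {}a {}b c _ ab _ bc; apply: lt_trans bc. Qed.

Lemma eq_pl_on f g a b : (forall t, a <= t <= b -> f t = g t) ->
  pl_on f a b -> pl_on g a b.
Proof.
move=> fg pf; elim: pf fg => {a b}[a b m ab lin|a b c pab IHa pbc IHb] fg.
  apply: (@pl_linear _ _ _ _ m) => // t tab.
  by rewrite -(fg t tab) (lin t tab) (fg a) // lexx ltW.
have ab := ltW (pl_on_lt pab); have bc := ltW (pl_on_lt pbc).
apply: (@pl_concat _ _ _ b); [apply: IHa|apply: IHb] => t /andP[t1 t2]; apply: fg.
  by rewrite t1 (le_trans t2).
by rewrite t2 (le_trans ab).
Qed.

Lemma pl_on_cst (x : R) a b : a < b -> pl_on (fun=> x) a b.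
Proof. by move=> ab; apply: (@pl_linear _ _ _ _ 0) => // t _; rewrite mul0r addr0. Qed.

Lemma pl_on_restrict g a b c d : pl_on g a b -> a <= c -> c < d -> d <= b ->
  pl_on g c d.
Proof.
move=> pg; elim: pg c d => {a b}[a b m ab lin|a b e pab IHa pbe IHb] c d ac cd db.
  apply: (@pl_linear _ _ _ _ m) => // t /andP[ct td].
  rewrite (lin t) ?(le_trans ac) ?(le_trans td) // (lin c) ?ac ?(le_trans (ltW cd)) //.
  ring.
have [dleb|bd] := leP d b; first exact: IHa.
have [bc|cb] := leP b c; first exact: IHb.
by apply: (@pl_concat _ _ _ b); [apply: IHa|apply: IHb].
Qed.

Lemma pl_on_addl f g a b m : a < b ->
  (forall t, a <= t <= b -> f t = f a + m%:~R * (t - a)) ->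
  pl_on g a b -> pl_on (fun t => f t + g t) a b.
Proof.
move=> ab lin pg; elim: pg ab lin => {a b}[a b n ab gn|a b c pab IHa pbc IHb] ac lin.
  apply: (@pl_linear _ _ _ _ (m + n)) => // t tab.
  by rewrite lin // gn // rmorphD /=; ring.
have ab := pl_on_lt pab; have bc := pl_on_lt pbc.
apply: (@pl_concat _ _ _ b); [apply: IHa => // t|apply: IHb => // t] => /andP[t1 t2].
  by apply: lin; rewrite t1 (le_trans t2) ?ltW.
rewrite (lin t) ?t2 ?(le_trans (ltW ab)) // (lin b) ?(ltW ab) ?ltW //.
ring.
Qed.

Lemma pl_onD f g a b : pl_on f a b -> pl_on g a b -> pl_on (fun t => f t + g t) a b.
Proof.
elim=> {a b}[a b m ab lin|a b c pab IHa pbc IHb] pg; first exact: pl_on_addl lin pg.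
have ab := pl_on_lt pab; have bc := pl_on_lt pbc.
by apply: (@pl_concat _ _ _ b); [apply: IHa|apply: IHb];
  apply: pl_on_restrict pg _ _ _ => //; rewrite ltW.
Qed.

Lemma pl_onN g a b : pl_on g a b -> pl_on (fun t => - g t) a b.
Proof.
elim=> {a b}[a b m ab lin|a b c _ IHa _ IHb]; last exact: pl_concat IHa IHb.
by apply: (@pl_linear _ _ _ _ (- m)) => // t /lin ->; rewrite rmorphN /=; ring.
Qed.

Lemma pl_on_rev g a b c : pl_on g a b -> pl_on (fun t => g (c - t)) (c - b) (c - a).
Proof.
elim=> {a b}[a b m ab lin|a b d _ IHa _ IHb]; last exact: pl_concat IHb IHa.
apply: (@pl_linear _ _ _ _ (- m)); first by rewrite ltrD2l ltrN2.
move=> t /andP[bt ta]; rewrite lin; last by apply/andP; split; lra.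
by rewrite subKr (lin b) ?lexx ?(ltW ab) // rmorphN /=; ring.
Qed.

Lemma pl_on_slope g a b t : pl_on g a b -> a <= t -> t < b ->
  exists m, slope_at g t m.
Proof.
elim=> {a b}[a b m ab lin|a b c pab IHa pbc IHb] at_ tb.
  exists m, (b - t); first by rewrite subr_gt0.
  move=> u /andP[u0 ub]; rewrite (lin (t + u)); last by apply/andP; split; lra.
  by rewrite (lin t) ?at_ ?ltW //; ring.
by have [/IHa[//|m ?]|/IHb[//|m ?]] := ltP t b; exists m.
Qed.

Lemma right_slope_rev g t c :
  right_slope (fun u => g (c - u)) (c - t) = right_slope (fun u => g (- u)) (- t).
Proof.
rewrite /right_slope; congr (xget 0 _); apply/funext => m; apply/propext.
by apply: iff_sym; apply: left_slope_atE.
Qed.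

(** The second term is the slope leaving t to the left, so this is the order of g at an interior
    point. *)
Definition kink g t : int := right_slope g t + right_slope (fun u => g (- u)) (- t).

(** By induction on the pieces, the junction of two pieces joining the breakpoints: the end slopes
    of the pieces that meet there add up to its kink. The vanishing sum of orders is the
    contribution of one edge to the degree of a principal divisor. *)
Lemma pl_on_breakpoints g a b : pl_on g a b ->
  exists s : seq R, [/\ uniq s, forall t, t \in s -> a < t < b,
    forall t, a < t < b -> t \notin s -> kink g t = 0,
    right_slope g a + right_slope (fun u => g (- u)) (- b) + \sum_(t <- s) kink g t = 0
  & g b = g a + (right_slope g a)%:~R * (b - a) + \sum_(t <- s) (kink g t)%:~R * (b - t)].
Proof.
elim=> {a b}[a b m ab lin|a b c pab [s1 [u1 in1 out1 sl1 val1]] pbc [s2 [u2 in2 out2 sl2 val2]]].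
  have slR t : a <= t < b -> right_slope g t = m.
    move=> /andP[at_ tb]; apply: right_slopeE; exists (b - t); first by rewrite subr_gt0.
    move=> u /andP[u0 ub]; rewrite (lin (t + u)); last by apply/andP; split; lra.
    by rewrite (lin t) ?at_ ?ltW //; ring.
  have slL t : a < t <= b -> right_slope (fun u => g (- u)) (- t) = - m.
    move=> /andP[at_ tb]; apply: right_slopeE; exists (t - a); first by rewrite subr_gt0.
    move=> u /andP[u0 ub]; rewrite (lin (- (- t + u))); last by apply/andP; split; lra.
    by rewrite opprK (lin t) ?tb ?ltW // rmorphN /=; ring.
  exists [::]; split=> //.
  - move=> t /andP[at_ tb] _; rewrite /kink slR ?ltW // slL ?at_ ?ltW //.
    by rewrite subrr.
  - by rewrite big_nil slR ?lexx // slL ?ab ?lexx // addr0 subrr.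
  - by rewrite big_nil addr0 slR ?lexx // lin // lexx ltW.
have ab := pl_on_lt pab; have bc := pl_on_lt pbc.
exists (s1 ++ b :: s2); split.
- rewrite cat_uniq u1 /= u2 andbT; apply/andP; split; last first.
    by apply/negP => /in2; rewrite ltxx.
  rewrite negb_or; apply/andP; split; first by apply/negP => /in1; rewrite ltxx andbF.
  apply/hasPn => t /in2/andP[bt _]; apply/negP => /in1/andP[_ tb].
  by have := lt_trans bt tb; rewrite ltxx.
- move=> t; rewrite mem_cat inE => /or3P[/in1/andP[-> tb]|/eqP->|/in2/andP[bt ->]].
  + exact: lt_trans bc.
  + by rewrite ab.
  + by rewrite andbT; apply: lt_trans bt.
- move=> t /andP[at_ tc]; rewrite mem_cat inE !negb_or => /and3P[t1 tb t2].
  have [ltb|gtb|etb] := ltgtP t b.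
  + by apply: out1; rewrite ?at_.
  + by apply: out2; rewrite ?tc ?gtb.
  + by rewrite etb eqxx in tb.
- rewrite big_cat big_cons /=; have kb : kink g b = right_slope g b + right_slope (fun u => g (- u)) (- b) by [].
  by move: (kink g b) kb sl1 sl2 => k; do 2 move: (\sum_(t <- _) _) => ?; lia.
- rewrite big_cat big_cons /= val2 val1.
  have -> : kink g b = right_slope g b + right_slope (fun u => g (- u)) (- b) by [].
  have -> : \sum_(t <- s1) (kink g t)%:~R * (c - t) =
     \sum_(t <- s1) (kink g t)%:~R * (b - t) + (\sum_(t <- s1) kink g t)%:~R * (c - b).
    by rewrite rmorph_sum /= mulr_suml -big_split; apply: eq_bigr => t _ /=; ring.
  have -> : \sum_(t <- s1) kink g t =
      - right_slope g a - right_slope (fun u => g (- u)) (- b) by lia.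
  rewrite !(rmorphD, rmorphB, rmorphN) /=; ring.
Qed.

(** For breakpoints u > 0, the function with value x and slope m at 0 whose slope increases by [d u]
    at each u in [s]. *)
Definition pl_fun (x : R) m (d : R -> int) (s : seq R) t : R :=
  x + m%:~R * t + \sum_(u <- s) (d u)%:~R * Num.max 0 (t - u).

Lemma slope_at_hinge u t : slope_at (fun s => Num.max 0 (s - u)) t (u <= t)%R%:Z.
Proof.
have [ut|tu] := leP u t.
  exists 1 => // s /andP[s0 _]; rewrite !max_r ?subr_ge0 // ?mul1r; first ring.
  lra.
exists (u - t); first by rewrite subr_gt0.
by move=> s /andP[s0 su]; rewrite !max_l ?mul0r ?addr0 //; lra.
Qed.

Lemma left_slope_at_hinge u t :
  left_slope_at (fun s => Num.max 0 (s - u)) t (- (u < t)%R%:Z).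
Proof.
have [ut|tu] := ltP u t.
  exists (t - u); first by rewrite subr_gt0.
  move=> s /andP[s0 su]; rewrite opprK !max_r //; try lra.
  by rewrite rmorphN /=; ring.
exists 1 => // s /andP[s0 _]; rewrite opprK !max_l ?rmorphN ?mul0r ?oppr0 ?addr0 //; try lra.
Qed.

Lemma slope_atZ g t m n : slope_at g t m -> slope_at (fun s => n%:~R * g s) t (n * m).
Proof.
by case=> h h0 gm; exists h => // u /gm ->; rewrite rmorphM /=; ring.
Qed.

Lemma slope_at_pl_fun x m d s t :
  slope_at (pl_fun x m d s) t (m + \sum_(u <- s) d u * (u <= t)%R%:Z).
Proof.
apply: slope_atD; last by apply: slope_at_sum => u; apply/slope_atZ/slope_at_hinge.
by exists 1 => // u _; ring.
Qed.

Lemma left_slope_at_pl_fun x m d s t :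
  left_slope_at (pl_fun x m d s) t (- m - \sum_(u <- s) d u * (u < t)%R%:Z).
Proof.
rewrite -sumrN /left_slope_at /pl_fun.
apply: slope_atD; last first.
  apply: slope_at_sum => u; rewrite -mulrN.
  by apply: slope_atZ; apply: left_slope_at_hinge.
by exists 1 => // u _; rewrite rmorphN /=; ring.
Qed.

Lemma pl_on_pl_fun x m d s b : 0 < b -> (forall u, u \in s -> 0 < u < b) ->
  pl_on (pl_fun x m d s) 0 b.
Proof.
move=> b0 sb; apply: pl_onD.
  by apply: (@pl_linear _ _ _ _ m) => // t _; ring.
elim: s sb => [|u s IH] sb.
  apply: (@eq_pl_on (fun=> 0)); last exact: pl_on_cst.
  by move=> t _; rewrite big_nil.
apply: (@eq_pl_on (fun t => (d u)%:~R * Num.max 0 (t - u) +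
    \sum_(v <- s) (d v)%:~R * Num.max 0 (t - v))).
  by move=> t _; rewrite big_cons.
apply: pl_onD; last by apply: IH => v vs; apply: sb; rewrite inE vs orbT.
have /andP[u0 ub] := sb u (mem_head _ _).
apply: (@pl_concat _ _ _ u).
  apply: (@pl_linear _ _ _ _ 0) => // t /andP[t0 tu].
  by rewrite !max_l ?mulr0 ?mul0r ?addr0 //; lra.
apply: (@pl_linear _ _ _ _ (d u)) => // t /andP[ut tb].
by rewrite !max_r //; try ring; lra.
Qed.

End PiecewiseLinear.

Lemma eq_big_support (K : eqType) (A : nmodType) (r s : seq K) (F : K -> A) :
  uniq r -> uniq s -> (forall p, p \notin r -> F p = 0) ->
  (forall p, p \notin s -> F p = 0) -> \sum_(p <- r) F p = \sum_(p <- s) F p.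
Proof.
move=> ur us Fr Fs.
have part (r' s' : seq K) : (forall p, p \notin s' -> F p = 0) ->
    \sum_(p <- r') F p = \sum_(p <- [seq p <- r' | p \in s']) F p.
  move=> F0; rewrite big_filter [RHS]big_mkcond; apply: eq_bigr => p _.
  by case: ifP => // /negbT/F0.
rewrite (part r s) // (part s r) //; apply: perm_big; apply: uniq_perm.
- exact: filter_uniq.
- exact: filter_uniq.
by move=> p; rewrite !mem_filter andbC.
Qed.

(** * Metric graphs *)

Section MetricGraphs.
Variables (R : realType) (G : metric_graph R).
Local Notation V := (vertex G).
Local Notation E := (edge G).
Implicit Types (f : mpoint G -> R) (e : E) (t : R).

Lemma edge_point_le0 e t : t <= 0 -> edge_point e t = inl (endpoint e false).
Proof.
move=> t0; rewrite /edge_point insubF /=; last by rewrite ltNge t0.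
by rewrite ltNge t0.
Qed.

Lemma edge_point_ge_len e t : len e <= t -> edge_point e t = inl (endpoint e true).
Proof.
move=> et; rewrite /edge_point insubF /=; last by rewrite [t < _]ltNge et andbF.
by rewrite (lt_le_trans (len_gt0 e)).
Qed.

Lemma edge_pointP e t : 0 < t < len e ->
  exists2 y, edge_point e t = inr y & val y = (e, t).
Proof. by move=> te; rewrite /edge_point insubT; exists (Sub (e, t) te). Qed.

Lemma mpointP (P : mpoint G -> Prop) : (forall x, P (inl x)) ->
  (forall e t, 0 < t < len e -> P (edge_point e t)) -> forall p, P p.
Proof.
move=> Pl Pe [x|y]; first exact: Pl.
have := valP y; case yE : (val y) => [e t] /= te; have := Pe e t te.
have [z -> zE] := edge_pointP te; congr (P (inr _)); apply: val_inj.
by rewrite yE zE.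
Qed.

Lemma edge_point_inj e e' t t' : 0 < t < len e -> 0 < t' < len e' ->
  edge_point e t = edge_point e' t' -> (e, t) = (e', t').
Proof.
by move=> /edge_pointP[y -> <-] /edge_pointP[y' -> <-] [->].
Qed.

Lemma mpoint_sum (A : nmodType) (F : mpoint G -> A) (r : seq (mpoint G))
    (T : E -> seq R) : uniq r -> (forall p, p \notin r -> F p = 0) ->
  (forall e, uniq (T e)) -> (forall e t, t \in T e -> 0 < t < len e) ->
  (forall e t, 0 < t < len e -> t \notin T e -> F (edge_point e t) = 0) ->
  \sum_(p <- r) F p =
  \sum_x F (inl x) + \sum_e \sum_(t <- T e) F (edge_point e t).
Proof.
move=> ur Fr uT Tlen FT.
pose S : seq (mpoint G) := [seq inl x | x <- enum V] ++ [seq edge_point e t | e <- enum E, t <- T e].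
rewrite (eq_big_support (s := S) ur _ Fr); last 2 first.
- rewrite cat_uniq map_inj_uniq ?enum_uniq => [|x y []//]; rewrite /=.
  apply/andP; split.
    apply/hasPn => p /allpairsPdep[e [t [_ /Tlen/edge_pointP[y py _] ->]]].
    by rewrite py; apply/mapP => -[].
  apply: allpairs_uniq_dep; [exact: enum_uniq|by move=> e _; apply: uT|].
  move=> _ _ /allpairsPdep[e [t [_ te ->]]] /allpairsPdep[e' [t' [_ te' ->]]] /=.
  by move=> /(edge_point_inj (Tlen _ _ te) (Tlen _ _ te'))[-> ->].
- apply: mpointP => [x|e t te]; rewrite mem_cat negb_or.
    by rewrite (map_f inl) // mem_enum.
  move=> /andP[_ nt]; apply: FT => //; apply: contra nt => tT.
  by apply/allpairsPdep; exists e, t; rewrite mem_enum.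
rewrite big_cat big_map big_enum /=; congr (_ + _).
by rewrite big_allpairs_dep big_enum.
Qed.

Lemma deg_mpoint (D : {freeg (mpoint G)}) (T : E -> seq R) :
  (forall e, uniq (T e)) -> (forall e t, t \in T e -> 0 < t < len e) ->
  (forall e t, 0 < t < len e -> t \notin T e -> coeff (edge_point e t) D = 0) ->
  deg D = \sum_x coeff (inl x) D + \sum_e \sum_(t <- T e) coeff (edge_point e t) D.
Proof.
move=> uT Tlen DT; rewrite -(mpoint_sum (F := fun p => coeff p D) (uniq_dom D)) //.
  rewrite -{1}[D]freeg_sumE raddf_sum /=; apply: eq_bigr => p _.
  by rewrite degU.
by move=> p; apply: coeff_outdom.
Qed.

Lemma rational_from f e b : rational f ->
  pl_on (fun s => f (point_from e b s)) 0 (len e).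
Proof.
move=> /(_ e) fe; case: b => //=.
by have := pl_on_rev (len e) fe; rewrite subrr subr0.
Qed.

Lemma directions_lt (p : mpoint G) d : d \in directions p -> 0 <= d.2 < len d.1.1.
Proof.
case: p => [x /mapP[e _ ->]|[[e t] /= /andP[t0 te]]]; first by rewrite lexx len_gt0.
by rewrite !inE => /orP[/eqP->|/eqP->] /=; apply/andP; split; lra.
Qed.

Lemma rational_slope f (p : mpoint G) d : rational f -> d \in directions p ->
  exists m, slope_at (fun s => f (point_from d.1.1 d.1.2 s)) d.2 m.
Proof.
move=> rf /directions_lt/andP[d0 dl].
exact: pl_on_slope (rational_from _ _ rf) d0 dl.
Qed.

Definition edge_slope f (d : E * bool) : int :=
  right_slope (fun s => f (point_from d.1 d.2 s)) 0.

Lemma metric_divisor_inl f (x : V) :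
  metric_divisor f (inl x) = \sum_(d <- half_edges x) edge_slope f d.
Proof. by rewrite /metric_divisor /= big_map. Qed.

Lemma metric_divisor_edge f e t : 0 < t < len e ->
  metric_divisor f (edge_point e t) = kink (fun s => f (edge_point e s)) t.
Proof.
move=> te; have [y -> yE] := edge_pointP te.
rewrite /metric_divisor /= yE big_cons big_seq1 /kink; congr (_ + _).
exact: (right_slope_rev (fun s => f (edge_point e s))).
Qed.

Lemma edge_slope_true f e : edge_slope f (e, true) =
  right_slope (fun u => f (edge_point e (- u))) (- len e).
Proof.
have := right_slope_rev (fun s => f (edge_point e s)) (len e) (len e).
by rewrite subrr.
Qed.

Lemma metric_function_theory : @function_theory (metric_theory G) R
  (@rational R G) (@metric_divisor R G).
Proof.
split.
- by move=> D D'; split=> [[f rf fD]|[f rf fD]]; exists f.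
- move=> a; split=> [e|p]; first exact/pl_on_cst/len_gt0.
  by apply: big1 => d _; apply: right_slopeE; apply: slope_at_cst.
- move=> f g rf rg; split=> [e|p].
    by apply: pl_onD (rf e) _; apply: pl_onN.
  rewrite /metric_divisor -sumrB !big_seq; apply: eq_bigr => d dp.
  have [m fm] := rational_slope rf dp; have [n gn] := rational_slope rg dp.
  rewrite (right_slopeE fm) (right_slopeE gn); apply: right_slopeE.
  by apply: slope_atD fm _; apply: slope_atN.
- move=> D f rf fD; have [T hT] := choice (fun e => pl_on_breakpoints (rf e)).
  rewrite (@deg_mpoint D T); last 3 first.
  + by move=> e; case: (hT e).
  + by move=> e; case: (hT e).
  + by move=> e t te tT; rewrite fD metric_divisor_edge //; case: (hT e) => _ _ ->.
  under eq_bigr do rewrite fD metric_divisor_inl.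
  rewrite sum_half_edges -big_split big1 // => e _ /=.
  have [_ inT _ sl _] := hT e; rewrite edge_slope_true -[RHS]sl; congr (_ + _).
  by rewrite !big_seq; apply: eq_bigr => t /inT te; rewrite fD metric_divisor_edge.
Qed.

End MetricGraphs.

(** * Gluing of metric graphs *)

Section MetricGlueTheory.
Variables (R : realType) (G1 G2 : metric_graph R).
Local Notation G := (metric_glue G1 G2).

Definition glue_point1 (p : mpoint G1) : mpoint G :=
  match p with
  | inl x => inl (glue_inl G2 x : vertex G)
  | inr y => edge_point (inl (val y).1 : edge G) (val y).2
  end.

Definition glue_point2 (p : mpoint G2) : mpoint G :=
  match p with
  | inl x => inl (glue_inr G1 x : vertex G)
  | inr y => edge_point (inr (val y).1 : edge G) (val y).2
  end.

Lemma glue_point1_edge e t :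
  glue_point1 (edge_point e t) = edge_point (inl e : edge G) t.
Proof.
have [t0|t0] := leP t 0; first by rewrite !edge_point_le0.
have [et|te] := leP (len e) t; first by rewrite !edge_point_ge_len.
by have [|y -> yE] := @edge_pointP _ _ e t; rewrite ?t0 // /glue_point1 yE.
Qed.

Lemma glue_point2_edge e t :
  glue_point2 (edge_point e t) = edge_point (inr e : edge G) t.
Proof.
have [t0|t0] := leP t 0; first by rewrite !edge_point_le0.
have [et|te] := leP (len e) t; first by rewrite !edge_point_ge_len.
by have [|y -> yE] := @edge_pointP _ _ e t; rewrite ?t0 // /glue_point2 yE.
Qed.

Lemma edge_point_neq_vertex (H : metric_graph R) (e : edge H) t (x : vertex H) :
  0 < t < len e -> edge_point e t <> inl x.
Proof. by move=> /edge_pointP[y -> _]. Qed.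

Lemma glue_point1_inj : injective glue_point1.
Proof.
apply: mpointP => [x|e t te]; apply: mpointP => [x'|e' t' te'].
- by case=> ->.
- by rewrite glue_point1_edge => /esym/(@edge_point_neq_vertex G (inl e') _ _ te').
- by rewrite glue_point1_edge => /(@edge_point_neq_vertex G (inl e) _ _ te).
rewrite !glue_point1_edge.
by move=> /(@edge_point_inj _ G (inl e) (inl e') _ _ te te')[-> ->].
Qed.

Lemma glue_point2_inj : injective glue_point2.
Proof.
apply: mpointP => [x|e t te]; apply: mpointP => [x'|e' t' te'].
- by case=> /glue_inr_inj->.
- by rewrite glue_point2_edge => /esym/(@edge_point_neq_vertex G (inr e') _ _ te').
- by rewrite glue_point2_edge => /(@edge_point_neq_vertex G (inr e) _ _ te).
rewrite !glue_point2_edge.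
by move=> /(@edge_point_inj _ G (inr e) (inr e') _ _ te te')[-> ->].
Qed.

Lemma glue_point12 p q : glue_point1 p = glue_point2 q <->
  p = inl (wmark G1) /\ q = inl (vmark G2).
Proof.
split=> [|[-> ->]]; last by rewrite /= glue_inr_mark.
move: p q; apply: mpointP => [x|e t te]; apply: mpointP => [y|e' t' te'].
- by case=> /glue_inlr[-> ->].
- by rewrite glue_point2_edge => /esym/(@edge_point_neq_vertex G (inr e') _ _ te').
- by rewrite glue_point1_edge => /(@edge_point_neq_vertex G (inl e) _ _ te).
rewrite glue_point1_edge glue_point2_edge.
by move=> /(@edge_point_inj _ G (inl e) (inr e') _ _ te te').
Qed.

Lemma glue_point_onto z :
  (exists p, z = glue_point1 p) \/ (exists q, z = glue_point2 q).
Proof.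
move: z; apply: mpointP => [z|[e|e] t te].
- apply: (glue_vertexP (P := fun z => (exists p, inl z = glue_point1 p) \/
    (exists q, inl z = glue_point2 q))) => [x|y _].
    by left; exists (inl x).
  by right; exists (inl y).
- by left; exists (edge_point e t); rewrite glue_point1_edge.
- by right; exists (edge_point e t); rewrite glue_point2_edge.
Qed.

Lemma rational_glue (f : mpoint G -> R) :
  rational f <-> rational (f \o glue_point1) /\ rational (f \o glue_point2).
Proof.
have E1 e : (fun t => f (edge_point (inl e : edge G) t)) =
    (fun t => (f \o glue_point1) (edge_point e t)).
  by apply/funext => t /=; rewrite glue_point1_edge.
have E2 e : (fun t => f (edge_point (inr e : edge G) t)) =
    (fun t => (f \o glue_point2) (edge_point e t)).
  by apply/funext => t /=; rewrite glue_point2_edge.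
split=> [rf|[r1 r2] [e|e]]; last 2 first.
- by rewrite E1; apply: r1.
- by rewrite E2; apply: r2.
by split=> e; [rewrite -E1; apply: (rf (inl e))|rewrite -E2; apply: (rf (inr e))].
Qed.

Lemma edge_slope_glue1 (f : mpoint G -> R) d :
  edge_slope f (inl d.1 : edge G, d.2) = edge_slope (f \o glue_point1) d.
Proof.
by congr right_slope; apply/funext => s /=; rewrite /point_from glue_point1_edge.
Qed.

Lemma edge_slope_glue2 (f : mpoint G -> R) d :
  edge_slope f (inr d.1 : edge G, d.2) = edge_slope (f \o glue_point2) d.
Proof.
by congr right_slope; apply/funext => s /=; rewrite /point_from glue_point2_edge.
Qed.

Lemma metric_divisor_glue_vertex (f : mpoint G -> R) (x : vertex G1) :
  metric_divisor f (glue_point1 (inl x)) =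
  metric_divisor (f \o glue_point1) (inl x) +
  (if x == wmark G1 then metric_divisor (f \o glue_point2) (inl (vmark G2)) else 0).
Proof.
rewrite !metric_divisor_inl glue_half_edges_inl; congr (_ + _).
  by apply: eq_bigr => d _; rewrite edge_slope_glue1.
by case: ifP => // _; apply: eq_bigr => d _; rewrite edge_slope_glue2.
Qed.

Lemma metric_divisor_glue1 (f : mpoint G -> R) p : p <> inl (wmark G1) ->
  metric_divisor f (glue_point1 p) = metric_divisor (f \o glue_point1) p.
Proof.
move: p; apply: mpointP => [x xw|e t te _].
  rewrite metric_divisor_glue_vertex; case: eqP => [xE|]; last by rewrite addr0.
  by rewrite xE in xw.
rewrite glue_point1_edge (@metric_divisor_edge R G f (inl e)) // metric_divisor_edge //.
by congr kink; apply/funext => s /=; rewrite glue_point1_edge.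
Qed.

Lemma metric_divisor_glue2 (f : mpoint G -> R) p : p <> inl (vmark G2) ->
  metric_divisor f (glue_point2 p) = metric_divisor (f \o glue_point2) p.
Proof.
move: p; apply: mpointP => [y yv|e t te _].
  rewrite !metric_divisor_inl glue_half_edges_inr; last first.
    by apply/eqP => yE; rewrite yE in yv.
  by apply: eq_bigr => d _; rewrite edge_slope_glue2.
rewrite glue_point2_edge (@metric_divisor_edge R G f (inr e)) // metric_divisor_edge //.
by congr kink; apply/funext => s /=; rewrite glue_point2_edge.
Qed.

Lemma metric_canonicalE (H : metric_graph R) :
  metric_canonical H = push (inl : vertex H -> mpoint H) (vertex_canonical H).
Proof.
by rewrite raddf_sum; apply: eq_bigr => x _; rewrite /= pushU.
Qed.

Lemma metric_glue_general (k : nat) : k <> 1%N ->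
  k_general_transmission k (metric_theory G1) ->
  k_general_transmission k (metric_theory G2) ->
  k_general_transmission k (metric_theory G).
Proof.
move=> k1; have ft1 := metric_function_theory G1.
have ft2 := metric_function_theory G2; have ft := metric_function_theory G.
apply: (glue_k_general_transmission (function_theory_good ft1)
  (function_theory_good ft2) (function_theory_good ft) _ k1).
apply: (function_gluing ft1 ft2 ft).
- exact: glue_point1_inj.
- exact: glue_point2_inj.
- exact: glue_point12.
- exact: glue_point_onto.
- by [].
- by [].
- by move=> f /rational_glue.
- by move=> f r1 r2; apply/rational_glue.
- exact: metric_divisor_glue1.
- exact: metric_divisor_glue2.
- by move=> f; rewrite metric_divisor_glue_vertex eqxx.
- rewrite /= !metric_canonicalE glue_vertex_canonical !raddfD /=.
  by rewrite !push_comp !pushU mulr2n.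
- exact: glue_betti1.
Qed.

End MetricGlueTheory.

(** * Metric graphs of genus one *)

Section MetricGenusOne.
Variables (R : realType) (G : metric_graph R).
Hypothesis b1 : betti1 G = 1%N.
Variables (theta : vertex G -> R) (c : edge G -> int) (L : R).
Hypothesis cc : cycle_coordinates (@len R G) theta c L.

Definition point_position (p : mpoint G) : R :=
  match p with
  | inl x => theta x
  | inr y => theta (endpoint (val y).1 true) +
             (c (val y).1)%:~R * (len (val y).1 - (val y).2)
  end.

Definition total_position (D : {freeg (mpoint G)}) : R :=
  \sum_(p <- dom D) (coeff p D)%:~R * point_position p.

Lemma point_position_edge (e : edge G) t : 0 <= t <= len e -> exists i : int,
  point_position (edge_point e t) =
  theta (endpoint e true) + (c e)%:~R * (len e - t) + i%:~R * L.
Proof.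
move=> /andP[t0 tl]; have [t00|tn0] := eqVneq t 0.
  have [i dE] := cycle_edge cc e; exists i.
  by rewrite edge_point_le0 t00 //= dE subr0.
have [tll|tnl] := eqVneq t (len e).
  by exists 0; rewrite edge_point_ge_len tll //= subrr; ring.
have [|y -> yE] := @edge_pointP _ _ e t; first by rewrite !lt_neqAle t0 tl tnl eq_sym tn0.
by exists 0; rewrite /point_position yE /= mul0r addr0.
Qed.

Lemma total_positionE D (s : seq (mpoint G)) : uniq s ->
  {subset dom D <= s} ->
  total_position D = \sum_(p <- s) (coeff p D)%:~R * point_position p.
Proof.
move=> us Ds; apply: eq_big_support us _ _; first exact: uniq_dom.
  by move=> p /coeff_outdom->; rewrite mul0r.
by move=> p ps; rewrite coeff_outdom ?mul0r //; apply: contra ps => /Ds.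
Qed.

Lemma total_positionB D p :
  total_position (D - << p >>) = total_position D - point_position p.
Proof.
pose s := undup (p :: dom D).
have us : uniq s by apply: undup_uniq.
rewrite (total_positionE (s := s)) //; last first.
  move=> q /domB; rewrite domU1 mem_cat mem_undup !inE => /orP[->|->] //.
  by rewrite orbT.
rewrite (total_positionE (s := s) (D := D)) //; last first.
  by move=> q qD; rewrite mem_undup inE qD orbT.
under eq_bigr do rewrite coeffB coeffU mul1r rmorphB /= mulrBl.
rewrite sumrB; congr (_ - _); rewrite (bigD1_seq p) //= ?mem_undup ?mem_head //.
rewrite eqxx mul1r big1 ?addr0 // => q /negbTE qp.
by rewrite eq_sym qp mul0r.
Qed.

Definition interior_support (D : {freeg (mpoint G)}) (e : edge G) : seq R :=
  undup (pmap (fun p : mpoint G => if p is inr y then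
    if (val y).1 == e then Some (val y).2 else None else None) (dom D)).

Lemma mem_interior_support D e t :
  t \in interior_support D e -> 0 < t < len e.
Proof.
rewrite mem_undup mem_pmap => /mapP[[x|[[e' t'] /= te]]] //= _.
by case: eqP te => // -> te [->].
Qed.

Lemma coeff_interior_support D e t : 0 < t < len e ->
  t \notin interior_support D e -> coeff (edge_point e t) D = 0.
Proof.
move=> te; rewrite mem_undup mem_pmap => tn; apply: coeff_outdom; apply: contra tn => pD.
apply/mapP; exists (edge_point e t) => //.
by have [y -> ->] := edge_pointP te; rewrite eqxx.
Qed.

(** The potential on vertices is extended over each edge by the function with initial slope [m e]
    and the coefficients of D as kinks. The equation for [h] says that it reaches the right value at
    the far end, where its outgoing slope is [- m e - delta e]. *)
Lemma metric_principal (D : {freeg (mpoint G)}) (j : int) :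
  deg D = 0 -> total_position D = j%:~R * L -> metric_lin_equiv D 0.
Proof.
pose T := interior_support D; pose d e t := coeff (edge_point e t) D.
have uT e : uniq (T e) by apply: undup_uniq.
have inT e t : t \in T e -> 0 < t < len e by apply: mem_interior_support.
have outT e t : 0 < t < len e -> t \notin T e -> d e t = 0.
  exact: coeff_interior_support.
pose delta e := \sum_(t <- T e) d e t.
pose M e := \sum_(t <- T e) (d e t)%:~R * (len e - t).
rewrite (deg_mpoint uT inT outT) => dD AJ.
have [|h [m [hm Dm]]] := cycle_principal cc (D0 := fun x => coeff (inl x) D)
    (delta := delta) (M := M) (j := j) dD.
  rewrite -AJ /total_position (mpoint_sum (uniq_dom D) _ uT inT); last 2 first.
  - by move=> p /coeff_outdom->; rewrite mul0r.
  - by move=> e t te /(outT _ _ te); rewrite /d => ->; rewrite mul0r.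
  congr (_ + _); apply: eq_bigr => e _.
  rewrite /delta /M rmorph_sum /= mulr_suml mulr_sumr -big_split /= !big_seq.
  apply: eq_bigr => t /inT te; rewrite -/(d e t).
  by have [y -> yE] := edge_pointP te; rewrite /point_position yE /=; ring.
pose F e := pl_fun (h (endpoint e false)) (m e) (d e) (T e).
pose f (p : mpoint G) := match p with
  | inl x => h x | inr y => F (val y).1 (val y).2 end.
have fF e t : 0 <= t <= len e -> f (edge_point e t) = F e t.
  move=> /andP[t0 tl]; have [t00|tn0] := eqVneq t 0.
    rewrite edge_point_le0 t00 //= /F /pl_fun mulr0 addr0 big_seq big1 ?addr0 // => u.
    by move=> /inT/andP[u0 _]; rewrite max_l ?mulr0 //; lra.
  have [tll|tnl] := eqVneq t (len e).
    rewrite edge_point_ge_len tll //= /F /pl_fun.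
    have -> : \sum_(u <- T e) (d e u)%:~R * Num.max 0 (len e - u) = M e.
      rewrite /M !big_seq; apply: eq_bigr => u /inT/andP[_ ul].
      by rewrite max_r //; lra.
    by have := hm e; lra.
  have [|y -> yE] := @edge_pointP _ _ e t; first by rewrite !lt_neqAle t0 tl tnl eq_sym tn0.
  by rewrite /f yE.
have len0 e : 0 < len e := len_gt0 e.
have slopeR e t : 0 <= t < len e ->
    slope_at (fun s => f (edge_point e s)) t (m e + \sum_(u <- T e) d e u * (u <= t)%R%:Z).
  move=> /andP[t0 tl]; apply: (@eq_slope_at _ (F e) _ _ _ (len e - t)).
  - by rewrite subr_gt0.
  - by move=> u /andP[u0 ul]; rewrite fF //; apply/andP; split; lra.
  exact: slope_at_pl_fun.
have slopeL e t : 0 < t <= len e ->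
    left_slope_at (fun s => f (edge_point e s)) t (- m e - \sum_(u <- T e) d e u * (u < t)%R%:Z).
  move=> /andP[t0 tl]; apply: (@eq_slope_at _ (fun u => F e (- u)) _ _ _ t) => //.
    by move=> u /andP[u0 ul]; rewrite fF //; apply/andP; split; lra.
  exact: left_slope_at_pl_fun.
exists f.
  move=> e; apply: (@eq_pl_on _ (F e)); last by apply: pl_on_pl_fun; [exact: len0|exact: inT].
  by move=> t te; rewrite -fF.
apply: mpointP => [x|e t te]; rewrite subr0.
  rewrite Dm metric_divisor_inl; apply: eq_bigr => -[e b] _ /=.
  case: b => /=.
    rewrite edge_slope_true (right_slopeE (slopeL e (len e) _)) ?len0 ?lexx //.
    congr (_ - _); rewrite /delta !big_seq; apply: eq_bigr => u /inT/andP[_ ->].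
    by rewrite mulr1.
  rewrite /edge_slope /point_from (right_slopeE (slopeR e 0 _)) ?lexx ?len0 //.
  rewrite big_seq big1 ?addr0 // => u /inT/andP[u0 _].
  by rewrite leNgt u0 mulr0.
rewrite metric_divisor_edge // /kink; case/andP: (te) => t0 tl.
rewrite (right_slopeE (slopeR e t _)) ?tl ?ltW // (right_slopeE (slopeL e t _)) ?t0 ?ltW //.
(* The two outgoing slopes cancel except for a hinge at t itself. *)
have -> : m e + \sum_(u <- T e) d e u * (u <= t)%R%:Z +
    (- m e - \sum_(u <- T e) d e u * (u < t)%R%:Z) =
    \sum_(u <- T e) d e u * (u == t)%:Z.
  rewrite addrACA subrr add0r -sumrB; apply: eq_bigr => u _.
  by rewrite -mulrBr; congr (_ * _); case: ltgtP.
rewrite -/(d e t); have [tT|tT] := boolP (t \in T e).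
  rewrite (bigD1_seq t) //= eqxx mulr1 big1 ?addr0 // => u /negbTE->.
  by rewrite mulr0.
rewrite (outT e t te tT) big_seq big1 // => u uT'; case: eqP => [ut|]; last by rewrite mulr0.
by move: tT; rewrite -ut uT'.
Qed.

Lemma metric_effective_deg1 (D : {freeg (point (metric_theory G))}) :
  deg D = 1 -> equiv_effective D.
Proof.
move=> dD; suff [p [j sp]] : exists p, exists j : int,
    total_position D = j%:~R * L + point_position p.
  exists << p >>; first by move=> q; rewrite coeffU mul1r.
  apply: ((lin_equivB (function_theory_good (metric_function_theory G)) _ _).2).
  apply: (metric_principal (j := j)); first by rewrite degB dD degU subrr.
  by rewrite total_positionB sp addrK.
have [j [[x sx]|[e [u [hu su]]]]] := cycle_onto cc (total_position D).
  by exists (inl x), j.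
have [|i pE] := @point_position_edge e (len e - u); first by apply/andP; split; lra.
exists (edge_point e (len e - u)), (j - i); rewrite su pE rmorphB /= subKr; ring.
Qed.

Lemma metric_canonical_trivial : lin_equiv (canonical (metric_theory G)) 0.
Proof.
rewrite /= metric_canonicalE; apply: (metric_principal (j := 0)).
  by rewrite deg_push deg_vertex_canonical b1.
have inl_inj : injective (inl : vertex G -> mpoint G) by move=> x y [].
rewrite /total_position (mpoint_sum (T := fun=> [::]) (uniq_dom _)) //.
- rewrite [X in _ + X]big1 => [|e _]; last by rewrite big_nil.
  rewrite mul0r addr0 -[RHS](cycle_canonical cc); apply: eq_bigr => x _.
  by rewrite coeff_push // coeff_vertex_canonical.
- by move=> p /coeff_outdom->; rewrite mul0r.
- move=> e t te _; rewrite coeff_push_out ?mul0r // => x.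
  by apply/eqP => /esym/(edge_point_neq_vertex te).
Qed.

End MetricGenusOne.

Lemma metric_genus1 (R : realType) (G : metric_graph R) (k : nat) : k <> 1%N ->
  betti1 G = 1%N ->
  ~ lin_equiv << vpt (metric_theory G) >> << wpt (metric_theory G) >> ->
  k_general_transmission k (metric_theory G) <-> torsion_order (metric_theory G) k.
Proof.
move=> k1 b1 vw; have [theta [c [L cc]]] := cycle_coordinates_exist (@len_gt0 R G) b1.
apply: genus1_k_general_transmission => //.
- exact: function_theory_good (metric_function_theory G).
- exact: metric_effective_deg1 cc.
- exact: (metric_canonical_trivial b1 cc).
Qed.

Lemma torsion_order_neq (T : divisor_theory) (k : nat) : k <> 1%N ->
  torsion_order T k -> ~ lin_equiv << vpt T >> << wpt T >>.
Proof.
move=> k1 tors vw; have /tors[m] : lin_equiv (<< vpt T >> *~ 1) (<< wpt T >> *~ 1) by [].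
move=> /esym/eqP; rewrite mulrC => /eqP mk; apply: k1.
have : (k%:Z %| 1)%Z by apply/dvdzP; exists m; rewrite mulrC.
by rewrite dvdz1 absz_nat => /eqP.
Qed.

Theorem theoremA (R : realType) (c : graph_kind) (k : nat) (k_neq1 : k <> 1%N) :
  (forall G1 G2 : marked_graph R c,
     k_general_transmission k (theory_of G1) ->
     k_general_transmission k (theory_of G2) ->
     k_general_transmission k (theory_of (vertex_gluing G1 G2)))
  /\
  (forall G : marked_graph R c,
     genus (theory_of G) = 1%N ->
     ~ lin_equiv << vpt (theory_of G) >> << wpt (theory_of G) >> ->
     (k_general_transmission k (theory_of G) <->
      torsion_order (theory_of G) k))
  /\
  (forall G : marked_graph R c,
     torsion_loop_chain k G -> k_general_transmission k (theory_of G)).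
Proof.
have glue (G1 G2 : marked_graph R c) :
    k_general_transmission k (theory_of G1) ->
    k_general_transmission k (theory_of G2) ->
    k_general_transmission k (theory_of (vertex_gluing G1 G2)).
  by case: c G1 G2 => G1 G2; [apply: finite_glue_general|apply: metric_glue_general].
have genus1 (G : marked_graph R c) : genus (theory_of G) = 1%N ->
    ~ lin_equiv << vpt (theory_of G) >> << wpt (theory_of G) >> ->
    (k_general_transmission k (theory_of G) <-> torsion_order (theory_of G) k).
  by case: c G {glue} => G; [apply: finite_genus1|apply: metric_genus1].
split=> //; split=> // G; elim=> {G}[G [b1 _] tors|G1 G2 _ kgt1 _ kgt2].
  apply/genus1 => //; last exact: torsion_order_neq k_neq1 tors.
  by case: c G b1 {tors glue genus1}.
exact: glue.
Qed.
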